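(* Let $0<\varepsilon<1$ and let $F_\varepsilon$ be the Katok--Ziller metric on the 2-sphere $\mathbb{S}^2$ given in spherical coordinates by $$F_\varepsilon(\phi,\theta;\xi_\phi,\xi_\theta)=\frac{1}{1-\varepsilon^2\sin^2\phi}\left(\sqrt{(1-\varepsilon^2\sin^2\phi)\,\xi_\phi^2+\sin^2\phi\;\xi_\theta^2}-\varepsilon\sin^2\phi\;\xi_\theta\right).$$ If $\lambda_1(\varepsilon)$ denotes the smallest non-zero eigenvalue of $-\Delta^{F_\varepsilon}$, then $$\lambda_1(\varepsilon)=2-2\varepsilon^2=\frac{8\pi}{\mathrm{vol}_\Omega(\mathbb{S}^2)},$$ where $\mathrm{vol}_\Omega(\mathbb{S}^2)=\int_{\mathbb{S}^2}\Omega^{F_\varepsilon}$.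
   Context: Coordinates on $\mathbb{S}^2$: $\phi\in[0,\pi]$ (colatitude), $\theta\in[0,2\pi]$ (longitude), with $(\xi_\phi,\xi_\theta)$ the associated coordinates on tangent spaces. $F_\varepsilon$ is the Randers metric obtained by the Katok--Ziller construction from the round metric and the rotation Killing field $\partial/\partial\theta$. For a Finsler metric $F$ on an oriented $n$-manifold $M$ (continuous $F\colon TM\to[0,\infty)$, smooth off the zero section, positively homogeneous of degree one, positive-definite, strongly convex): $HM:=(TM\smallsetminus\{\text{zero section}\})/\mathbb{R}^+$, with quotient map $r\colon TM\smallsetminus 0\to HM$, projection $\pi\colon HM\to M$, fibers $H_xM$, vertical bundle $VHM=\ker d\pi$. The Hilbert form is the contact 1-form $A$ on $HM$ with $r^*A=\frac{\partial F}{\partial v^i}dx^i$; its Reeb field $X$ satisfies $A(X)=1$, $i_XdA=0$. $HM$ is oriented by $A\wedge dA^{n-1}$ and the fibers $H_xM$ so that fiber orientation followed by base orientation is that of $HM$. There is a unique volume form $\Omega^F$ on $M$ for which there is an $(n-1)$-form $\alpha^F$ on $HM$, nowhere zero on $VHM$ (and uniquely determined there), with $\alpha^F\wedge\pi^*\Omega^F=A\wedge dA^{n-1}$ and $\int_{H_xM}\alpha^F=\mathrm{vol}_{\mathrm{Eucl}}(\mathbb{S}^{n-1})$ for all $x$. The Finsler--Laplace operator is $\Delta^Ff(x)=\frac{n}{\mathrm{vol}_{\mathrm{Eucl}}(\mathbb{S}^{n-1})}\int_{H_xM}L_X^2(\pi^*f)\,\alpha^F$. Here $n=2$ and $M=\mathbb{S}^2$.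 An eigenvalue of $-\Delta^{F_\varepsilon}$ is a $\lambda$ such that $-\Delta^{F_\varepsilon}u=\lambda u$ for some nonzero $u\in C^\infty(\mathbb{S}^2)$. *)

(* Defs.v *)
From Stdlib Require Import Reals Lra ClassicalEpsilon.
From Coquelicot Require Import Coquelicot.
Open Scope R_scope.

Notation vec := (R * R * R)%type.

Definition dot (x y : vec) : R :=
  let '(x1, x2, x3) := x in let '(y1, y2, y3) := y in x1 * y1 + x2 * y2 + x3 * y3.

Definition det3 (x y z : vec) : R :=
  let '(x1, x2, x3) := x in let '(y1, y2, y3) := y in let '(z1, z2, z3) := z in
  x1 * (y2 * z3 - y3 * z2) - x2 * (y1 * z3 - y3 * z1) + x3 * (y1 * z2 - y2 * z1).

Definition S2 (x : vec) : Prop := dot x x = 1.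
Definition TS2 (x v : vec) : Prop := dot x v = 0.

(* HM = (TM \ 0) / R^+ for M = S^2: every ray of T_xM contains exactly one vector v that is
   unit for the round metric, so HM is the round unit tangent bundle, the quotient map r is
   (x, v) |-> (x, v / |v|) and the projection pi is [fst]. *)
Definition HM (p : vec * vec) : Prop :=
  S2 (fst p) /\ TS2 (fst p) (snd p) /\ dot (snd p) (snd p) = 1.

Definition THM (p Y : vec * vec) : Prop :=
  let (x, v) := p in let (dx, dv) := Y in
  dot x dx = 0 /\ dot dx v + dot x dv = 0 /\ dot v dv = 0.

Definition VHM (p Y : vec * vec) : Prop := THM p Y /\ fst Y = zero.

Definition dderiv {V : NormedModule R_AbsRing} (f : V -> R) (v x : V) : R :=
  Derive (fun t => f (plus x (scal t v))) 0.

Fixpoint differentiable_upto {V : NormedModule R_AbsRing} (k : nat) (f : V -> R) : Prop :=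
  match k with
  | O => forall x : V, continuous f x
  | S k' => (forall x : V, ex_filterdiff f (locally x)) /\
            (forall v : V, differentiable_upto k' (dderiv f v))
  end.

Definition smooth {V : NormedModule R_AbsRing} (f : V -> R) : Prop :=
  forall k, differentiable_upto k f.

Definition c1 (x : vec) : R := fst (fst x).
Definition c2 (x : vec) : R := snd (fst x).
Definition c3 (x : vec) : R := snd x.

Definition smooth_map {V : NormedModule R_AbsRing} (c : V -> vec * vec) : Prop :=
  (smooth (fun q => c1 (fst (c q))) /\ smooth (fun q => c2 (fst (c q))) /\
   smooth (fun q => c3 (fst (c q)))) /\
  (smooth (fun q => c1 (snd (c q))) /\ smooth (fun q => c2 (snd (c q))) /\
   smooth (fun q => c3 (snd (c q)))).

(* S^2 is a closed submanifold of R^3, so its smooth functions are exactly the restrictions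
   of the smooth functions on R^3. *)
Definition smooth_on_S2 (u : vec -> R) : Prop :=
  exists U : vec -> R, smooth U /\ forall x, S2 x -> u x = U x.

Definition Dvec (c : R -> vec) (t : R) : vec :=
  (Derive (fun s => c1 (c s)) t, Derive (fun s => c2 (c s)) t, Derive (fun s => c3 (c s)) t).

Definition velocity (c : R -> vec * vec) (t : R) : vec * vec :=
  (Dvec (fun s => fst (c s)) t, Dvec (fun s => snd (c s)) t).

(* Finsler metrics are functions [F x v] of which only the values on TS^2 matter; forms and
   vector fields on HM are functions of which only the values at points of HM, on vectors
   tangent to HM, matter. *)

Definition the {T : Type} (d : T) (P : T -> Prop) : T := epsilon (inhabits d) P.

(* r^*A = (dF/dv^i) dx^i: the derivative of F along the fiber, in the direction dpi(Y). *)
Definition hilbert_form (F : vec -> vec -> R) (p Y : vec * vec) : R :=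
  Derive (fun t => F (fst p) (plus (snd p) (scal t (fst Y)))) 0.

(* B = dA, expressed through pullbacks c^*B = d(c^*A) to the (s, t)-plane. Any two tangent
   vectors at a point of HM are the partial derivatives of some such c, so B is determined
   on THM. *)
Definition is_ext_deriv (A : vec * vec -> vec * vec -> R)
    (B : vec * vec -> vec * vec -> vec * vec -> R) : Prop :=
  forall c : R * R -> vec * vec, smooth_map c -> (forall q, HM (c q)) ->
  let cs s t := velocity (fun s' => c (s', t)) s in
  let ct s t := velocity (fun t' => c (s, t')) t in
  forall s t,
    B (c (s, t)) (cs s t) (ct s t) =
      Derive (fun s' => A (c (s', t)) (ct s' t)) s
      - Derive (fun t' => A (c (s, t')) (cs s t')) t.

Definition d_hilbert (F : vec -> vec -> R) : vec * vec -> vec * vec -> vec * vec -> R :=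
  the (fun _ _ _ => 0) (is_ext_deriv (hilbert_form F)).

(* A /\ dA *)
Definition contact_volume (F : vec -> vec -> R) (p Y1 Y2 Y3 : vec * vec) : R :=
  hilbert_form F p Y1 * d_hilbert F p Y2 Y3
  - hilbert_form F p Y2 * d_hilbert F p Y1 Y3
  + hilbert_form F p Y3 * d_hilbert F p Y1 Y2.

Definition is_reeb (F : vec -> vec -> R) (X : vec * vec -> vec * vec) : Prop :=
  forall p, HM p ->
    THM p (X p) /\ hilbert_form F p (X p) = 1 /\
    (forall Y, THM p Y -> d_hilbert F p (X p) Y = 0).

Definition reeb (F : vec -> vec -> R) : vec * vec -> vec * vec :=
  the (fun _ => zero) (is_reeb F).

(* The value at p of the derivative of g : HM -> R along the vector field X. *)
Definition lie (X : vec * vec -> vec * vec) (g : vec * vec -> R) (p : vec * vec) : R :=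
  the 0 (fun l => forall c : R -> vec * vec,
    smooth_map c -> (forall t, HM (c t)) -> c 0 = p -> velocity c 0 = X p ->
    is_derive (fun t => g (c t)) 0 l).

Definition fiber_point (x e e' : vec) (t : R) : vec * vec :=
  (x, plus (scal (cos t) e) (scal (sin t) e')).

Definition fiber_tangent (e e' : vec) (t : R) : vec * vec :=
  (zero, plus (scal (- sin t) e) (scal (cos t) e')).

(* The parametrization t |-> cos t e + sin t e' of H_xM is positively oriented: its velocity
   followed by lifts of a positive basis of T_xM (S^2 carries the orientation given by the
   outward normal) is positive for A /\ dA. *)
Definition positive_fiber_frame (F : vec -> vec -> R) (x e e' : vec) : Prop :=
  (TS2 x e /\ TS2 x e' /\ dot e e = 1 /\ dot e' e' = 1 /\ dot e e' = 0) /\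
  (forall t Y1 Y2,
     THM (fiber_point x e e' t) Y1 -> THM (fiber_point x e e' t) Y2 ->
     0 < det3 x (fst Y1) (fst Y2) ->
     0 < contact_volume F (fiber_point x e e' t) (fiber_tangent e e' t) Y1 Y2).

Definition fiber_integral (F : vec -> vec -> R) (x : vec)
    (beta : vec * vec -> vec * vec -> R) : R :=
  let (e, e') := the (zero, zero) (fun ee => positive_fiber_frame F x (fst ee) (snd ee)) in
  RInt (fun t => beta (fiber_point x e e' t) (fiber_tangent e e' t)) 0 (2 * PI).

Definition is_one_form (alpha : vec * vec -> vec * vec -> R) : Prop :=
  forall p, HM p -> forall a b Y Z, THM p Y -> THM p Z ->
    alpha p (plus (scal a Y) (scal b Z)) = a * alpha p Y + b * alpha p Z.

Definition is_volume_form (Omega : vec -> vec -> vec -> R) : Prop :=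
  forall x, S2 x ->
    (forall a b v w z, TS2 x v -> TS2 x w -> TS2 x z ->
       Omega x (plus (scal a v) (scal b w)) z = a * Omega x v z + b * Omega x w z) /\
    (forall v w, TS2 x v -> TS2 x w -> Omega x v w = - Omega x w v) /\
    (exists v w, TS2 x v /\ TS2 x w /\ Omega x v w <> 0).

(* No smoothness is imposed on Omega and alpha: already pointwise, these conditions have a
   unique solution Omega, and a unique solution alpha on VHM. The third condition is
   alpha /\ pi^*Omega = A /\ dA. *)
Definition is_volume_angle (F : vec -> vec -> R) (Omega : vec -> vec -> vec -> R)
    (alpha : vec * vec -> vec * vec -> R) : Prop :=
  is_one_form alpha /\
  (forall p Y, HM p -> VHM p Y -> Y <> zero -> alpha p Y <> 0) /\
  (forall p Y1 Y2 Y3, HM p -> THM p Y1 -> THM p Y2 -> THM p Y3 ->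
     alpha p Y1 * Omega (fst p) (fst Y2) (fst Y3)
     - alpha p Y2 * Omega (fst p) (fst Y1) (fst Y3)
     + alpha p Y3 * Omega (fst p) (fst Y1) (fst Y2) = contact_volume F p Y1 Y2 Y3) /\
  (forall x, S2 x -> fiber_integral F x alpha = 2 * PI).

Definition volume_form (F : vec -> vec -> R) : vec -> vec -> vec -> R :=
  the (fun _ _ _ => 0)
      (fun Omega => is_volume_form Omega /\ exists alpha, is_volume_angle F Omega alpha).

Definition angle_form (F : vec -> vec -> R) : vec * vec -> vec * vec -> R :=
  the (fun _ _ => 0) (is_volume_angle F (volume_form F)).

Definition finsler_laplacian (F : vec -> vec -> R) (f : vec -> R) (x : vec) : R :=
  2 / (2 * PI) *
  fiber_integral F x (fun p Y =>
    lie (reeb F) (lie (reeb F) (fun q => f (fst q))) p * angle_form F p Y).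

Definition is_eigenvalue (F : vec -> vec -> R) (lambda : R) : Prop :=
  exists u : vec -> R,
    smooth_on_S2 u /\ (exists x, S2 x /\ u x <> 0) /\
    (forall x, S2 x -> - finsler_laplacian F u x = lambda * u x).

Definition is_smallest_nonzero_eigenvalue (F : vec -> vec -> R) (lambda : R) : Prop :=
  is_eigenvalue F lambda /\ lambda <> 0 /\
  (forall mu, is_eigenvalue F mu -> mu <> 0 -> lambda <= mu).

Definition sph (phi theta : R) : vec :=
  (sin phi * cos theta, sin phi * sin theta, cos phi).

Definition sph_dphi (phi theta : R) : vec :=
  (cos phi * cos theta, cos phi * sin theta, - sin phi).

Definition sph_dtheta (phi theta : R) : vec :=
  (- (sin phi * sin theta), sin phi * cos theta, 0).

Definition volume (F : vec -> vec -> R) : R :=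
  RInt (fun phi =>
    RInt (fun theta =>
      volume_form F (sph phi theta) (sph_dphi phi theta) (sph_dtheta phi theta))
    0 (2 * PI)) 0 PI.

(* This determines F on all of TS^2: at the poles d/dtheta vanishes and the right-hand side
   is |xi_phi|, while d/dphi runs over all unit tangent vectors as theta varies. *)
Definition is_katok_ziller (eps : R) (F : vec -> vec -> R) : Prop :=
  forall phi theta xphi xtheta,
    0 <= phi <= PI -> 0 <= theta <= 2 * PI ->
    F (sph phi theta)
      (plus (scal xphi (sph_dphi phi theta)) (scal xtheta (sph_dtheta phi theta))) =
    1 / (1 - eps ^ 2 * sin phi ^ 2) *
      (sqrt ((1 - eps ^ 2 * sin phi ^ 2) * xphi ^ 2 + sin phi ^ 2 * xtheta ^ 2)
       - eps * sin phi ^ 2 * xtheta).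

Lemma katok_ziller_exists (eps : R) : exists F, is_katok_ziller eps F.
Proof.
exists (fun x v =>
  let '(x1, x2, x3) := x in let '(v1, v2, v3) := v in
  1 / (1 - eps ^ 2 * (x1 ^ 2 + x2 ^ 2)) *
  (sqrt ((1 - eps ^ 2 * (x1 ^ 2 + x2 ^ 2)) * (v1 ^ 2 + v2 ^ 2 + v3 ^ 2)
         + eps ^ 2 * (x1 * v2 - x2 * v1) ^ 2)
   - eps * (x1 * v2 - x2 * v1))).
intros phi theta a b _ _.
unfold sph, sph_dphi, sph_dtheta, plus, scal; simpl.
unfold prod_plus, prod_scal, plus, scal, mult; simpl.
unfold prod_plus, prod_scal, plus, scal, mult; simpl.
unfold mult; simpl.
assert (Ht : cos theta * cos theta = 1 - sin theta * sin theta)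
  by (generalize (sin2_cos2 theta); unfold Rsqr; lra).
assert (Hp : cos phi * cos phi = 1 - sin phi * sin phi)
  by (generalize (sin2_cos2 phi); unfold Rsqr; lra).
set (st := sin theta) in *; set (ct := cos theta) in *.
set (sp := sin phi) in *; set (cp := cos phi) in *.
assert (E1 : sp * ct * (sp * ct * 1) + sp * st * (sp * st * 1) = sp * (sp * 1)) by ring [Ht].
assert (E2 : sp * ct * (a * (cp * st) + b * (sp * ct))
             - sp * st * (a * (cp * ct) + b * - (sp * st)) = sp * (sp * 1) * b) by ring [Ht].
rewrite E1, E2.
f_equal. f_equal; [ f_equal | ring ].
ring [Ht Hp].
Qed.

(* Main.v *)
From Stdlib Require Import Reals Lra Psatz ClassicalEpsilon FunctionalExtensionality Nsatz.
From Coquelicot Require Import Coquelicot.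
Require Import Defs.
Open Scope R_scope.

(** The indicatrix of the metric at [x] is the round unit circle translated by [eps] times the
rotation field, so the Reeb flow is the round geodesic flow composed with the rotation of speed
[eps]. The proof works with infinitesimal data only. On [HM], which is the rotation group, the
frame [(x, v, n)], with [n] the cross product of [x] and [v], turns the coefficients of the
forms into functions of the third row [(x3, v3, n3)] of a rotation matrix.
In the coframe [(spin, side, forward)] of infinitesimal rotations about the three axes, with
[S = sqrt (1 - eps^2 v3^2)] and [N = / (S + eps n3)] the value of the metric,
  [A  = N (forward - eps v3 side / S)],
  [dA = - (spin /\ side + m side /\ forward) / S^3],
and hence [A /\ dA = - (N / S^3) spin /\ area] ([hilbert_form_eq],
[is_ext_deriv_d_hilbert_frame], [contact_volume_eq]). These formulas determine all the objects
that the statement selects by a description: [dA], because any two tangent vectors are the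
velocities of a two-parameter family of frames ([d_hilbert_eq]); the Reeb field, which is
explicit because [dA] is ([reeb_eq]); and the volume and angle forms, by normalizing the fiber
integral of [N / S^3] ([volume_angle_unique]). That integral is [2 PI / b^3], where
[b^2 = 1 - eps^2 sin^2 phi]: multiplying numerator and denominator by [S - eps n3] leaves a term
odd in [v], which integrates to zero, and a rational function of [sin t]. The volume is then
[4 PI / (1 - eps^2)] ([volume_eq]).

The same parity argument computes the operator. In spherical coordinates it is
  [2 b^2/(1+b) d_phi^2 + 2 (1 - b^2/(1+b)) cot phi d_phi + 2 b^3/((1+b) sin^2 phi) d_theta^2]
([laplacian_spherical]); the coordinate function [x1] is an eigenfunction of eigenvalue
[2 - 2 eps^2] ([first_coordinate_eigenfunction]).

For the lower bound, let [u] be an eigenfunction of nonzero eigenvalue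
[mu < 2 - 2 eps^2]. The
coefficients depend on [phi] only, so the part of [u] that is odd under the reflection in a
meridian plane is again a solution. It vanishes on the boundary of a half-sphere, in the
interior of which the eigenfunction [sin phi sin theta], of larger eigenvalue, is positive; a
small correction makes the latter a positive strict supersolution up to the boundary, and the
maximum principle forces the odd part to vanish ([maximum_principle], [barrier_exists],
[reflection_nonpositive]). Hence [u] is invariant under all these reflections and depends on
[phi] alone ([zonal]). For a zonal [u] the equation is an ordinary one, solved by [cos phi] with
eigenvalue 2. Picone's identity, comparing [u'] with the derivative of [cos phi], exhibits a
quantity that vanishes at both poles and whose derivative is a sum of squares when [mu < 2]; so [u' = 0], and [mu u = 0]
([is_derive_picone], [zonal_vanishes]). *)

(** * Calculus of smooth functions *)

Section SmoothCalculus.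
Context {V : NormedModule R_AbsRing}.
Implicit Types f g : V -> R.

Lemma is_derive_filterdiff_line f (x v : V) l :
  filterdiff f (locally x) l -> is_derive (fun t => f (plus x (scal t v))) 0 (l v).
Proof.
intros Hf.
assert (E : plus x (scal 0 v) = x)
  by (transitivity (plus x zero); [f_equal; exact (scal_zero_l v)|apply plus_zero_r]).
unfold is_derive.
apply filterdiff_ext_lin with (fun t => l (scal t v)).
- apply (filterdiff_comp' (fun t : R_AbsRing => plus x (scal t v)) f 0 (fun t => scal t v) l).
  + apply filterdiff_ext_lin with (fun t : R_AbsRing => plus zero (scal t v)).
    * apply (filterdiff_plus_fct (fun _ => x) (fun t : R_AbsRing => scal t v)).
      -- apply filterdiff_const.
      -- apply filterdiff_linear, is_linear_scal_l.
    * intros t; apply plus_zero_l.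
  + exact (eq_ind_r (fun y => filterdiff f (locally y) l) Hf E).
- intros t. apply (linear_scal l (proj1 Hf)).
Qed.

Lemma dderiv_filterdiff f (x v : V) l : filterdiff f (locally x) l -> dderiv f v x = l v.
Proof. intros Hf. apply is_derive_unique, is_derive_filterdiff_line, Hf. Qed.

Lemma smooth_ex_filterdiff f (x : V) : smooth f -> ex_filterdiff f (locally x).
Proof. intros Hf. apply (Hf 1%nat). Qed.

Lemma smooth_dderiv f (v : V) : smooth f -> smooth (dderiv f v).
Proof. intros Hf k. apply (Hf (S k)). Qed.

Lemma differentiable_upto_le k : forall f, differentiable_upto (S k) f -> differentiable_upto k f.
Proof.
induction k as [|k IH]; intros f [Hf Hd].
- intros x. exact (filterdiff_continuous f x (Hf x)).
- split; [exact Hf|]. intros v. apply IH, Hd.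
Qed.

Lemma smooth_continuous f (x : V) : smooth f -> continuous f x.
Proof. intros Hf. apply (Hf 0%nat). Qed.

Lemma differentiable_upto_const (a : R) k : differentiable_upto k (fun _ : V => a).
Proof.
revert a; induction k as [|k IH]; intros a.
- intros x. apply continuous_const.
- split.
  + intros x. eexists. apply filterdiff_const.
  + intros v. replace (dderiv (fun _ : V => a) v) with (fun _ : V => 0); [apply IH|].
    apply functional_extensionality; intros x. symmetry. exact (Derive_const a 0).
Qed.

Lemma smooth_const (a : R) : smooth (fun _ : V => a).
Proof. intros k. apply differentiable_upto_const. Qed.

Lemma smooth_linear (l : V -> R) : is_linear l -> smooth l.
Proof.
intros Hl k. destruct k as [|k].
- intros x. apply (filterdiff_continuous l x). exists l. now apply filterdiff_linear.
- split.
  + intros x. exists l. now apply filterdiff_linear.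
  + intros v. replace (dderiv l v) with (fun _ : V => l v); [apply smooth_const|].
    apply functional_extensionality; intros x. symmetry.
    apply dderiv_filterdiff. now apply filterdiff_linear.
Qed.

Lemma dderiv_plus f g (v x : V) :
  ex_filterdiff f (locally x) -> ex_filterdiff g (locally x) ->
  dderiv (fun y => f y + g y) v x = dderiv f v x + dderiv g v x.
Proof.
intros [lf Hf] [lg Hg].
rewrite (dderiv_filterdiff f x v lf Hf), (dderiv_filterdiff g x v lg Hg).
apply (dderiv_filterdiff _ x v (fun y => plus (lf y) (lg y))).
apply (filterdiff_plus_fct f g lf lg Hf Hg).
Qed.

Lemma dderiv_mult f g (v x : V) :
  ex_filterdiff f (locally x) -> ex_filterdiff g (locally x) ->
  dderiv (fun y => f y * g y) v x = dderiv f v x * g x + f x * dderiv g v x.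
Proof.
intros [lf Hf] [lg Hg].
rewrite (dderiv_filterdiff f x v lf Hf), (dderiv_filterdiff g x v lg Hg).
apply (dderiv_filterdiff _ x v (fun y => plus (mult (lf y) (g x)) (mult (f x) (lg y)))).
apply (filterdiff_mult_fct f g x lf lg Rmult_comm Hf Hg).
Qed.

Lemma differentiable_upto_plus k : forall f g,
  differentiable_upto k f -> differentiable_upto k g -> differentiable_upto k (fun x => f x + g x).
Proof.
induction k as [|k IH]; intros f g Hf Hg.
- intros x. apply (continuous_plus f g); [apply Hf|apply Hg].
- destruct Hf as [Hf Hf'], Hg as [Hg Hg']. split.
  + intros x. destruct (Hf x) as [lf Hlf], (Hg x) as [lg Hlg].
    eexists. apply (filterdiff_plus_fct f g lf lg Hlf Hlg).
  + intros v. replace (dderiv (fun x => f x + g x) v)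
      with (fun x => dderiv f v x + dderiv g v x); [now apply IH|].
    apply functional_extensionality; intros x. symmetry. now apply dderiv_plus.
Qed.

Lemma smooth_plus f g : smooth f -> smooth g -> smooth (fun x => f x + g x).
Proof. intros Hf Hg k. now apply differentiable_upto_plus. Qed.

(** The derivative of a product contains the factors themselves, to which the induction
    hypothesis applies only after lowering their order by one. *)
Lemma differentiable_upto_mult k : forall f g,
  differentiable_upto k f -> differentiable_upto k g -> differentiable_upto k (fun x => f x * g x).
Proof.
induction k as [|k IH]; intros f g Hf Hg.
- intros x. apply (continuous_mult f g); [apply Hf|apply Hg].
- pose proof (differentiable_upto_le k f Hf) as Hf0.
  pose proof (differentiable_upto_le k g Hg) as Hg0.
  destruct Hf as [Hf Hf'], Hg as [Hg Hg']. split.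
  + intros x. destruct (Hf x) as [lf Hlf], (Hg x) as [lg Hlg].
    eexists. apply (filterdiff_mult_fct f g x lf lg Rmult_comm Hlf Hlg).
  + intros v. replace (dderiv (fun x => f x * g x) v)
      with (fun x => dderiv f v x * g x + f x * dderiv g v x).
    * apply differentiable_upto_plus; now apply IH.
    * apply functional_extensionality; intros x. symmetry. now apply dderiv_mult.
Qed.

Lemma smooth_mult f g : smooth f -> smooth g -> smooth (fun x => f x * g x).
Proof. intros Hf Hg k. now apply differentiable_upto_mult. Qed.

Lemma filterdiff_comp_derive f (h : R -> R) dh (x : V) lf :
  filterdiff f (locally x) lf -> is_derive h (f x) dh ->
  filterdiff (fun y => h (f y)) (locally x) (fun y => dh * lf y).
Proof.
intros Hf Hh.
apply filterdiff_ext_lin with (fun y => scal (lf y) dh).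
- apply (filterdiff_comp' f h x lf (fun y => scal y dh) Hf Hh).
- intros y. apply Rmult_comm.
Qed.

(** A joint induction, since the derivative of each function involves the other. *)
Lemma differentiable_upto_cos_sin k : forall f, differentiable_upto k f ->
  differentiable_upto k (fun x => cos (f x)) /\ differentiable_upto k (fun x => sin (f x)).
Proof.
induction k as [|k IH]; intros f Hf.
- split; intros x; apply (continuous_comp f); try apply Hf;
    [apply continuous_cos|apply continuous_sin].
- destruct (IH f (differentiable_upto_le k f Hf)) as [Hc Hs].
  destruct Hf as [Hf Hf'].
  split; split.
  + intros x. destruct (Hf x) as [lf Hlf]. eexists.
    apply (filterdiff_comp_derive f cos _ x lf Hlf (is_derive_cos _)).
  + intros v. replace (dderiv (fun x => cos (f x)) v)
      with (fun x => (-1 * sin (f x)) * dderiv f v x).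
    * apply differentiable_upto_mult; [|apply Hf'].
      apply differentiable_upto_mult; [apply differentiable_upto_const|exact Hs].
    * apply functional_extensionality; intros x. destruct (Hf x) as [lf Hlf].
      rewrite (dderiv_filterdiff f x v lf Hlf).
      rewrite (dderiv_filterdiff _ x v _
        (filterdiff_comp_derive f cos _ x lf Hlf (is_derive_cos _))).
      ring.
  + intros x. destruct (Hf x) as [lf Hlf]. eexists.
    apply (filterdiff_comp_derive f sin _ x lf Hlf (is_derive_sin _)).
  + intros v. replace (dderiv (fun x => sin (f x)) v)
      with (fun x => cos (f x) * dderiv f v x).
    * apply differentiable_upto_mult; [exact Hc|apply Hf'].
    * apply functional_extensionality; intros x. destruct (Hf x) as [lf Hlf].
      rewrite (dderiv_filterdiff f x v lf Hlf).
      rewrite (dderiv_filterdiff _ x v _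
        (filterdiff_comp_derive f sin _ x lf Hlf (is_derive_sin _))).
      reflexivity.
Qed.

Lemma smooth_cos f : smooth f -> smooth (fun x => cos (f x)).
Proof. intros Hf k. now apply differentiable_upto_cos_sin. Qed.

Lemma smooth_sin f : smooth f -> smooth (fun x => sin (f x)).
Proof. intros Hf k. now apply differentiable_upto_cos_sin. Qed.

Lemma is_derive_comp_curve f (c : R -> V) t (l : V) :
  smooth f -> is_derive c t l -> is_derive (fun s => f (c s)) t (dderiv f l (c t)).
Proof.
intros Hf Hc. destruct (smooth_ex_filterdiff f (c t) Hf) as [lf Hlf].
rewrite (dderiv_filterdiff f (c t) l lf Hlf).
apply filterdiff_ext_lin with (fun y => lf (scal y l)).
- apply (filterdiff_comp' c f t (fun y => scal y l) lf Hc Hlf).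
- intros y. apply (linear_scal lf (proj1 Hlf)).
Qed.

Lemma dderiv_lin f (a b : R) (v w x : V) : smooth f ->
  dderiv f (plus (scal a v) (scal b w)) x = a * dderiv f v x + b * dderiv f w x.
Proof.
intros Hf. destruct (smooth_ex_filterdiff f x Hf) as [lf Hlf].
rewrite !(dderiv_filterdiff f x _ lf Hlf).
rewrite (linear_plus lf (proj1 Hlf)), !(linear_scal lf (proj1 Hlf)). reflexivity.
Qed.

End SmoothCalculus.

Lemma is_derive_pair {U V : NormedModule R_AbsRing} (f : R -> U) (g : R -> V) t lf lg :
  is_derive f t lf -> is_derive g t lg ->
  is_derive (V := prod_NormedModule R_AbsRing U V) (fun s => (f s, g s)) t (lf, lg).
Proof.
intros Hf Hg.
apply (filterdiff_comp_2 f g (fun u v => (u, v)) (fun y => scal y lf) (fun y => scal y lg)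
         (fun u v => (u, v)) Hf Hg).
apply filterdiff_linear.
split.
- reflexivity.
- reflexivity.
- exists 1. split; [lra|]. intros [u v]. rewrite Rmult_1_l. apply Rle_refl.
Qed.

Lemma is_derive_vec (a b c : R -> R) t la lb lc :
  is_derive a t la -> is_derive b t lb -> is_derive c t lc ->
  is_derive (fun s => (a s, b s, c s) : vec) t ((la, lb, lc) : vec).
Proof. intros Ha Hb Hc. apply is_derive_pair; [apply is_derive_pair|]; assumption. Qed.

Lemma is_derive_smooth_fst (f : R * R -> R) s t :
  smooth f -> is_derive (fun s' => f (s', t)) s (dderiv f (1, 0) (s, t)).
Proof.
intros Hf. apply (is_derive_comp_curve f (fun s' => (s', t)) s (1, 0) Hf).
apply is_derive_pair; [apply (is_derive_id s)|apply (is_derive_const t s)].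
Qed.

Lemma is_derive_smooth_snd (f : R * R -> R) s t :
  smooth f -> is_derive (fun t' => f (s, t')) t (dderiv f (0, 1) (s, t)).
Proof.
intros Hf. apply (is_derive_comp_curve f (fun t' => (s, t')) t (0, 1) Hf).
apply is_derive_pair; [apply (is_derive_const s t)|apply (is_derive_id t)].
Qed.

Lemma continuity_2d_pt_smooth (f : R * R -> R) s t :
  smooth f -> continuity_2d_pt (fun u v => f (u, v)) s t.
Proof.
intros Hf. apply continuity_2d_pt_filterlim.
apply (filterlim_ext f (fun z => f (fst z, snd z))).
- now intros [u v].
- apply (smooth_continuous f (s, t) Hf).
Qed.

(** Schwarz's theorem. *)
Lemma dderiv_comm (f : R * R -> R) s t : smooth f ->
  dderiv (dderiv f (0, 1)) (1, 0) (s, t) = dderiv (dderiv f (1, 0)) (0, 1) (s, t).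
Proof.
intros Hf.
assert (H1 : forall s t, Derive (fun s' => f (s', t)) s = dderiv f (1, 0) (s, t))
  by (intros; now apply is_derive_unique, is_derive_smooth_fst).
assert (H2 : forall s t, Derive (fun t' => f (s, t')) t = dderiv f (0, 1) (s, t))
  by (intros; now apply is_derive_unique, is_derive_smooth_snd).
assert (H12 : forall s t, Derive (fun z => Derive (fun t' => f (z, t')) t) s
    = dderiv (dderiv f (0, 1)) (1, 0) (s, t)).
{ intros s' t'. rewrite (Derive_ext _ (fun z => dderiv f (0, 1) (z, t'))) by (intros; apply H2).
  now apply is_derive_unique, is_derive_smooth_fst, smooth_dderiv. }
assert (H21 : forall s t, Derive (fun z => Derive (fun s' => f (s', z)) s) t
    = dderiv (dderiv f (1, 0)) (0, 1) (s, t)).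
{ intros s' t'. rewrite (Derive_ext _ (fun z => dderiv f (1, 0) (s', z))) by (intros; apply H1).
  now apply is_derive_unique, is_derive_smooth_snd, smooth_dderiv. }
rewrite <- H12, <- H21.
apply (Schwarz (fun u v => f (u, v))).
- exists (mkposreal 1 Rlt_0_1). intros u v _ _. repeat split.
  + eexists; now apply is_derive_smooth_fst.
  + eexists; now apply is_derive_smooth_snd.
  + apply (ex_derive_ext (fun z => dderiv f (0, 1) (z, v))); [intros; now rewrite H2|].
    eexists; now apply is_derive_smooth_fst, smooth_dderiv.
  + apply (ex_derive_ext (fun z => dderiv f (1, 0) (u, z))); [intros; now rewrite H1|].
    eexists; now apply is_derive_smooth_snd, smooth_dderiv.
- apply (continuity_2d_pt_ext (fun u v => dderiv (dderiv f (0, 1)) (1, 0) (u, v))).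
  + intros; now rewrite H12.
  + now apply continuity_2d_pt_smooth, smooth_dderiv, smooth_dderiv.
- apply (continuity_2d_pt_ext (fun u v => dderiv (dderiv f (1, 0)) (0, 1) (u, v))).
  + intros; now rewrite H21.
  + now apply continuity_2d_pt_smooth, smooth_dderiv, smooth_dderiv.
Qed.

(** * The moving frame on the unit tangent bundle *)

Definition cross (x y : vec) : vec :=
  let '(x1, x2, x3) := x in let '(y1, y2, y3) := y in
  (x2 * y3 - x3 * y2, x3 * y1 - x1 * y3, x1 * y2 - x2 * y1).

Definition lincomb (a : R) (v : vec) (b : R) (w : vec) : vec := plus (scal a v) (scal b w).

Definition normal (p : vec * vec) : vec := cross (fst p) (snd p).

(** A tangent vector at [p = (x, v)] is the velocity of an infinitesimal rotation; these are its
    components about the axes [x], [v] and [normal p]. The fibers are the orbits of the first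
    rotation, and the round geodesics those of the third. *)
Definition spin (p Y : vec * vec) : R := dot (snd Y) (normal p).
Definition side (p Y : vec * vec) : R := - dot (fst Y) (normal p).
Definition forward (p Y : vec * vec) : R := dot (fst Y) (snd p).

Definition frame_vector (p : vec * vec) (a b g : R) : vec * vec :=
  (lincomb g (snd p) (- b) (normal p), lincomb a (normal p) (- g) (fst p)).

Ltac vec_destruct :=
  repeat match goal with
  | x : vec * vec |- _ => destruct x
  | x : R * R * R |- _ => destruct x as [[? ?] ?]
  end.

(* The operations of a product space unfold one pairing at a time, whence the repetitions. *)
Ltac vec_unfold :=
  unfold HM, THM, VHM, S2, TS2, frame_vector, spin, side, forward, normal, cross, lincomb, dot, det3,
    c1, c2, c3, plus, scal, zero, mult in *; simpl in *;
  unfold prod_plus, prod_scal, prod_zero, plus, scal, zero, mult in *; simpl in *;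
  unfold prod_plus, prod_scal, prod_zero, plus, scal, zero, mult in *; simpl in *;
  unfold plus, scal, zero, mult in *; simpl in *.

Lemma HM_normal (p : vec * vec) : HM p ->
  dot (normal p) (normal p) = 1 /\ dot (fst p) (normal p) = 0 /\ dot (snd p) (normal p) = 0.
Proof.
intros (Hx & Hxv & Hv). vec_destruct. vec_unfold. repeat split; nsatz.
Qed.

Lemma frame_expansion (p : vec * vec) (w : vec) : HM p ->
  w = plus (lincomb (dot w (fst p)) (fst p) (dot w (snd p)) (snd p)) (scal (dot w (normal p)) (normal p)).
Proof.
intros (Hx & Hxv & Hv). vec_destruct. vec_unfold.
f_equal; [f_equal|]; nsatz.
Qed.

(** The third row of the orthogonal matrix with columns [fst p], [snd p], [normal p]. *)
Lemma frame_row3 (p : vec * vec) : HM p ->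
  c3 (fst p) ^ 2 + c3 (snd p) ^ 2 + c3 (normal p) ^ 2 = 1.
Proof.
intros (Hx & Hxv & Hv). vec_destruct. vec_unfold. nsatz.
Qed.

Lemma THM_frame_vector (p : vec * vec) (a b g : R) : HM p ->
  THM p (frame_vector p a b g) /\ spin p (frame_vector p a b g) = a /\
  side p (frame_vector p a b g) = b /\ forward p (frame_vector p a b g) = g.
Proof.
intros (Hx & Hxv & Hv). vec_destruct. vec_unfold.
repeat split; nsatz.
Qed.

Lemma THM_frame (p Y : vec * vec) : HM p -> THM p Y ->
  Y = frame_vector p (spin p Y) (side p Y) (forward p Y).
Proof.
intros Hp HY.
pose proof (frame_expansion p (fst Y) Hp) as E1.
pose proof (frame_expansion p (snd Y) Hp) as E2.
destruct p as [x v], Y as [dx dv]. destruct HY as (H1 & H2 & H3).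
unfold frame_vector, spin, side, forward. simpl fst in *; simpl snd in *.
assert (G1 : dot dx x = 0) by (rewrite <- H1; vec_destruct; vec_unfold; ring).
assert (G2 : dot dv v = 0) by (rewrite <- H3; vec_destruct; vec_unfold; ring).
assert (G3 : dot dv x = - dot dx v)
  by (transitivity (dot x dv); [vec_destruct; vec_unfold; ring|lra]).
rewrite G1 in E1. rewrite G2, G3 in E2.
f_equal.
- rewrite E1 at 1. generalize (dot dx v) (dot dx (normal (x, v))) (normal (x, v)).
  intros; clear; vec_destruct; vec_unfold; f_equal; [f_equal|]; ring.
- rewrite E2 at 1. generalize (dot dx v) (dot dv (normal (x, v))) (normal (x, v)).
  intros; clear; vec_destruct; vec_unfold; f_equal; [f_equal|]; ring.
Qed.

(** * The Hilbert form of a Katok-Ziller metric *)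

Lemma polar_coordinates (x y : R) :
  exists r t, 0 <= r /\ 0 <= t <= 2 * PI /\ x = r * cos t /\ y = r * sin t.
Proof.
set (r := sqrt (x ^ 2 + y ^ 2)).
assert (Hr : r * r = x ^ 2 + y ^ 2) by (apply sqrt_sqrt; nra).
assert (Hr0 : 0 <= r) by apply sqrt_pos.
destruct (Req_dec r 0) as [E | E].
{ exists 0, 0. pose proof PI_RGT_0. repeat split; nra. }
assert (Hb : -1 <= x / r <= 1).
{ assert (Hq : (x / r) * r = x) by (field; lra).
  assert (x <= r) by nra. assert (- r <= x) by nra. split; nra. }
assert (Hs : sqrt (1 - Rsqr (x / r)) = Rabs y / r).
{ replace (1 - Rsqr (x / r)) with (Rsqr (Rabs y / r)).
  - apply sqrt_Rsqr. apply Rmult_le_pos; [apply Rabs_pos|].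
    apply Rlt_le, Rinv_0_lt_compat; lra.
  - unfold Rsqr. assert (Rabs y * Rabs y = y * y) by (rewrite <- Rabs_mult; apply Rabs_pos_eq; nra).
    apply Rmult_eq_reg_r with (r * r); [|nra]. field_simplify; [|lra|lra]. nra. }
pose proof (acos_bound (x / r)).
destruct (Rle_dec 0 y) as [Hy | Hy].
- exists r, (acos (x / r)). rewrite cos_acos, sin_acos, Hs by exact Hb.
  rewrite (Rabs_pos_eq y Hy). repeat split; try lra; field; lra.
- exists r, (2 * PI - acos (x / r)).
  rewrite cos_minus, sin_minus, cos_2PI, sin_2PI, cos_acos, sin_acos, Hs by exact Hb.
  rewrite (Rabs_left y) by lra. repeat split; try lra; field; lra.
Qed.

(** At a pole the longitude is free and [sph_dtheta] vanishes, so the longitude has to be chosen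
    so that [sph_dphi] is parallel to [v]. *)
Lemma sph_tangent_surj (x v : vec) : S2 x -> TS2 x v ->
  exists phi theta a b, 0 <= phi <= PI /\ 0 <= theta <= 2 * PI /\ x = sph phi theta /\
    v = lincomb a (sph_dphi phi theta) b (sph_dtheta phi theta).
Proof.
intros Hx Hv. destruct x as [[x1 x2] x3], v as [[v1 v2] v3].
unfold S2, TS2, dot in Hx, Hv.
assert (Hb : -1 <= x3 <= 1) by nra.
destruct (Req_dec (x1 ^ 2 + x2 ^ 2) 0) as [E | E].
- assert (x1 = 0) by nra. assert (x2 = 0) by nra. subst x1 x2.
  destruct (polar_coordinates v1 v2) as (r & t & Hr & Ht & E1 & E2).
  pose proof PI_RGT_0.
  assert (Hx3 : x3 = 1 \/ x3 = -1).
  { destruct (Req_dec x3 1); [now left|right]. nra. }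
  destruct Hx3; subst x3.
  + exists 0, t, r, 0. unfold sph, sph_dphi, sph_dtheta. rewrite sin_0, cos_0.
    repeat split; try lra; vec_unfold; f_equal; try f_equal; lra.
  + exists PI, t, (- r), 0. unfold sph, sph_dphi, sph_dtheta. rewrite sin_PI, cos_PI.
    repeat split; try lra; vec_unfold; f_equal; try f_equal; lra.
- destruct (polar_coordinates x1 x2) as (r & t & Hr & Ht & E1 & E2).
  pose proof (sin2_cos2 t) as Hsc. unfold Rsqr in Hsc.
  assert (Hrr : r * r = 1 - x3 * x3).
  { transitivity (x1 * x1 + x2 * x2); [|lra]. subst x1 x2. nra. }
  assert (Hs : sin (acos x3) = r).
  { rewrite sin_acos by exact Hb. unfold Rsqr. rewrite <- Hrr. now apply sqrt_square. }
  assert (Hc : cos (acos x3) = x3) by now apply cos_acos.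
  assert (Hr0 : r <> 0) by (intros ->; apply E; subst; ring).
  exists (acos x3), t, (v1 * x3 * cos t + v2 * x3 * sin t - v3 * r),
    ((v2 * cos t - v1 * sin t) / r).
  pose proof (acos_bound x3).
  assert (Hq : (v2 * cos t - v1 * sin t) / r * r = v2 * cos t - v1 * sin t) by now field.
  unfold sph, sph_dphi, sph_dtheta. rewrite Hs, Hc.
  split; [lra|split; [lra|split]].
  + now f_equal; f_equal.
  + generalize dependent ((v2 * cos t - v1 * sin t) / r). intros q Hq.
    subst x1 x2. clear - Hsc Hrr Hv Hq. vec_unfold.
    generalize dependent (cos t). generalize dependent (sin t). intros.
    f_equal; [f_equal|]; nsatz.
Qed.

(** The metric in Cartesian coordinates, with [g] the round product of [v] and the rotation field. *)
Definition katok (eps : R) (x v : vec) : R :=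
  let g := c3 (cross x v) in let b2 := 1 - eps ^ 2 * (1 - c3 x ^ 2) in
  / b2 * (sqrt (b2 * dot v v + eps ^ 2 * g ^ 2) - eps * g).

Lemma katok_ziller_eq (eps : R) (F : vec -> vec -> R) : is_katok_ziller eps F ->
  forall x v, S2 x -> TS2 x v -> F x v = katok eps x v.
Proof.
intros HF x v Hx Hv.
destruct (sph_tangent_surj x v Hx Hv) as (phi & theta & a & b & Hphi & Htheta & -> & ->).
unfold lincomb at 1. rewrite HF by assumption.
unfold katok, sph, sph_dphi, sph_dtheta. vec_unfold.
pose proof (sin2_cos2 theta) as Ht. pose proof (sin2_cos2 phi) as Hp. unfold Rsqr in *.
set (st := sin theta) in *; set (ct := cos theta) in *.
set (sp := sin phi) in *; set (cp := cos phi) in *.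
assert (Ht' : ct * ct = 1 - st * st) by lra. assert (Hp' : cp * cp = 1 - sp * sp) by lra.
assert (E1 : 1 - cp * (cp * 1) = sp * (sp * 1)) by lra.
assert (E2 : sp * ct * (a * (cp * st) + b * (sp * ct))
             - sp * st * (a * (cp * ct) + b * - (sp * st)) = sp * (sp * 1) * b) by ring [Ht'].
rewrite E1, E2. unfold Rdiv. rewrite Rmult_1_l.
f_equal. f_equal; [f_equal|ring]. ring [Ht' Hp'].
Qed.

Definition speed_root (eps : R) (p : vec * vec) : R := sqrt (1 - eps ^ 2 * c3 (snd p) ^ 2).

(** The value of the metric at [p = (x, v)] is [/ r], where [r v] is on the indicatrix, the round
    unit circle centered at [eps] times the rotation field. The quadratic equation for [r] has
    the roots [eps n3 + S] and [eps n3 - S], with [n3] the height of the normal and [S] the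
    [speed_root]. *)
Definition finsler_norm (eps : R) (p : vec * vec) : R :=
  / (speed_root eps p + eps * c3 (normal p)).

Lemma speed_root_spec (eps : R) (p : vec * vec) : 0 < eps < 1 -> HM p ->
  0 < speed_root eps p /\ speed_root eps p ^ 2 = 1 - eps ^ 2 * c3 (snd p) ^ 2 /\
  0 < speed_root eps p + eps * c3 (normal p) /\
  0 < speed_root eps p - eps * c3 (normal p).
Proof.
intros He Hp. pose proof (frame_row3 p Hp) as Hr. unfold speed_root.
set (a := c3 (fst p)) in *. set (b := c3 (snd p)) in *. set (g := c3 (normal p)) in *.
assert (Hpos : 0 < 1 - eps ^ 2 * b ^ 2) by nra.
pose proof (sqrt_lt_R0 _ Hpos) as Hs.
pose proof (pow2_sqrt (1 - eps ^ 2 * b ^ 2) (Rlt_le _ _ Hpos)) as Hs2.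
set (s := sqrt (1 - eps ^ 2 * b ^ 2)) in *.
assert (0 < s ^ 2 - (eps * g) ^ 2) by nra.
repeat split; try assumption; nra.
Qed.

(** The metric is differentiated along the segment [v + t dx], which stays in the tangent plane,
    where the metric is given by [katok]. *)
Lemma hilbert_form_eq (eps : R) (F : vec -> vec -> R) (p Y : vec * vec) :
  0 < eps < 1 -> is_katok_ziller eps F -> HM p -> THM p Y ->
  hilbert_form F p Y = finsler_norm eps p *
    (forward p Y - eps * c3 (snd p) * side p Y / speed_root eps p).
Proof.
intros He HF Hp HY. unfold hilbert_form.
destruct (speed_root_spec eps p He Hp) as (HS & HS2 & HSg & HSg').
pose proof (frame_row3 p Hp) as Hr.
rewrite (Derive_ext _ (fun t => katok eps (fst p) (plus (snd p) (scal t (fst Y))))).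
2:{ intros t. apply (katok_ziller_eq eps F HF); [apply Hp|].
  destruct Hp as (_ & Hxv & _). clear - Hxv HY. vec_destruct. vec_unfold.
  destruct HY as (H1 & _). clear - Hxv H1. nsatz. }
pose proof (f_equal fst (THM_frame p Y Hp HY)) as HdY.
set (ga := forward p Y) in *. set (be := side p Y) in *. unfold frame_vector in HdY.
simpl in HdY. set (dx := lincomb ga (snd p) (- be) (normal p)) in *.
set (z1 := c3 (fst p)) in *. set (z2 := c3 (snd p)) in *. set (z3 := c3 (normal p)) in *.
set (S := speed_root eps p) in *.
set (b2 := 1 - eps ^ 2 * (1 - z1 ^ 2)).
assert (Hb2 : b2 = (S + eps * z3) * (S - eps * z3)) by (unfold b2; nra).
assert (Hb2pos : 0 < b2) by (rewrite Hb2; now apply Rmult_lt_0_compat).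
rewrite (Derive_ext _ (fun t => / b2 *
  (sqrt (b2 * (1 + 2 * t * ga + t ^ 2 * (ga ^ 2 + be ^ 2))
         + eps ^ 2 * (z3 + t * (ga * z3 + be * z2)) ^ 2)
   - eps * (z3 + t * (ga * z3 + be * z2))))).
2:{ intros t.
  assert (E : forall w, dot w w = 1 + 2 * t * ga + t ^ 2 * (ga ^ 2 + be ^ 2) ->
    c3 (cross (fst p) w) = z3 + t * (ga * z3 + be * z2) ->
    katok eps (fst p) w = / b2 *
      (sqrt (b2 * (1 + 2 * t * ga + t ^ 2 * (ga ^ 2 + be ^ 2))
         + eps ^ 2 * (z3 + t * (ga * z3 + be * z2)) ^ 2)
       - eps * (z3 + t * (ga * z3 + be * z2))))
    by (intros w E1 E2; unfold katok; now rewrite E1, E2).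
  rewrite HdY. apply E.
  - destruct (HM_normal p Hp) as (N1 & _ & N3). destruct Hp as (_ & _ & Hv). unfold dx.
    transitivity ((1 + t * ga) ^ 2 * dot (snd p) (snd p) + (t * be) ^ 2 * dot (normal p) (normal p)
      - 2 * (1 + t * ga) * (t * be) * dot (snd p) (normal p)).
    + generalize (normal p) ga be. clear. intros n g' b'. vec_destruct. vec_unfold. ring.
    + rewrite N1, N3, Hv. ring.
  - unfold dx, z3, z2. clear -Hp. destruct Hp as (Hx & Hxv & Hv).
    vec_destruct. vec_unfold. generalize ga be. intros. clear ga be. nsatz. }
assert (HsqrtS : sqrt (S ^ 2) = S) by (apply sqrt_pow2; lra).
apply is_derive_unique. auto_derive.
- match goal with |- 0 < ?e => replace e with (S ^ 2) by (rewrite Hb2; ring) end. nra.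
- match goal with |- context [sqrt ?e] => replace e with (S ^ 2) by (rewrite Hb2; ring) end.
  rewrite HsqrtS. unfold finsler_norm. fold S z3. rewrite Hb2. field. repeat split; lra.
Qed.

(** * Curves in the unit tangent bundle *)

Lemma is_derive_fst {U V : NormedModule R_AbsRing} (c : R -> prod_NormedModule R_AbsRing U V) t l :
  is_derive c t l -> is_derive (fun s => fst (c s)) t (fst l).
Proof.
intros Hc. apply (filterdiff_comp' c fst t (fun y => scal y l) fst Hc).
apply filterdiff_linear, is_linear_fst.
Qed.

Lemma is_derive_snd {U V : NormedModule R_AbsRing} (c : R -> prod_NormedModule R_AbsRing U V) t l :
  is_derive c t l -> is_derive (fun s => snd (c s)) t (snd l).
Proof.
intros Hc. apply (filterdiff_comp' c snd t (fun y => scal y l) snd Hc).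
apply filterdiff_linear, is_linear_snd.
Qed.

Lemma is_derive_coords (x : R -> vec) t (dx : vec) : is_derive x t dx <->
  is_derive (fun s => c1 (x s)) t (c1 dx) /\ is_derive (fun s => c2 (x s)) t (c2 dx) /\
  is_derive (fun s => c3 (x s)) t (c3 dx).
Proof.
split.
- intros H. pose proof (is_derive_fst x t dx H) as H12. split; [|split].
  + exact (is_derive_fst (U := R_NormedModule) (V := R_NormedModule) (fun s => fst (x s)) t _ H12).
  + exact (is_derive_snd (U := R_NormedModule) (V := R_NormedModule) (fun s => fst (x s)) t _ H12).
  + apply (is_derive_snd x t dx H).
- intros (H1 & H2 & H3). destruct dx as [[a b] c].
  apply (is_derive_ext (fun s => (c1 (x s), c2 (x s), c3 (x s)) : vec)).
  + intros s. unfold c1, c2, c3. now destruct (x s) as [[? ?] ?].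
  + now apply is_derive_vec.
Qed.

Lemma Dvec_eq (x : R -> vec) t (dx : vec) : is_derive x t dx -> Dvec x t = dx.
Proof.
intros H. apply is_derive_coords in H. destruct H as (H1 & H2 & H3). unfold Dvec.
destruct dx as [[a b] c].
f_equal; [f_equal|]; apply is_derive_unique; assumption.
Qed.

Definition is_velocity (c : R -> vec * vec) (t : R) (Y : vec * vec) : Prop :=
  is_derive (fun s => fst (c s)) t (fst Y) /\ is_derive (fun s => snd (c s)) t (snd Y).

Lemma velocity_eq (c : R -> vec * vec) t Y : is_velocity c t Y -> velocity c t = Y.
Proof.
intros [H1 H2]. destruct Y as [dx dv]. unfold velocity.
f_equal; apply Dvec_eq; assumption.
Qed.

Lemma is_derive_Rmult (f g : R -> R) (t f' g' : R) : is_derive f t f' -> is_derive g t g' ->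
  is_derive (fun s => f s * g s) t (f' * g t + f t * g').
Proof. intros Hf Hg. apply (is_derive_mult f g); auto. intros; apply Rmult_comm. Qed.

Lemma is_derive_dot (x y : R -> vec) t (dx dy : vec) :
  is_derive x t dx -> is_derive y t dy ->
  is_derive (fun s => dot (x s) (y s)) t (dot dx (y t) + dot (x t) dy).
Proof.
intros Hx Hy. apply is_derive_coords in Hx, Hy.
destruct Hx as (X1 & X2 & X3), Hy as (Y1 & Y2 & Y3).
apply (is_derive_ext (fun s => c1 (x s) * c1 (y s) + c2 (x s) * c2 (y s) + c3 (x s) * c3 (y s))).
{ intros s. unfold c1, c2, c3, dot. now destruct (x s) as [[? ?] ?], (y s) as [[? ?] ?]. }
replace (dot dx (y t) + dot (x t) dy) with
  ((c1 dx * c1 (y t) + c1 (x t) * c1 dy) + (c2 dx * c2 (y t) + c2 (x t) * c2 dy)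
   + (c3 dx * c3 (y t) + c3 (x t) * c3 dy)).
2:{ unfold c1, c2, c3, dot. destruct (x t) as [[? ?] ?], (y t) as [[? ?] ?],
    dx as [[? ?] ?], dy as [[? ?] ?]. simpl. ring. }
apply (is_derive_plus (fun s => c1 (x s) * c1 (y s) + c2 (x s) * c2 (y s)));
  [|now apply is_derive_Rmult].
apply (is_derive_plus (fun s => c1 (x s) * c1 (y s))); now apply is_derive_Rmult.
Qed.

Lemma is_derive_cross (x y : R -> vec) t (dx dy : vec) :
  is_derive x t dx -> is_derive y t dy ->
  is_derive (fun s => cross (x s) (y s)) t (lincomb 1 (cross dx (y t)) 1 (cross (x t) dy)).
Proof.
intros Hx Hy. apply is_derive_coords in Hx, Hy. apply is_derive_coords.
destruct Hx as (X1 & X2 & X3), Hy as (Y1 & Y2 & Y3).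
assert (Hm : forall (f g h k : R -> R) (f' g' h' k' : R), is_derive f t f' -> is_derive g t g' ->
  is_derive h t h' -> is_derive k t k' ->
  is_derive (fun s => f s * g s - h s * k s) t (f' * g t + f t * g' - (h' * k t + h t * k'))).
{ intros. apply (is_derive_minus (fun s => f s * g s) (fun s => h s * k s));
    now apply is_derive_Rmult. }
split; [|split].
- apply (is_derive_ext (fun s => c2 (x s) * c3 (y s) - c3 (x s) * c2 (y s))).
  { intros s. now destruct (x s) as [[? ?] ?], (y s) as [[? ?] ?]. }
  evar_last; [eapply Hm; eassumption|].
  cbv beta. destruct (x t) as [[? ?] ?], (y t) as [[? ?] ?], dx as [[? ?] ?], dy as [[? ?] ?].
  vec_unfold. ring.
- apply (is_derive_ext (fun s => c3 (x s) * c1 (y s) - c1 (x s) * c3 (y s))).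
  { intros s. now destruct (x s) as [[? ?] ?], (y s) as [[? ?] ?]. }
  evar_last; [eapply Hm; eassumption|].
  cbv beta. destruct (x t) as [[? ?] ?], (y t) as [[? ?] ?], dx as [[? ?] ?], dy as [[? ?] ?].
  vec_unfold. ring.
- apply (is_derive_ext (fun s => c1 (x s) * c2 (y s) - c2 (x s) * c1 (y s))).
  { intros s. now destruct (x s) as [[? ?] ?], (y s) as [[? ?] ?]. }
  evar_last; [eapply Hm; eassumption|].
  cbv beta. destruct (x t) as [[? ?] ?], (y t) as [[? ?] ?], dx as [[? ?] ?], dy as [[? ?] ?].
  vec_unfold. ring.
Qed.

(** Differentiate the three equations that define [HM]. *)
Lemma velocity_THM (c : R -> vec * vec) t Y :
  (forall s, HM (c s)) -> is_velocity c t Y -> THM (c t) Y.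
Proof.
intros HcM [H1 H2].
assert (K : forall f l (a : R), is_derive f t l -> (forall s, f s = a) -> l = 0).
{ intros f l a Hf Ha. rewrite <- (is_derive_unique f t l Hf), (Derive_ext f (fun _ => a) t Ha).
  apply Derive_const. }
pose proof (K _ _ 1 (is_derive_dot _ _ _ _ _ H1 H1) (fun s => proj1 (HcM s))) as K1.
pose proof (K _ _ 0 (is_derive_dot _ _ _ _ _ H1 H2) (fun s => proj1 (proj2 (HcM s)))) as K2.
pose proof (K _ _ 1 (is_derive_dot _ _ _ _ _ H2 H2) (fun s => proj2 (proj2 (HcM s)))) as K3.
cbv beta in K1, K2, K3. destruct (c t) as [x v], Y as [dx dv]. simpl in K1, K2, K3.
assert (S : forall a b, dot a b = dot b a) by (intros; vec_destruct; unfold dot; ring).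
rewrite (S dx x) in K1. rewrite (S dv v) in K3. repeat split; lra.
Qed.

Section Partials.
Context {V : NormedModule R_AbsRing}.

Definition vmap_dderiv (c : V -> vec) (w q : V) : vec :=
  (dderiv (fun q => c1 (c q)) w q, dderiv (fun q => c2 (c q)) w q, dderiv (fun q => c3 (c q)) w q).

Definition map_dderiv (c : V -> vec * vec) (w q : V) : vec * vec :=
  (vmap_dderiv (fun q => fst (c q)) w q, vmap_dderiv (fun q => snd (c q)) w q).

Lemma smooth_map_dderiv (c : V -> vec * vec) (w : V) :
  smooth_map c -> smooth_map (map_dderiv c w).
Proof.
intros ((A1 & A2 & A3) & (B1 & B2 & B3)).
repeat split; apply smooth_dderiv; assumption.
Qed.

Lemma smooth_map_velocity (c : V -> vec * vec) (l : R -> V) t (w : V) :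
  smooth_map c -> is_derive l t w -> is_velocity (fun s => c (l s)) t (map_dderiv c w (l t)).
Proof.
intros ((A1 & A2 & A3) & (B1 & B2 & B3)) Hl.
split; apply is_derive_coords; (split; [|split]).
- apply (is_derive_comp_curve (fun q => c1 (fst (c q))) l t w A1 Hl).
- apply (is_derive_comp_curve (fun q => c2 (fst (c q))) l t w A2 Hl).
- apply (is_derive_comp_curve (fun q => c3 (fst (c q))) l t w A3 Hl).
- apply (is_derive_comp_curve (fun q => c1 (snd (c q))) l t w B1 Hl).
- apply (is_derive_comp_curve (fun q => c2 (snd (c q))) l t w B2 Hl).
- apply (is_derive_comp_curve (fun q => c3 (snd (c q))) l t w B3 Hl).
Qed.

End Partials.

(** ** Curves with prescribed velocity *)

(** The rotation group acts simply transitively on the unit tangent bundle, so composing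
    rotations about the three axes of the frame at [p], by angles [a], [b], [g], reaches all of
    the tangent space at [p] to first order. *)
Definition rotated_frame (p : vec * vec) (a b g : R) : vec * vec :=
  let rot (y : R * R * R) : vec :=
    let '(y1, y2, y3) := y in plus (lincomb y1 (fst p) y2 (snd p)) (scal y3 (normal p)) in
  (rot (cos b * cos g, cos a * sin g + sin a * sin b * cos g,
        sin a * sin g - cos a * sin b * cos g),
   rot (- (cos b * sin g), cos a * cos g - sin a * sin b * sin g,
        sin a * cos g + cos a * sin b * sin g)).

Lemma rotated_frame_HM (p : vec * vec) (a b g : R) : HM p -> HM (rotated_frame p a b g).
Proof.
intros Hp. destruct (HM_normal p Hp) as (N1 & N2 & N3). destruct Hp as (Hx & Hxv & Hv).
unfold rotated_frame. revert N1 N2 N3. generalize (normal p) as n. destruct p as [x v].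
intros n N1 N2 N3. cbn [fst snd] in *.
assert (D : forall a1 a2 a3 b1 b2 b3,
  dot (plus (lincomb a1 x a2 v) (scal a3 n)) (plus (lincomb b1 x b2 v) (scal b3 n))
  = a1 * b1 + a2 * b2 + a3 * b3).
{ intros. transitivity (a1 * b1 * dot x x + a2 * b2 * dot v v + a3 * b3 * dot n n
    + (a1 * b2 + a2 * b1) * dot x v + (a1 * b3 + a3 * b1) * dot x n
    + (a2 * b3 + a3 * b2) * dot v n).
  - clear. vec_destruct. vec_unfold. ring.
  - unfold S2, TS2 in Hx, Hxv. rewrite Hx, Hxv, Hv, N1, N2, N3. ring. }
pose proof (sin2_cos2 a) as Ha. pose proof (sin2_cos2 b) as Hb. pose proof (sin2_cos2 g) as Hg.
unfold Rsqr in *. clear - Ha Hb Hg D.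
repeat split; unfold S2, TS2; cbn [fst snd]; rewrite D;
  generalize dependent (sin a); generalize dependent (cos a);
  generalize dependent (sin b); generalize dependent (cos b);
  generalize dependent (sin g); generalize dependent (cos g);
  clear; intros; nsatz.
Qed.

Lemma rotated_frame_0 (p : vec * vec) : rotated_frame p 0 0 0 = p.
Proof.
unfold rotated_frame. rewrite sin_0, cos_0. generalize (normal p). intros.
vec_destruct. vec_unfold. repeat f_equal; ring.
Qed.

Section PrescribedVelocity.
Context {V : NormedModule R_AbsRing}.

Lemma rotated_frame_smooth (p : vec * vec) (a b g : V -> R) :
  smooth a -> smooth b -> smooth g ->
  smooth_map (fun q => rotated_frame p (a q) (b q) (g q)).
Proof.
intros Ha Hb Hg.
pose proof (smooth_sin a Ha) as Hsa. pose proof (smooth_cos a Ha) as Hca.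
pose proof (smooth_sin b Hb) as Hsb. pose proof (smooth_cos b Hb) as Hcb.
pose proof (smooth_sin g Hg) as Hsg. pose proof (smooth_cos g Hg) as Hcg.
assert (L : forall (y1 y2 y3 : V -> R) k1 k2 k3, smooth y1 -> smooth y2 -> smooth y3 ->
  smooth (fun q => y1 q * k1 + y2 q * k2 + y3 q * k3)).
{ intros. apply (smooth_plus (fun q => y1 q * k1 + y2 q * k2));
    [apply smooth_plus|]; apply smooth_mult; auto using smooth_const. }
assert (N : forall y : V -> R, smooth y -> smooth (fun q => - y q)).
{ intros y Hy. replace (fun q => - y q) with (fun q => -1 * y q)
    by (apply functional_extensionality; intros; ring).
  apply smooth_mult; auto using smooth_const. }
assert (M : forall y z : V -> R, smooth y -> smooth z -> smooth (fun q => y q - z q))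
  by (intros; apply smooth_plus; auto).
destruct p as [x v]. unfold rotated_frame. cbn [fst snd]. generalize (normal (x, v)) as n. intros n.
destruct x as [[x1 x2] x3], v as [[v1 v2] v3], n as [[n1 n2] n3].
unfold smooth_map, c1, c2, c3. cbn [fst snd].
repeat split; apply L; auto 6 using smooth_mult, smooth_plus.
Qed.

(** Each of the three rotations contributes its infinitesimal generator at angle 0, whatever the
    order in which they are composed. *)
Lemma rotated_frame_velocity (p : vec * vec) (a b g : R -> R) a' b' g' : HM p ->
  a 0 = 0 -> b 0 = 0 -> g 0 = 0 ->
  is_derive a 0 a' -> is_derive b 0 b' -> is_derive g 0 g' ->
  is_velocity (fun t => rotated_frame p (a t) (b t) (g t)) 0 (frame_vector p a' b' g').
Proof.
intros Hp Ha0 Hb0 Hg0 Ha Hb Hg.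
pose proof (is_derive_unique _ _ _ Ha) as Da. pose proof (is_derive_unique _ _ _ Hb) as Db.
pose proof (is_derive_unique _ _ _ Hg) as Dg.
assert (Ea : ex_derive a 0) by now exists a'. assert (Eb : ex_derive b 0) by now exists b'.
assert (Eg : ex_derive g 0) by now exists g'.
unfold rotated_frame, frame_vector. destruct p as [x v]. cbn [fst snd].
generalize (normal (x, v)) as n. intros n. clear Hp.
destruct x as [[x1 x2] x3], v as [[v1 v2] v3], n as [[n1 n2] n3].
split; apply is_derive_coords; vec_unfold;
  (split; [|split]); (auto_derive; [auto 40|]);
  change (fun x => a x) with a; change (fun x => b x) with b; change (fun x => g x) with g;
  rewrite ?Ha0, ?Hb0, ?Hg0, ?Da, ?Db, ?Dg, ?sin_0, ?cos_0; ring.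
Qed.

End PrescribedVelocity.

(** * The exterior derivative of the Hilbert form *)

Definition reeb_twist (eps : R) (p : vec * vec) : R :=
  eps * finsler_norm eps p * c3 (fst p) * (1 + finsler_norm eps p * speed_root eps p).

(** The expression in the coframe comes from the structure equations
    [d forward = - spin /\ side] and [d side = spin /\ forward] of the rotation group. *)
Definition d_hilbert_frame (eps : R) (p Y Z : vec * vec) : R :=
  - ((spin p Y * side p Z - spin p Z * side p Y)
     + reeb_twist eps p * (side p Y * forward p Z - side p Z * forward p Y))
  / speed_root eps p ^ 3.

Lemma dot_frame_vector (p : vec * vec) (a b g a' b' g' : R) : HM p ->
  dot (fst (frame_vector p a b g)) (snd (frame_vector p a' b' g')) = - (b * a').
Proof.
intros Hp. destruct (HM_normal p Hp) as (N1 & N2 & N3). destruct Hp as (Hx & Hxv & Hv).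
unfold frame_vector. revert N1 N2 N3. generalize (normal p) as n. destruct p as [x v].
intros n N1 N2 N3. cbn [fst snd] in *. unfold S2, TS2 in Hx, Hxv.
transitivity (- b * a' * dot n n + g * a' * dot v n - g * g' * dot x v + b * g' * dot x n).
- clear. vec_destruct. vec_unfold. ring.
- rewrite N1, N2, N3, Hxv. ring.
Qed.

(** The frame [(fst, snd, normal)] rotates with angular velocity [(a, b, g)] in its own axes. *)
Lemma normal_velocity (c : R -> vec * vec) t a b g : HM (c t) ->
  is_velocity c t (frame_vector (c t) a b g) ->
  is_derive (fun s => normal (c s)) t (lincomb (- a) (snd (c t)) b (fst (c t))).
Proof.
intros Hp [H1 H2]. unfold normal. evar_last; [exact (is_derive_cross _ _ _ _ _ H1 H2)|].
cbv beta. destruct (HM_normal _ Hp) as (N1 & N2 & N3). destruct Hp as (Hx & Hxv & Hv).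
destruct (c t) as [x v]. unfold S2, TS2 in *. unfold frame_vector, normal in *. cbn [fst snd] in *.
assert (E1 : cross (cross x v) v = lincomb (dot x v) v (- dot v v) x)
  by (clear; vec_destruct; vec_unfold; f_equal; [f_equal|]; ring).
assert (E2 : cross x (cross x v) = lincomb (dot x v) x (- dot x x) v)
  by (clear; vec_destruct; vec_unfold; f_equal; [f_equal|]; ring).
transitivity (lincomb (- b) (cross (cross x v) v) a (cross x (cross x v))).
- generalize (cross x v). clear. intros. vec_destruct; vec_unfold; f_equal; [f_equal|]; ring.
- rewrite E1, E2, Hx, Hxv, Hv. clear. vec_destruct; vec_unfold; f_equal; [f_equal|]; ring.
Qed.

Lemma is_derive_hilbert_scalar (eps : R) (z2 z3 ga be : R -> R) (t z2' z3' ga' be' : R) :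
  is_derive z2 t z2' -> is_derive z3 t z3' -> is_derive ga t ga' -> is_derive be t be' ->
  let S := sqrt (1 - eps ^ 2 * z2 t ^ 2) in
  0 < 1 - eps ^ 2 * z2 t ^ 2 -> S + eps * z3 t <> 0 ->
  let N := / (S + eps * z3 t) in
  let S' := - eps ^ 2 * z2 t * z2' / S in let N' := - N ^ 2 * (S' + eps * z3') in
  is_derive (fun s => / (sqrt (1 - eps ^ 2 * z2 s ^ 2) + eps * z3 s)
    * (ga s - eps * z2 s * be s / sqrt (1 - eps ^ 2 * z2 s ^ 2))) t
    (N' * (ga t - eps * z2 t * be t / S) +
     N * (ga' - eps * (z2' * be t / S + z2 t * be' / S - z2 t * be t * S' / S ^ 2))).
Proof.
intros D2 D3 Dg Db S Hpos Hne N S' N'.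
pose proof (is_derive_unique _ _ _ D2) as U2. pose proof (is_derive_unique _ _ _ D3) as U3.
pose proof (is_derive_unique _ _ _ Dg) as Ug. pose proof (is_derive_unique _ _ _ Db) as Ub.
assert (ex_derive z2 t) by now exists z2'. assert (ex_derive z3 t) by now exists z3'.
assert (ex_derive ga t) by now exists ga'. assert (ex_derive be t) by now exists be'.
assert (HS : 0 < S) by now apply sqrt_lt_R0.
assert (E : 1 + - (eps * (eps * 1) * (z2 t * (z2 t * 1))) = 1 - eps ^ 2 * z2 t ^ 2) by ring.
auto_derive.
- rewrite E. fold S. repeat split; auto; lra.
- change (fun x => z2 x) with z2. change (fun x => z3 x) with z3.
  change (fun x => ga x) with ga. change (fun x => be x) with be.
  rewrite U2, U3, Ug, Ub.
  rewrite E. fold S. unfold N', N, S', N. field. split; lra.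
Qed.

Section KatokZiller.
Context (eps : R) (F : vec -> vec -> R) (He : 0 < eps < 1) (HF : is_katok_ziller eps F).

(** The heights [z1], [z2], [z3] of the axes vary with the rotation of the frame; [W] is the
    derivative of the base component of the field, which cancels from [dA] because it is
    symmetric in the two parameters. *)
Lemma is_derive_hilbert_form (c Y : R -> vec * vec) t a b g W :
  (forall s, HM (c s)) -> (forall s, THM (c s) (Y s)) ->
  is_velocity c t (frame_vector (c t) a b g) -> is_derive (fun s => fst (Y s)) t W ->
  let z1 := c3 (fst (c t)) in let z2 := c3 (snd (c t)) in let z3 := c3 (normal (c t)) in
  let S := speed_root eps (c t) in let N := finsler_norm eps (c t) in
  let ga := forward (c t) (Y t) in let be := side (c t) (Y t) in
  let z2' := a * z3 - g * z1 in let z3' := - a * z2 + b * z1 in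
  let S' := - eps ^ 2 * z2 * z2' / S in let N' := - N ^ 2 * (S' + eps * z3') in
  let ga' := dot W (snd (c t)) - be * a in
  let be' := - dot W (normal (c t)) + a * ga in
  is_derive (fun s => hilbert_form F (c s) (Y s)) t
    (N' * (ga - eps * z2 * be / S) +
     N * (ga' - eps * (z2' * be / S + z2 * be' / S - z2 * be * S' / S ^ 2))).
Proof.
intros HcM HYM Hc HY z1 z2 z3 S N ga be z2' z3' S' N' ga' be'.
pose proof (normal_velocity c t a b g (HcM t) Hc) as Hn.
destruct Hc as [Hx Hv].
destruct (speed_root_spec eps (c t) He (HcM t)) as (HS & HS2 & HSg & _).
fold S z2 z3 in HS, HS2, HSg.
apply (is_derive_ext (fun s => / (sqrt (1 - eps ^ 2 * c3 (snd (c s)) ^ 2) + eps * c3 (normal (c s)))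
  * (forward (c s) (Y s) - eps * c3 (snd (c s)) * side (c s) (Y s)
     / sqrt (1 - eps ^ 2 * c3 (snd (c s)) ^ 2)))).
{ intros s. symmetry. exact (hilbert_form_eq eps F (c s) (Y s) He HF (HcM s) (HYM s)). }
assert (Dz2 : is_derive (fun s => c3 (snd (c s))) t z2').
{ apply is_derive_coords in Hv. destruct Hv as (_ & _ & Hv3). evar_last; [exact Hv3|].
  unfold z2', z3, z1, frame_vector. generalize (normal (c t)). clear.
  destruct (c t) as [x v]. intros. vec_destruct. vec_unfold. ring. }
assert (Dz3 : is_derive (fun s => c3 (normal (c s))) t z3').
{ apply is_derive_coords in Hn. destruct Hn as (_ & _ & Hn3). evar_last; [exact Hn3|].
  unfold z3', z2, z1. clear. destruct (c t) as [x v]. vec_destruct. vec_unfold. ring. }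
pose proof (THM_frame _ _ (HcM t) (HYM t)) as EY. fold ga be in EY.
assert (Dga : is_derive (fun s => forward (c s) (Y s)) t ga').
{ unfold forward. evar_last; [exact (is_derive_dot _ _ _ _ _ HY Hv)|]. cbv beta.
  pose proof (dot_frame_vector (c t) (spin (c t) (Y t)) be ga a b g (HcM t)) as E.
  rewrite <- EY in E. unfold ga'. rewrite E. ring. }
assert (Dbe : is_derive (fun s => side (c s) (Y s)) t be').
{ unfold side. evar_last; [exact (is_derive_opp _ _ _ (is_derive_dot _ _ _ _ _ HY Hn))|]. cbv beta.
  unfold be'. change opp with Ropp.
  enough (E : dot (fst (Y t)) (lincomb (- a) (snd (c t)) b (fst (c t))) = - (a * ga)).
  { rewrite E. unfold opp; simpl. ring. }
  transitivity (- a * dot (fst (Y t)) (snd (c t)) + b * dot (fst (c t)) (fst (Y t))).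
  - clear. destruct (c t) as [x v], (Y t) as [dx dv]. vec_destruct. vec_unfold. ring.
  - pose proof (HYM t) as HYt. unfold THM in HYt. destruct (c t) as [x v], (Y t) as [dx dv].
    destruct HYt as (H1 & _). cbn [fst snd] in *. rewrite H1. unfold ga, forward. simpl. ring. }
assert (Hpos : 0 < 1 - eps ^ 2 * z2 ^ 2) by (rewrite <- HS2; nra).
assert (Hne : S + eps * z3 <> 0) by lra.
exact (is_derive_hilbert_scalar eps (fun s => c3 (snd (c s))) (fun s => c3 (normal (c s)))
  (fun s => forward (c s) (Y s)) (fun s => side (c s) (Y s)) t z2' z3' ga' be'
  Dz2 Dz3 Dga Dbe Hpos Hne).
Qed.

Lemma is_ext_deriv_d_hilbert_frame : is_ext_deriv (hilbert_form F) (d_hilbert_frame eps).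
Proof.
intros c Hc HcM cs ct s t.
pose proof (smooth_map_dderiv c (1, 0) Hc) as Hc1.
pose proof (smooth_map_dderiv c (0, 1) Hc) as Hc2.
assert (L1 : forall s t, is_derive (fun s' => (s', t)) s ((1, 0) : R * R))
  by (intros s' t'; apply is_derive_pair; [apply (is_derive_id s')|apply (is_derive_const t' s')]).
assert (L2 : forall s t, is_derive (fun t' => (s, t')) t ((0, 1) : R * R))
  by (intros s' t'; apply is_derive_pair; [apply (is_derive_const s' t')|apply (is_derive_id t')]).
assert (V1 : forall s t, is_velocity (fun s' => c (s', t)) s (map_dderiv c (1, 0) (s, t)))
  by (intros; apply (smooth_map_velocity c (fun s' => (s', _)) _ (1, 0) Hc), L1).
assert (V2 : forall s t, is_velocity (fun t' => c (s, t')) t (map_dderiv c (0, 1) (s, t)))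
  by (intros; apply (smooth_map_velocity c (fun t' => (_, t')) _ (0, 1) Hc), L2).
assert (E1 : cs = fun s t => map_dderiv c (1, 0) (s, t)).
{ apply functional_extensionality; intros s'; apply functional_extensionality; intros t'.
  apply velocity_eq, V1. }
assert (E2 : ct = fun s t => map_dderiv c (0, 1) (s, t)).
{ apply functional_extensionality; intros s'; apply functional_extensionality; intros t'.
  apply velocity_eq, V2. }
rewrite E1, E2. clear cs ct E1 E2.
assert (T1 : forall s t, THM (c (s, t)) (map_dderiv c (1, 0) (s, t)))
  by (intros s' t'; exact (velocity_THM (fun s' => c (s', t')) s' _ (fun _ => HcM _) (V1 s' t'))).
assert (T2 : forall s t, THM (c (s, t)) (map_dderiv c (0, 1) (s, t)))
  by (intros s' t'; exact (velocity_THM (fun t' => c (s', t')) t' _ (fun _ => HcM _) (V2 s' t'))).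
pose proof (smooth_map_velocity _ (fun s' => (s', t)) s (1, 0) Hc2 (L1 s t)) as [W1 _].
pose proof (smooth_map_velocity _ (fun t' => (s, t')) t (0, 1) Hc1 (L2 s t)) as [W2 _].
(* The mixed second derivative of the base point is the same in both orders. *)
assert (EW : fst (map_dderiv (map_dderiv c (0, 1)) (1, 0) (s, t))
           = fst (map_dderiv (map_dderiv c (1, 0)) (0, 1) (s, t))).
{ destruct Hc as ((A1 & A2 & A3) & _). unfold map_dderiv at 1 3. cbn [fst].
  unfold vmap_dderiv at 1 2. cbn [fst].
  f_equal; [f_equal|].
  - exact (dderiv_comm (fun q => c1 (fst (c q))) s t A1).
  - exact (dderiv_comm (fun q => c2 (fst (c q))) s t A2).
  - exact (dderiv_comm (fun q => c3 (fst (c q))) s t A3). }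
rewrite EW in W1. clear EW. set (W := fst (map_dderiv (map_dderiv c (1, 0)) (0, 1) (s, t))) in *.
set (Ys := map_dderiv c (1, 0) (s, t)) in *. set (Yt := map_dderiv c (0, 1) (s, t)) in *.
pose proof (V1 s t) as VV1. pose proof (V2 s t) as VV2.
rewrite (THM_frame _ _ (HcM (s, t)) (T1 s t)) in VV1.
rewrite (THM_frame _ _ (HcM (s, t)) (T2 s t)) in VV2. fold Ys in VV1. fold Yt in VV2.
pose proof (is_derive_hilbert_form (fun s' => c (s', t)) (fun s' => map_dderiv c (0, 1) (s', t)) s
  _ _ _ W (fun _ => HcM _) (fun _ => T2 _ _) VV1 W1) as D1.
pose proof (is_derive_hilbert_form (fun t' => c (s, t')) (fun t' => map_dderiv c (1, 0) (s, t')) t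
  _ _ _ W (fun _ => HcM _) (fun _ => T1 _ _) VV2 W2) as D2.
cbv zeta in D1, D2. fold Ys in D2. fold Yt in D1.
etransitivity; [|apply (f_equal2 Rminus); symmetry;
  [exact (is_derive_unique _ _ _ D1)|exact (is_derive_unique _ _ _ D2)]].
cbv beta. clear D1 D2.
change (map_dderiv c (1, 0) (s, t)) with Ys. change (map_dderiv c (0, 1) (s, t)) with Yt.
destruct (speed_root_spec eps (c (s, t)) He (HcM (s, t))) as (HS & HS2 & HSg & _).
unfold d_hilbert_frame, reeb_twist, finsler_norm.
generalize dependent (speed_root eps (c (s, t))). intros S HS HS2 HSg.
clear - HS HS2 HSg.
generalize dependent (c3 (normal (c (s, t)))). intros z3 HSg.
generalize dependent (c3 (snd (c (s, t)))). intros z2 HS2.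
generalize (c3 (fst (c (s, t)))) as z1.
generalize (dot W (snd (c (s, t)))) (dot W (normal (c (s, t)))).
generalize (spin (c (s, t)) Ys) (side (c (s, t)) Ys) (forward (c (s, t)) Ys).
generalize (spin (c (s, t)) Yt) (side (c (s, t)) Yt) (forward (c (s, t)) Yt).
intros a' b' g' a b g w1 w2 z1.
field_simplify_eq; [|repeat split; lra].
ring [HS2].
Qed.
End KatokZiller.

Lemma the_spec {T : Type} (d : T) (P : T -> Prop) (a : T) : P a -> P (the d P).
Proof. intros Ha. exact (epsilon_spec (inhabits d) P (ex_intro _ a Ha)). Qed.

Lemma smooth_combination (a b : R) : smooth (fun q : R * R => a * fst q + b * snd q).
Proof.
apply smooth_plus; apply smooth_mult; try apply smooth_const; apply smooth_linear.
- apply is_linear_fst.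
- apply is_linear_snd.
Qed.

Lemma is_derive_radical (eps : R) (z2 z3 : R -> R) (t z2' z3' : R) :
  is_derive z2 t z2' -> is_derive z3 t z3' -> 0 < 1 - eps ^ 2 * z2 t ^ 2 ->
  is_derive (fun s => sqrt (1 - eps ^ 2 * z2 s ^ 2) + eps * z3 s) t
    (- eps ^ 2 * z2 t * z2' / sqrt (1 - eps ^ 2 * z2 t ^ 2) + eps * z3').
Proof.
intros D2 D3 Hpos.
pose proof (is_derive_unique _ _ _ D2) as U2. pose proof (is_derive_unique _ _ _ D3) as U3.
assert (ex_derive z2 t) by now exists z2'. assert (ex_derive z3 t) by now exists z3'.
pose proof (sqrt_lt_R0 _ Hpos).
assert (E : 1 + - (eps * (eps * 1) * (z2 t * (z2 t * 1))) = 1 - eps ^ 2 * z2 t ^ 2) by ring.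
auto_derive.
- rewrite E. repeat split; auto.
- change (fun x => z2 x) with z2. change (fun x => z3 x) with z3.
  rewrite U2, U3, E. field. lra.
Qed.

Section KatokZiller.
Context (eps : R) (F : vec -> vec -> R) (He : 0 < eps < 1) (HF : is_katok_ziller eps F).

(** Rotating the frame at [p] by angles that are linear in two parameters realizes any pair of
    tangent vectors, so the characterization of the exterior derivative determines its values. *)
Lemma d_hilbert_eq (p Y Z : vec * vec) : HM p -> THM p Y -> THM p Z ->
  d_hilbert F p Y Z = d_hilbert_frame eps p Y Z.
Proof.
intros Hp HY HZ.
assert (Hd : is_ext_deriv (hilbert_form F) (d_hilbert F)).
{ apply (the_spec _ _ (d_hilbert_frame eps)).
  exact (is_ext_deriv_d_hilbert_frame eps F He HF). }
pose (l := fun a b (q : R * R) => a * fst q + b * snd q).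
pose (c := fun q => rotated_frame p (l (spin p Y) (spin p Z) q) (l (side p Y) (side p Z) q)
  (l (forward p Y) (forward p Z) q)).
assert (Hc : smooth_map c)
  by exact (rotated_frame_smooth p _ _ _ (smooth_combination _ _) (smooth_combination _ _)
              (smooth_combination _ _)).
assert (HcM : forall q, HM (c q)) by (intros; exact (rotated_frame_HM p _ _ _ Hp)).
assert (D1 : forall a b, is_derive (fun s => l a b (s, 0)) 0 a).
{ intros a b. unfold l. cbn [fst snd]. auto_derive; [easy|ring]. }
assert (D2 : forall a b, is_derive (fun t => l a b (0, t)) 0 b).
{ intros a b. unfold l. cbn [fst snd]. auto_derive; [easy|ring]. }
assert (L0 : forall a b, l a b (0, 0) = 0) by (intros; unfold l; cbn [fst snd]; ring).
assert (E0 : c (0, 0) = p) by (unfold c; rewrite !L0; apply rotated_frame_0).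
pose proof (rotated_frame_velocity p (fun s => l (spin p Y) (spin p Z) (s, 0))
  (fun s => l (side p Y) (side p Z) (s, 0)) (fun s => l (forward p Y) (forward p Z) (s, 0))
  _ _ _ Hp (L0 _ _) (L0 _ _) (L0 _ _) (D1 _ _) (D1 _ _) (D1 _ _)) as V1.
pose proof (rotated_frame_velocity p (fun s => l (spin p Y) (spin p Z) (0, s))
  (fun s => l (side p Y) (side p Z) (0, s)) (fun s => l (forward p Y) (forward p Z) (0, s))
  _ _ _ Hp (L0 _ _) (L0 _ _) (L0 _ _) (D2 _ _) (D2 _ _) (D2 _ _)) as V2.
rewrite <- (THM_frame p Y Hp HY) in V1. rewrite <- (THM_frame p Z Hp HZ) in V2.
apply velocity_eq in V1, V2.
pose proof (Hd c Hc HcM 0 0) as B1.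
pose proof (is_ext_deriv_d_hilbert_frame eps F He HF c Hc HcM 0 0) as B2.
cbv zeta in B1, B2. pose proof (eq_trans B1 (eq_sym B2)) as B. clear B1 B2.
change (velocity (fun s' => c (s', 0)) 0 = Y) in V1.
change (velocity (fun s' => c (0, s')) 0 = Z) in V2.
assert (K : forall q Y' Z', q = p -> Y' = Y -> Z' = Z ->
  d_hilbert F q Y' Z' = d_hilbert_frame eps q Y' Z' ->
  d_hilbert F p Y Z = d_hilbert_frame eps p Y Z) by (intros q Y' Z' -> -> ->; trivial).
exact (K _ _ _ E0 V1 V2 B).
Qed.

Lemma det3_frame (p Y Z : vec * vec) : HM p -> THM p Y -> THM p Z ->
  det3 (fst p) (fst Y) (fst Z) = side p Y * forward p Z - forward p Y * side p Z.
Proof.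
intros Hp HY HZ.
rewrite (THM_frame p Y Hp HY) at 1. rewrite (THM_frame p Z Hp HZ) at 1.
generalize (spin p Y) (side p Y) (forward p Y) (spin p Z) (side p Z) (forward p Z).
intros a b g a' b' g'. clear HY HZ Y Z.
destruct (HM_normal p Hp) as (N1 & N2 & N3).
transitivity ((b * g' - g * b') * dot (normal p) (normal p)).
- destruct p as [x v]. unfold frame_vector, normal. clear. vec_destruct. vec_unfold. ring.
- rewrite N1. ring.
Qed.

(** [A] has no [spin] component and the [spin] part of [dA] is a multiple of [spin /\ side], so
    only the wedge of [spin] with [forward /\ side], the round area form up to sign, survives. *)
Lemma contact_volume_eq (p Y1 Y2 Y3 : vec * vec) :
  HM p -> THM p Y1 -> THM p Y2 -> THM p Y3 ->
  contact_volume F p Y1 Y2 Y3 = - (finsler_norm eps p / speed_root eps p ^ 3) *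
    (spin p Y1 * det3 (fst p) (fst Y2) (fst Y3) - spin p Y2 * det3 (fst p) (fst Y1) (fst Y3)
     + spin p Y3 * det3 (fst p) (fst Y1) (fst Y2)).
Proof.
intros Hp H1 H2 H3. unfold contact_volume.
rewrite !d_hilbert_eq, !(hilbert_form_eq eps F), !det3_frame by assumption.
destruct (speed_root_spec eps p He Hp) as (HS & _).
unfold d_hilbert_frame. field. lra.
Qed.

(** * The Reeb field *)

Definition rotation_field (y : vec) : vec := let '(y1, y2, y3) := y in (- y2, y1, 0).

(** The component of the Reeb field along [side] vanishes because [dA] pairs [side] with [spin];
    the [forward] component is then the inverse of the metric, and the [spin] component solves
    [i_X dA = 0]. *)
Definition reeb_frame (eps : R) (p : vec * vec) : vec * vec :=
  frame_vector p (eps * c3 (fst p) * (1 + finsler_norm eps p * speed_root eps p)) 0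
    (speed_root eps p + eps * c3 (normal p)).

(** The second derivative of the base point along the Reeb flow: geodesic acceleration, Coriolis
    acceleration (the base point moves with velocity [r v], [r] being the inverse of the metric),
    and the opposite of the centripetal acceleration of the rotation. *)
Definition reeb_acceleration (eps : R) (p : vec * vec) : vec :=
  plus (lincomb (-1) (fst p) (2 * eps * (speed_root eps p + eps * c3 (normal p)))
          (rotation_field (snd p)))
    (scal (- eps ^ 2) (rotation_field (rotation_field (fst p)))).

Lemma finsler_norm_inv (p : vec * vec) : HM p ->
  finsler_norm eps p * (speed_root eps p + eps * c3 (normal p)) = 1.
Proof.
intros Hp. destruct (speed_root_spec eps p He Hp) as (_ & _ & HSg & _).
unfold finsler_norm. apply Rinv_l. lra.
Qed.

Lemma is_reeb_reeb_frame : is_reeb F (reeb_frame eps).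
Proof.
intros p Hp. unfold reeb_frame.
pose proof (finsler_norm_inv p Hp) as HN.
destruct (speed_root_spec eps p He Hp) as (HS & _).
set (a := eps * c3 (fst p) * (1 + finsler_norm eps p * speed_root eps p)).
set (g := speed_root eps p + eps * c3 (normal p)) in *.
destruct (THM_frame_vector p a 0 g Hp) as (HT & Ea & Eb & Eg).
split; [exact HT|split].
- rewrite (hilbert_form_eq eps F) by assumption. rewrite Eb, Eg. unfold Rdiv.
  rewrite Rmult_0_r, Rmult_0_l, Rminus_0_r. exact HN.
- intros Y HY. rewrite d_hilbert_eq by assumption. unfold d_hilbert_frame.
  rewrite Ea, Eb, Eg. unfold reeb_twist.
  replace (eps * finsler_norm eps p * c3 (fst p) * (1 + finsler_norm eps p * speed_root eps p))
    with (finsler_norm eps p * a) by (unfold a; ring).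
  transitivity (- (side p Y * a * (1 - finsler_norm eps p * g)) / speed_root eps p ^ 3);
    [|rewrite HN]; field; lra.
Qed.

(** Testing [i_X dA = 0] against the [spin] and [side] directions leaves one parameter, which
    [A (X) = 1] fixes. *)
Lemma reeb_eq (p : vec * vec) : HM p -> reeb F p = reeb_frame eps p.
Proof.
intros Hp.
assert (HR : is_reeb F (reeb F)).
{ apply (the_spec _ _ (reeb_frame eps)). exact is_reeb_reeb_frame. }
destruct (HR p Hp) as (HT & H1 & H0). set (X := reeb F p) in *.
pose proof (finsler_norm_inv p Hp) as HN.
destruct (speed_root_spec eps p He Hp) as (HS & _).
destruct (THM_frame_vector p 1 0 0 Hp) as (TA & A1 & A2 & A3).
destruct (THM_frame_vector p 0 1 0 Hp) as (TB & B1 & B2 & B3).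
pose proof (H0 _ TA) as KA. pose proof (H0 _ TB) as KB.
rewrite d_hilbert_eq in KA, KB by assumption. rewrite (hilbert_form_eq eps F) in H1 by assumption.
unfold d_hilbert_frame in KA, KB. rewrite A1, A2, A3 in KA. rewrite B1, B2, B3 in KB.
assert (HS3 : speed_root eps p ^ 3 <> 0) by (apply pow_nonzero; lra).
assert (Z : forall a, a / speed_root eps p ^ 3 = 0 -> a = 0).
{ intros a Ha. apply (Rmult_eq_reg_r (/ speed_root eps p ^ 3)).
  - rewrite Rmult_0_l. exact Ha.
  - now apply Rinv_neq_0_compat. }
apply Z in KA, KB.
assert (Hb : side p X = 0) by lra. rewrite Hb in *.
assert (Hg : forward p X = speed_root eps p + eps * c3 (normal p)).
{ apply (Rmult_eq_reg_l (finsler_norm eps p)).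
  - rewrite HN, <- H1. unfold Rdiv. ring.
  - intros E. rewrite E in HN. lra. }
rewrite (THM_frame p X Hp HT), Hb, Hg. unfold reeb_frame. f_equal.
transitivity (reeb_twist eps p * forward p X); [lra|]. rewrite Hg. unfold reeb_twist.
transitivity (eps * c3 (fst p) * (1 + finsler_norm eps p * speed_root eps p)
  * (finsler_norm eps p * (speed_root eps p + eps * c3 (normal p)))); [ring|rewrite HN; ring].
Qed.

(** The description is not vacuous, because some curve in [HM] has the velocity [X p] at [p]. *)
Lemma lie_eq (X : vec * vec -> vec * vec) (g : vec * vec -> R) (p : vec * vec) (l : R) :
  HM p -> THM p (X p) ->
  (forall c : R -> vec * vec, smooth_map c -> (forall t, HM (c t)) -> c 0 = p ->
     is_velocity c 0 (X p) -> is_derive (fun t => g (c t)) 0 l) ->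
  lie X g p = l.
Proof.
intros Hp HX Hl.
assert (Hl' : forall c : R -> vec * vec,
    smooth_map c -> (forall t, HM (c t)) -> c 0 = p -> velocity c 0 = X p ->
    is_derive (fun t => g (c t)) 0 l).
{ intros c Hc HcM Hc0 Hv. apply Hl; try assumption.
  pose proof (smooth_map_velocity c (fun t => t) 0 1 Hc (is_derive_id 0)) as Hv'.
  cbv beta in Hv'. rewrite <- Hv.
  exact (eq_ind_r (is_velocity c 0) Hv' (velocity_eq _ _ _ Hv')). }
assert (Hs : forall c : R -> vec * vec,
    smooth_map c -> (forall t, HM (c t)) -> c 0 = p -> velocity c 0 = X p ->
    is_derive (fun t => g (c t)) 0 (lie X g p)) by exact (the_spec 0 (fun l => _) l Hl').
pose (c := fun t => rotated_frame p (spin p (X p) * t) (side p (X p) * t) (forward p (X p) * t)).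
assert (Hc : smooth_map c).
{ assert (L : forall k, smooth (fun t : R => k * t)).
  { intros k. apply (smooth_mult (V := R_NormedModule)); [apply smooth_const|].
    apply smooth_linear, is_linear_id. }
  exact (rotated_frame_smooth p _ _ _ (L _) (L _) (L _)). }
assert (HcM : forall t, HM (c t)) by (intros; exact (rotated_frame_HM p _ _ _ Hp)).
assert (E0 : c 0 = p) by (unfold c; rewrite !Rmult_0_r; apply rotated_frame_0).
assert (D : forall k, is_derive (fun t => k * t) 0 k) by (intros; auto_derive; [easy|ring]).
assert (Hv : velocity c 0 = X p).
{ pose proof (rotated_frame_velocity p (fun t => spin p (X p) * t) (fun t => side p (X p) * t)
    (fun t => forward p (X p) * t) _ _ _ Hp (Rmult_0_r _) (Rmult_0_r _) (Rmult_0_r _)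
    (D _) (D _) (D _)) as Hv.
  rewrite <- (THM_frame p (X p) Hp HX) in Hv. exact (velocity_eq _ _ _ Hv). }
exact (eq_trans (eq_sym (is_derive_unique _ _ _ (Hs c Hc HcM E0 Hv)))
         (is_derive_unique _ _ _ (Hl' c Hc HcM E0 Hv))).
Qed.

Definition basis_vector (i : nat) : vec :=
  match i with 0%nat => (1, 0, 0) | 1%nat => (0, 1, 0) | _ => (0, 0, 1) end.

Definition partial (U : vec -> R) (i : nat) : vec -> R := dderiv U (basis_vector i).

Lemma dderiv_partials (U : vec -> R) (v x : vec) : smooth U ->
  dderiv U v x = c1 v * partial U 0 x + c2 v * partial U 1 x + c3 v * partial U 2 x.
Proof.
intros HU. unfold partial.
rewrite <- (dderiv_lin U (c1 v) (c2 v) _ _ x HU).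
rewrite <- (Rmult_1_l (dderiv U (plus _ _) x)), <- (dderiv_lin U 1 (c3 v) _ _ x HU).
f_equal. destruct v as [[a b] c]. vec_unfold. f_equal; [f_equal|]; ring.
Qed.

Definition hessian (U : vec -> R) (v w x : vec) : R :=
  c1 v * dderiv (partial U 0) w x + c2 v * dderiv (partial U 1) w x
  + c3 v * dderiv (partial U 2) w x.

Lemma is_derive_dderiv_curve (U : vec -> R) (x w : R -> vec) t (dx dw : vec) : smooth U ->
  is_derive x t dx -> is_derive w t dw ->
  is_derive (fun s => dderiv U (w s) (x s)) t
    (hessian U (w t) dx (x t) + dderiv U dw (x t)).
Proof.
intros HU Hx Hw. apply is_derive_coords in Hw. destruct Hw as (W1 & W2 & W3).
apply (is_derive_ext (fun s => c1 (w s) * partial U 0 (x s) + c2 (w s) * partial U 1 (x s)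
  + c3 (w s) * partial U 2 (x s))).
{ intros s. symmetry. now apply dderiv_partials. }
assert (P : forall i, is_derive (fun s => partial U i (x s)) t (dderiv (partial U i) dx (x t))).
{ intros i. apply (is_derive_comp_curve (partial U i) x t dx); [now apply smooth_dderiv|exact Hx]. }
rewrite dderiv_partials by assumption. unfold hessian.
pose proof (is_derive_Rmult _ _ _ _ _ W1 (P 0%nat)) as D1.
pose proof (is_derive_Rmult _ _ _ _ _ W2 (P 1%nat)) as D2.
pose proof (is_derive_Rmult _ _ _ _ _ W3 (P 2%nat)) as D3.
evar_last; [exact (is_derive_plus _ _ _ _ _ (is_derive_plus _ _ _ _ _ D1 D2) D3)|].
unfold plus; simpl. ring.
Qed.

Lemma rotation_field_frame (p : vec * vec) : HM p ->
  rotation_field (snd p) = lincomb (c3 (fst p)) (normal p) (- c3 (normal p)) (fst p) /\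
  rotation_field (rotation_field (fst p)) = plus
    (lincomb (c3 (fst p) ^ 2 - 1) (fst p) (c3 (fst p) * c3 (snd p)) (snd p))
    (scal (c3 (fst p) * c3 (normal p)) (normal p)).
Proof.
intros (Hx & Hxv & Hv). vec_destruct. vec_unfold.
split; (f_equal; [f_equal|]); nsatz.
Qed.

Lemma is_derive_reeb_direction (c : R -> vec * vec) :
  (forall t, HM (c t)) -> is_velocity c 0 (reeb_frame eps (c 0)) ->
  is_derive (fun t => fst (reeb_frame eps (c t))) 0 (reeb_acceleration eps (c 0)).
Proof.
intros HcM Hc. pose proof (HcM 0) as Hp.
pose proof (normal_velocity c 0 _ _ _ Hp Hc) as Hn. destruct Hc as [_ Hv].
destruct (speed_root_spec eps (c 0) He Hp) as (HS & HS2 & HSg & _).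
destruct (rotation_field_frame (c 0) Hp) as [J1 J2].
pose proof (finsler_norm_inv (c 0) Hp) as HN.
set (h := fun t => speed_root eps (c t) + eps * c3 (normal (c t))).
assert (Hw : forall t, scal (h t) (snd (c t)) = fst (reeb_frame eps (c t))).
{ intros t. unfold reeb_frame, frame_vector. cbn [fst]. fold (h t). generalize (h t).
  generalize (normal (c t)). destruct (c t) as [x v]. clear. intros. vec_destruct. vec_unfold.
  f_equal; [f_equal|]; ring. }
apply (is_derive_ext _ _ _ _ Hw).
unfold reeb_frame, frame_vector in Hv. cbn [snd] in Hv. fold (h 0) in Hv.
set (a := eps * c3 (fst (c 0)) * (1 + finsler_norm eps (c 0) * speed_root eps (c 0))) in *.
set (dv := lincomb a (normal (c 0)) (- h 0) (fst (c 0))) in *.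
apply is_derive_coords in Hv. destruct Hv as (V1 & V2 & V3).
apply is_derive_coords in Hn. destruct Hn as (_ & _ & N3).
set (z1 := c3 (fst (c 0))) in *. set (z2 := c3 (snd (c 0))) in *.
set (z3 := c3 (normal (c 0))) in *. set (S := speed_root eps (c 0)) in *.
assert (Ez2 : c3 dv = a * z3 - h 0 * z1).
{ unfold dv, z3, z1. generalize (normal (c 0)) (h 0). clear. destruct (c 0). intros.
  vec_destruct. vec_unfold. ring. }
assert (Ez3 : c3 (lincomb (- a) (snd (c 0)) 0 (fst (c 0))) = - a * z2).
{ unfold z2. clear. destruct (c 0). vec_destruct. vec_unfold. ring. }
rewrite Ez2 in V3. rewrite Ez3 in N3.
assert (Hpos : 0 < 1 - eps ^ 2 * z2 ^ 2) by (rewrite <- HS2; nra).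
assert (Dh : is_derive h 0 (- eps ^ 2 * z1 * z2)).
{ evar_last; [exact (is_derive_radical eps (fun s => c3 (snd (c s)))
    (fun s => c3 (normal (c s))) 0 _ _ V3 N3 Hpos)|].
  cbv beta. fold z2. change (sqrt (1 - eps ^ 2 * z2 ^ 2)) with S.
  change (h 0) with (S + eps * z3). unfold a.
  transitivity (- eps ^ 2 * z1 * z2 * (finsler_norm eps (c 0) * (S + eps * z3))).
  - field_simplify_eq; [|lra]. ring [HN].
  - rewrite HN. ring. }
apply is_derive_coords.
unfold reeb_acceleration. rewrite J1, J2. fold z1 z2 z3 S. change (S + eps * z3) with (h 0).
assert (Ea : a = eps * z1 + eps * z1 * finsler_norm eps (c 0) * S) by (unfold a; ring).
assert (K : forall ci : vec -> R, ci = c1 \/ ci = c2 \/ ci = c3 ->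
  is_derive (fun s => ci (snd (c s))) 0 (ci dv) ->
  is_derive (fun s => ci (scal (h s) (snd (c s)))) 0
    (ci (plus (lincomb (-1) (fst (c 0)) (2 * eps * h 0)
            (lincomb z1 (normal (c 0)) (- z3) (fst (c 0))))
       (scal (- eps ^ 2) (plus (lincomb (z1 ^ 2 - 1) (fst (c 0)) (z1 * z2) (snd (c 0)))
          (scal (z1 * z3) (normal (c 0)))))))).
{ intros ci Hci Dci.
  assert (Lin : forall k (y : vec), ci (scal k y) = k * ci y)
    by (intros k [[? ?] ?]; destruct Hci as [-> | [-> | ->]]; reflexivity).
  assert (Add : forall y z : vec, ci (plus y z) = ci y + ci z)
    by (intros [[? ?] ?] [[? ?] ?]; destruct Hci as [-> | [-> | ->]]; reflexivity).
  apply (is_derive_ext (fun s => h s * ci (snd (c s)))); [intros s; symmetry; apply Lin|].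
  evar_last; [exact (is_derive_Rmult _ _ _ _ _ Dh Dci)|].
  cbv beta. unfold dv, lincomb. repeat (rewrite Add || rewrite Lin).
  assert (EN : finsler_norm eps (c 0) * h 0 = 1) by exact HN.
  assert (Eh : h 0 = S + eps * z3) by reflexivity.
  assert (Eq : a * h 0 = 2 * eps * h 0 * z1 - eps ^ 2 * z1 * z3).
  { rewrite Ea. transitivity (eps * z1 * h 0 + eps * z1 * S * (finsler_norm eps (c 0) * h 0));
      [ring|rewrite EN, Eh; ring]. }
  assert (Ehh : h 0 * h 0 = 2 * (S + eps * z3) * eps * z3 + 1 - eps ^ 2 * (1 - z1 ^ 2)).
  { pose proof (frame_row3 (c 0) Hp) as Hr. fold z1 z2 z3 in Hr. rewrite Eh.
    replace (1 - z1 ^ 2) with (z2 ^ 2 + z3 ^ 2) by lra. nra. }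
  clear - Eq Ehh Eh.
  generalize dependent (h 0). intros h0 Eh Eq Ehh.
  transitivity (- eps ^ 2 * z1 * z2 * ci (snd (c 0)) + (a * h0) * ci (normal (c 0))
    - (h0 * h0) * ci (fst (c 0))); [ring|rewrite Eq, Ehh, Eh; ring]. }
(split; [|split]); (apply K; [auto|]); [exact V1|exact V2|rewrite Ez2; exact V3].
Qed.
End KatokZiller.

(** * Trigonometric integrals *)

Lemma ex_RInt_continuous_R (g : R -> R) a b : (forall t, continuous g t) -> ex_RInt g a b.
Proof. intros Hg. apply (ex_RInt_continuous (V := R_CompleteNormedModule)). intros; apply Hg. Qed.

Lemma RInt_translate (g : R -> R) a b c : (forall t, continuous g t) ->
  RInt (fun t => g (t + c)) a b = RInt g (a + c) (b + c).
Proof.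
intros Hg.
transitivity (RInt (fun y => scal 1 (g (1 * y + c))) a b).
- apply RInt_ext. intros t _. change (g (t + c) = 1 * g (1 * t + c)). now rewrite !Rmult_1_l.
- pose proof (RInt_comp_lin g 1 c a b (ex_RInt_continuous_R _ _ _ Hg)) as H.
  rewrite !Rmult_1_l in H. exact H.
Qed.

Lemma RInt_periodic_shift (g : R -> R) T c : (forall t, continuous g t) ->
  (forall t, g (t + T) = g t) -> RInt (fun t => g (t + c)) 0 T = RInt g 0 T.
Proof.
intros Hg HT. pose proof (fun a b => ex_RInt_continuous_R g a b Hg) as E.
rewrite RInt_translate, Rplus_0_l by assumption.
rewrite <- (RInt_Chasles g c 0 (T + c)), <- (RInt_Chasles g 0 T (T + c)) by apply E.
assert (Hs : RInt g T (T + c) = RInt g 0 c).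
{ rewrite <- (RInt_ext (fun t => g (t + T)) g 0 c) by (intros; apply HT).
  rewrite RInt_translate by assumption. f_equal; ring. }
rewrite Hs, <- (opp_RInt_swap g 0 c) by apply E.
unfold plus, opp; simpl. ring.
Qed.

Lemma RInt_antiperiodic (g : R -> R) : (forall t, continuous g t) ->
  (forall t, g (t + PI) = - g t) -> RInt g 0 (2 * PI) = 0.
Proof.
intros Hg HT. pose proof (fun a b => ex_RInt_continuous_R g a b Hg) as E.
rewrite <- (RInt_Chasles g 0 PI (2 * PI)) by apply E.
assert (Hs : RInt g PI (2 * PI) = - RInt g 0 PI).
{ transitivity (RInt (fun t => - g t) 0 PI); [|exact (RInt_opp g 0 PI (E _ _))].
  rewrite <- (RInt_ext (fun t => g (t + PI)) (fun t => - g t) 0 PI) by (intros; apply HT).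
  rewrite RInt_translate by assumption. f_equal; ring. }
rewrite Hs. unfold plus; simpl. ring.
Qed.

Lemma RInt_odd_periodic (g : R -> R) T : (forall t, continuous g t) ->
  (forall t, g (T - t) = - g t) -> RInt g 0 T = 0.
Proof.
intros Hg HT. pose proof (fun a b => ex_RInt_continuous_R g a b Hg) as E.
pose proof (RInt_comp_lin g (-1) T 0 T (E _ _)) as H.
replace (-1 * 0 + T) with T in H by ring. replace (-1 * T + T) with 0 in H by ring.
assert (H1 : RInt g 0 T = RInt (fun y => scal (-1) (g (-1 * y + T))) 0 T).
{ apply RInt_ext. intros t _. change (g t = -1 * g (-1 * t + T)).
  replace (-1 * t + T) with (T - t) by ring. rewrite HT. ring. }
assert (H2 : RInt g T 0 = - RInt g 0 T) by (symmetry; exact (opp_RInt_swap g 0 T (E _ _))).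
assert (H3 : RInt g 0 T = RInt g T 0) by exact (eq_trans H1 H). lra.
Qed.

Lemma RInt_combination (f g : R -> R) k l a b :
  (forall t, continuous f t) -> (forall t, continuous g t) ->
  RInt (fun t => k * f t + l * g t) a b = k * RInt f a b + l * RInt g a b.
Proof.
intros Hf Hg.
pose proof (ex_RInt_continuous_R f a b Hf) as Ef. pose proof (ex_RInt_continuous_R g a b Hg) as Eg.
pose proof (RInt_plus _ _ a b (ex_RInt_scal f a b k Ef) (ex_RInt_scal g a b l Eg)) as K.
etransitivity; [exact K|].
apply (f_equal2 Rplus); [exact (RInt_scal f a b k Ef)|exact (RInt_scal g a b l Eg)].
Qed.

Lemma continuous_combination (f g : R -> R) k l t :
  continuous f t -> continuous g t -> continuous (fun t => k * f t + l * g t) t.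
Proof.
intros Hf Hg. apply (continuous_plus (fun t => k * f t) (fun t => l * g t)).
- apply (continuous_mult (fun _ => k) f); [apply continuous_const|exact Hf].
- apply (continuous_mult (fun _ => l) g); [apply continuous_const|exact Hg].
Qed.

Section Moments.
Context (a : R) (Ha : 0 < 1 - a ^ 2).

Definition radicand (t : R) : R := 1 - a ^ 2 * sin t ^ 2.

Lemma radicand_pos t : 0 < radicand t.
Proof. unfold radicand. pose proof (sin2_cos2 t) as H. unfold Rsqr in H. nra. Qed.

Let b := sqrt (1 - a ^ 2).

Lemma b_pos : 0 < b /\ b ^ 2 = 1 - a ^ 2.
Proof. split; [now apply sqrt_lt_R0|]. apply pow2_sqrt. lra. Qed.

Lemma continuous_radicand t : continuous radicand t.
Proof. apply (ex_derive_continuous radicand). unfold radicand. now auto_derive. Qed.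

(** The antiderivative is [atan (b tan t) / b], with the jumps at the poles of [tan] removed by
    the subtraction formula for [atan]. *)
Lemma RInt_inv_radicand : RInt (fun t => / radicand t) 0 (2 * PI) = 2 * PI / b.
Proof.
destruct b_pos as [Hb Hb2].
pose (G := fun t => / b * (t - atan ((1 - b) * sin t * cos t / (cos t ^ 2 + b * sin t ^ 2)))).
assert (HG : forall t, is_derive G t (/ radicand t)).
{ intros t. pose proof (sin2_cos2 t) as H. unfold Rsqr in H.
  assert (HD : 0 < cos t ^ 2 + b * sin t ^ 2).
  { destruct (Req_dec (sin t) 0) as [E | E]; [rewrite E in *; nra|].
    pose proof (pow2_ge_0 (cos t)). assert (0 < sin t ^ 2) by nra. nra. }
  pose proof (radicand_pos t) as HR.
  assert (ER : radicand t = cos t ^ 2 + b ^ 2 * sin t ^ 2)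
    by (unfold radicand; rewrite Hb2; nra).
  unfold G. auto_derive; [nra|].
  assert (ED : (cos t ^ 2 + b * sin t ^ 2) ^ 2 + ((1 - b) * sin t * cos t) ^ 2
    = cos t ^ 2 + b ^ 2 * sin t ^ 2).
  { transitivity ((sin t * sin t + cos t * cos t) * (cos t ^ 2 + b ^ 2 * sin t ^ 2)); [ring|].
    rewrite H. ring. }
  rewrite ER in *. unfold Rsqr.
  generalize dependent (sin t). generalize dependent (cos t). intros c s H HD HR _ ED.
  set (D := c ^ 2 + b * s ^ 2) in *. set (n := (1 - b) * s * c) in *.
  set (Q := c ^ 2 + b ^ 2 * s ^ 2) in *.
  transitivity (/ b * (1 - (((1 - b) * (c ^ 2 - s ^ 2)) * D - n * (2 * (b - 1) * s * c))
    / (D ^ 2 + n ^ 2))).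
  - change (c * (c * 1) + b * (s * (s * 1))) with D. field. repeat split; nra.
  - rewrite ED.
    replace ((1 - b) * (c ^ 2 - s ^ 2) * D - n * (2 * (b - 1) * s * c))
      with ((1 - b) * (c ^ 2 - b * s ^ 2) * (s * s + c * c)) by (unfold D, n; ring).
    rewrite H. transitivity (/ b * (b * (s * s + c * c) / Q)); [unfold Q; field|rewrite H; field];
      (split; [|lra]); [|lra].
    replace (c ^ 2 + (b * s) ^ 2) with Q by (unfold Q; ring). lra. }
assert (H : is_RInt (fun t => / radicand t) 0 (2 * PI) (minus (G (2 * PI)) (G 0))).
{ apply (is_RInt_derive G).
  - intros; apply HG.
  - intros t _. apply (continuous_comp radicand Rinv); [apply continuous_radicand|].
    apply continuous_Rinv. pose proof (radicand_pos t). lra. }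
rewrite (is_RInt_unique _ _ _ _ H). unfold minus, plus, opp, G; simpl.
rewrite sin_2PI, sin_0. unfold Rdiv. rewrite !Rmult_0_r, !Rmult_0_l, atan_0. field. lra.
Qed.

Definition sin_moment : R := RInt (fun t => sin t ^ 2 / radicand t) 0 (2 * PI).
Definition cos_moment : R := RInt (fun t => cos t ^ 2 / radicand t) 0 (2 * PI).

Lemma continuous_over_radicand (g : R -> R) t : (forall t, ex_derive g t) ->
  continuous (fun t => g t / radicand t) t.
Proof.
intros Hg. apply (continuous_mult g (fun t => / radicand t)).
- now apply (ex_derive_continuous g).
- apply (continuous_comp radicand Rinv); [apply continuous_radicand|].
  apply continuous_Rinv. pose proof (radicand_pos t). lra.
Qed.

(** Both moments follow from the previous integral: numerators [sin^2 + cos^2 = 1] and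
    [b^2 sin^2 + cos^2 = radicand] give two linear equations, independent when [b] is not 1. *)
Lemma moments : a <> 0 -> sin_moment = 2 * PI / (b * (1 + b)) /\ cos_moment = 2 * PI / (1 + b).
Proof.
intros Hn. destruct b_pos as [Hb Hb2].
assert (Es : ex_RInt (fun t => sin t ^ 2 / radicand t) 0 (2 * PI)).
{ apply ex_RInt_continuous_R. intros t. apply continuous_over_radicand.
  intros; now auto_derive. }
assert (Ec : ex_RInt (fun t => cos t ^ 2 / radicand t) 0 (2 * PI)).
{ apply ex_RInt_continuous_R. intros t. apply continuous_over_radicand.
  intros; now auto_derive. }
assert (H1 : sin_moment + cos_moment = 2 * PI / b).
{ unfold sin_moment, cos_moment. rewrite <- RInt_inv_radicand.
  rewrite <- (RInt_plus (fun t => sin t ^ 2 / radicand t) (fun t => cos t ^ 2 / radicand t))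
    by assumption.
  apply RInt_ext. intros t _. pose proof (radicand_pos t). pose proof (sin2_cos2 t) as H'.
  unfold Rsqr in H'. unfold plus; simpl. field_simplify_eq; [|lra]. lra. }
assert (H2 : b ^ 2 * sin_moment + cos_moment = 2 * PI).
{ unfold sin_moment, cos_moment.
  pose proof (RInt_scal (fun t => sin t ^ 2 / radicand t) 0 (2 * PI) (b ^ 2) Es) as K1.
  pose proof (RInt_plus (fun t => scal (b ^ 2) (sin t ^ 2 / radicand t))
    (fun t => cos t ^ 2 / radicand t) 0 (2 * PI) (ex_RInt_scal _ _ _ _ Es) Ec) as K2.
  etransitivity; [etransitivity; [|symmetry; exact K2]|].
  { apply (f_equal2 Rplus); [symmetry; exact K1|reflexivity]. }
  transitivity (RInt (fun _ => 1) 0 (2 * PI)).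
  - apply RInt_ext. intros t _. pose proof (radicand_pos t). pose proof (sin2_cos2 t) as H'.
    unfold Rsqr in H'. unfold plus, scal; simpl; unfold mult; simpl.
    apply (Rmult_eq_reg_r (radicand t)); [|lra]. field_simplify; [|lra].
    unfold radicand. simpl. nra.
  - rewrite RInt_const. unfold scal; simpl; unfold mult; simpl. ring. }
assert (Hb1 : b <> 1) by (intros E; rewrite E in Hb2; nra).
assert (Es' : sin_moment = 2 * PI / (b * (1 + b))).
{ apply (Rmult_eq_reg_r (1 - b ^ 2)); [|nra].
  transitivity (2 * PI / b - 2 * PI); [lra|field; lra]. }
split; [exact Es'|]. transitivity (2 * PI / b - sin_moment); [lra|].
rewrite Es'. field. lra.
Qed.

End Moments.

(** * Fiber integrals, area form and angle form *)

Lemma spherical_frame (phi theta : R) :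
  let x := sph phi theta in let e := (- sin theta, cos theta, 0) in
  S2 x /\ TS2 x e /\ dot e e = 1 /\ cross e x = sph_dphi phi theta.
Proof.
pose proof (sin2_cos2 theta) as Ht. pose proof (sin2_cos2 phi) as Hp. unfold Rsqr in *.
unfold sph, sph_dphi. vec_unfold.
generalize dependent (sin theta). generalize dependent (cos theta).
generalize dependent (sin phi). generalize dependent (cos phi). intros.
repeat split; try nsatz. f_equal; [f_equal|]; nsatz.
Qed.

Lemma sph_surj (x : vec) : S2 x -> exists phi theta, x = sph phi theta.
Proof.
intros Hx. destruct (sph_tangent_surj x (0, 0, 0) Hx) as (phi & theta & _ & _ & _ & _ & E & _).
- vec_destruct. vec_unfold. ring.
- now exists phi, theta.
Qed.

Lemma fiber_point_0 (x e e' : vec) : fiber_point x e e' 0 = (x, e).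
Proof.
unfold fiber_point. rewrite sin_0, cos_0. f_equal. vec_destruct. vec_unfold.
f_equal; [f_equal|]; ring.
Qed.

(** The contact volume is negative on a positive [spin] followed by a positive basis, so the
    fibers are oriented clockwise: [cross e x] is [e] turned by a negative right angle. *)
Lemma fiber_frame (x e : vec) (t : R) : S2 x -> TS2 x e -> dot e e = 1 ->
  HM (fiber_point x e (cross e x) t) /\
  fiber_tangent e (cross e x) t = frame_vector (fiber_point x e (cross e x) t) (-1) 0 0 /\
  normal (fiber_point x e (cross e x) t) = lincomb (sin t) e (- cos t) (cross e x).
Proof.
intros Hx He1 He2.
assert (A1 : dot (cross e x) (cross e x) = 1)
  by (clear t; vec_destruct; vec_unfold; nsatz).
assert (A2 : dot x (cross e x) = 0) by (clear; vec_destruct; vec_unfold; ring).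
assert (A3 : dot e (cross e x) = 0) by (clear; vec_destruct; vec_unfold; ring).
pose proof (sin2_cos2 t) as Ht. unfold Rsqr in Ht.
assert (N : normal (fiber_point x e (cross e x) t) = lincomb (sin t) e (- cos t) (cross e x)).
{ unfold fiber_point, normal. cbn [fst snd].
  assert (B : cross x (cross e x) = lincomb (dot x x) e (- dot x e) x)
    by (clear; vec_destruct; vec_unfold; f_equal; [f_equal|]; ring).
  unfold S2, TS2 in *. rewrite Hx, He1 in B.
  transitivity (lincomb (- cos t) (cross e x) (sin t) (cross x (cross e x))).
  - assert (C : forall f : vec, cross x (plus (scal (cos t) e) (scal (sin t) f))
      = lincomb (- cos t) (cross e x) (sin t) (cross x f))
      by (clear; intros; vec_destruct; vec_unfold; f_equal; [f_equal|]; ring).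
    apply C.
  - rewrite B. generalize (cross e x). clear. intros. vec_destruct. vec_unfold.
    f_equal; [f_equal|]; ring. }
split; [|split; [|exact N]].
- unfold fiber_point. repeat split; cbn [fst snd].
  + exact Hx.
  + unfold TS2 in *. transitivity (cos t * dot x e + sin t * dot x (cross e x)).
    * generalize (cross e x). clear. intros. vec_destruct. vec_unfold. ring.
    * rewrite He1, A2. ring.
  + transitivity (cos t * cos t * dot e e + sin t * sin t * dot (cross e x) (cross e x)
      + 2 * sin t * cos t * dot e (cross e x)).
    * generalize (cross e x). clear. intros. vec_destruct. vec_unfold. ring.
    * rewrite He2, A1, A3. lra.
- unfold frame_vector. rewrite N. unfold fiber_tangent, fiber_point. cbn [fst snd].
  generalize (cross e x) (sin t) (cos t). clear. intros. vec_destruct. vec_unfold.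
  f_equal; (f_equal; [f_equal|]); ring.
Qed.

Section KatokZiller.
Context (eps : R) (F : vec -> vec -> R) (He : 0 < eps < 1) (HF : is_katok_ziller eps F).

Lemma density_pos (p : vec * vec) : HM p -> 0 < finsler_norm eps p / speed_root eps p ^ 3.
Proof.
intros Hp. destruct (speed_root_spec eps p He Hp) as (HS & _ & HSg & _).
apply Rdiv_lt_0_compat; [now apply Rinv_0_lt_compat|now apply pow_lt].
Qed.

(** The orientation is tested at parameter 0, on lifts of the basis [e], [normal (x, e)]. *)
Lemma positive_fiber_frame_iff (x e e' : vec) : S2 x ->
  positive_fiber_frame F x e e' <-> TS2 x e /\ dot e e = 1 /\ e' = cross e x.
Proof.
intros Hx. split.
- intros [(He1 & He1' & He2 & He2' & He3) Hpos]. split; [exact He1|split; [exact He2|]].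
  assert (Hp : HM (x, e)) by (repeat split; assumption).
  specialize (Hpos 0 (frame_vector (x, e) 0 0 1) (frame_vector (x, e) 0 (-1) 0)).
  rewrite fiber_point_0 in Hpos.
  destruct (THM_frame_vector (x, e) 0 0 1 Hp) as (T1 & A1 & B1 & C1).
  destruct (THM_frame_vector (x, e) 0 (-1) 0 Hp) as (T2 & A2 & B2 & C2).
  pose proof (frame_expansion (x, e) e' Hp) as E. cbn [fst snd] in E.
  set (n := normal (x, e)) in *. set (d := dot e' n) in *.
  assert (D1 : dot e' x = 0) by (rewrite <- He1'; clear; vec_destruct; vec_unfold; ring).
  assert (D2 : dot e' e = 0) by (rewrite <- He3; clear; vec_destruct; vec_unfold; ring).
  rewrite D1, D2 in E.
  assert (E' : e' = scal d n).
  { rewrite E at 1. generalize n d. clear. intros. vec_destruct. vec_unfold.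
    f_equal; [f_equal|]; ring. }
  assert (T0 : fiber_tangent e e' 0 = frame_vector (x, e) d 0 0).
  { unfold fiber_tangent, frame_vector. rewrite sin_0, cos_0, E'. cbn [fst snd]. fold n.
    generalize n d. clear. intros. vec_destruct. vec_unfold. f_equal; (f_equal; [f_equal|]); ring. }
  rewrite T0 in Hpos.
  destruct (THM_frame_vector (x, e) d 0 0 Hp) as (T3 & A3 & B3 & C3).
  specialize (Hpos T1 T2).
  rewrite (contact_volume_eq eps F He HF) in Hpos by assumption. cbn [fst] in Hpos.
  pose proof (det3_frame (x, e) (frame_vector (x, e) 0 0 1) (frame_vector (x, e) 0 (-1) 0) Hp T1 T2) as D.
  cbn [fst] in D. rewrite B1, C1, B2, C2 in D. rewrite D, A1, A2, A3 in Hpos.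
  specialize (Hpos ltac:(lra)).
  pose proof (density_pos (x, e) Hp) as HK.
  assert (Hd : d < 0) by nra.
  assert (Hd2 : d * d = 1).
  { destruct (HM_normal (x, e) Hp) as (N1 & _). fold n in N1. rewrite <- He2', E'.
    transitivity (d * d * dot n n); [rewrite N1; ring|]. generalize n d. clear. intros.
    vec_destruct. vec_unfold. ring. }
  assert (Hd1 : d = -1) by nra.
  rewrite E', Hd1. unfold n, normal. clear. vec_destruct. vec_unfold. f_equal; [f_equal|]; ring.
- intros (He1 & He2 & ->). split.
  + destruct (fiber_frame x e (PI / 2) Hx He1 He2) as (Hp & _).
    unfold fiber_point in Hp. rewrite cos_PI2, sin_PI2 in Hp.
    assert (E : plus (scal 0 e) (scal 1 (cross e x)) = cross e x)
      by (clear; vec_destruct; vec_unfold; f_equal; [f_equal|]; ring).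
    rewrite E in Hp. destruct Hp as (_ & Hp2 & Hp3). cbn [fst snd] in *.
    repeat split; try assumption. clear. vec_destruct. vec_unfold. ring.
  + intros t Y1 Y2 HY1 HY2 Hdet.
    destruct (fiber_frame x e t Hx He1 He2) as (Hp & -> & _).
    set (p := fiber_point x e (cross e x) t) in *.
    destruct (THM_frame_vector p (-1) 0 0 Hp) as (T & A & B & C).
    rewrite (contact_volume_eq eps F He HF) by assumption.
    pose proof (det3_frame p _ Y1 Hp T HY1) as D1. pose proof (det3_frame p _ Y2 Hp T HY2) as D2.
    rewrite B, C in D1, D2. rewrite D1, D2, A. change (fst p) with x.
    pose proof (density_pos p Hp) as HK.
    set (K := finsler_norm eps p / speed_root eps p ^ 3) in *.
    replace (- K * _) with (K * det3 x (fst Y1) (fst Y2)) by ring.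
    now apply Rmult_lt_0_compat.
Qed.
End KatokZiller.

Lemma fiber_frames_rotation (x e e1 : vec) :
  S2 x -> TS2 x e -> dot e e = 1 -> TS2 x e1 -> dot e1 e1 = 1 ->
  exists tau, forall t,
    fiber_point x e1 (cross e1 x) t = fiber_point x e (cross e x) (t + tau) /\
    fiber_tangent e1 (cross e1 x) t = fiber_tangent e (cross e x) (t + tau).
Proof.
intros Hx He1 He2 E1 E2.
set (f := cross e x) in *.
assert (Hp : HM (x, e)) by (repeat split; assumption).
pose proof (frame_expansion (x, e) e1 Hp) as E. cbn [fst snd] in E.
assert (D1 : dot e1 x = 0) by (rewrite <- E1; clear; vec_destruct; vec_unfold; ring).
rewrite D1 in E.
assert (En : normal (x, e) = scal (-1) f)
  by (unfold f, normal; clear; vec_destruct; vec_unfold; f_equal; [f_equal|]; ring).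
set (p := dot e1 e) in *. set (q := dot e1 f).
assert (Eq : dot e1 (normal (x, e)) = - q)
  by (rewrite En; unfold q; generalize f; clear; intros; vec_destruct; vec_unfold; ring).
rewrite Eq, En in E.
assert (E' : e1 = lincomb p e q f).
{ rewrite E at 1. generalize f p q. clear. intros. vec_destruct. vec_unfold.
  f_equal; [f_equal|]; ring. }
destruct (HM_normal _ Hp) as (N1 & N2 & N3). rewrite En in N1, N2, N3. cbn [fst snd] in N2, N3.
assert (F1 : dot f f = 1)
  by (rewrite <- N1; generalize f; clear; intros; vec_destruct; vec_unfold; ring).
assert (F2 : dot e f = 0)
  by (apply (Rmult_eq_reg_l (-1)); [|lra]; rewrite Rmult_0_r, <- N3; generalize f; clear; intros;
      vec_destruct; vec_unfold; ring).
assert (Hpq : p * p + q * q = 1).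
{ rewrite <- E2, E'.
  transitivity (p * p * dot e e + q * q * dot f f + 2 * p * q * dot e f).
  - rewrite He2, F1, F2. ring.
  - generalize f p q. clear. intros. vec_destruct. vec_unfold. ring. }
destruct (polar_coordinates p q) as (r & tau & Hr & _ & Pc & Ps).
assert (Hr1 : r = 1).
{ pose proof (sin2_cos2 tau) as Ht. unfold Rsqr in Ht. assert (r * r = 1) by nra. nra. }
rewrite Hr1, Rmult_1_l in Pc, Ps.
assert (Ff : cross f x = scal (-1) e).
{ unfold f. transitivity (lincomb (dot x e) x (- dot x x) e).
  - clear. vec_destruct. vec_unfold. f_equal; [f_equal|]; ring.
  - unfold S2, TS2 in *. rewrite He1, Hx. clear. vec_destruct. vec_unfold. f_equal; [f_equal|]; ring. }
assert (E1' : cross e1 x = lincomb (- q) e p f).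
{ rewrite E'. transitivity (lincomb p (cross e x) q (cross f x)).
  - generalize f p q. clear. intros. vec_destruct. vec_unfold. f_equal; [f_equal|]; ring.
  - rewrite Ff. fold f. generalize f p q. clear. intros. vec_destruct. vec_unfold.
    f_equal; [f_equal|]; ring. }
rewrite E1', E', Pc, Ps.
exists tau. intros t. unfold fiber_point, fiber_tangent. rewrite cos_plus, sin_plus.
generalize (cos t) (sin t) (cos tau) (sin tau) f. clear. intros.
split; f_equal; vec_destruct; vec_unfold; (f_equal; [f_equal|]); ring.
Qed.

Section KatokZiller.
Context (eps : R) (F : vec -> vec -> R) (He : 0 < eps < 1) (HF : is_katok_ziller eps F).

(** The value does not depend on the positive frame that the fiber integral selects: any two
    differ by a rotation, that is, by a shift of the periodic parameter. *)
Lemma fiber_integral_eq (x e : vec) (beta : vec * vec -> vec * vec -> R) (g : R -> R) :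
  S2 x -> TS2 x e -> dot e e = 1 -> (forall t, continuous g t) ->
  (forall t, beta (fiber_point x e (cross e x) t) (fiber_tangent e (cross e x) t) = g t) ->
  fiber_integral F x beta = RInt g 0 (2 * PI).
Proof.
intros Hx He1 He2 Hg Hbeta. unfold fiber_integral.
assert (Hfr : positive_fiber_frame F x (fst (e, cross e x)) (snd (e, cross e x))).
{ apply (positive_fiber_frame_iff eps F He HF x _ _ Hx). now repeat split. }
pose proof (the_spec (zero, zero) (fun ee => positive_fiber_frame F x (fst ee) (snd ee))
  (e, cross e x) Hfr) as Hs. cbv beta in Hs.
destruct (the (zero, zero) (fun ee => positive_fiber_frame F x (fst ee) (snd ee))) as [e1 e1'].
cbn [fst snd] in Hs.
apply (positive_fiber_frame_iff eps F He HF x _ _ Hx) in Hs. destruct Hs as (E1 & E2 & ->).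
destruct (fiber_frames_rotation x e e1 Hx He1 He2 E1 E2) as (tau & Htau).
rewrite <- (RInt_periodic_shift g (2 * PI) tau Hg).
- apply RInt_ext. intros t _. destruct (Htau t) as [-> ->]. apply Hbeta.
- intros t. rewrite <- !Hbeta. unfold fiber_point, fiber_tangent.
  now rewrite cos_plus, sin_plus, cos_2PI, sin_2PI, !Rmult_1_r, !Rmult_0_r, Rminus_0_r, Rplus_0_r.
Qed.

Definition area_density (x : vec) : R := / sqrt (1 - eps ^ 2 * (1 - c3 x ^ 2)) ^ 3.

Lemma area_density_sph phi theta :
  area_density (sph phi theta) = / sqrt (1 - (eps * sin phi) ^ 2) ^ 3.
Proof.
unfold area_density. f_equal. f_equal. f_equal. unfold sph, c3. cbn [snd].
pose proof (sin2_cos2 phi) as H. unfold Rsqr in H. clear - H. nra.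
Qed.

Lemma eps_sin_bound phi : 0 < 1 - (eps * sin phi) ^ 2.
Proof. pose proof (sin2_cos2 phi) as H. unfold Rsqr in H. nra. Qed.

Lemma area_density_pos (x : vec) : S2 x -> 0 < area_density x.
Proof.
intros Hx. destruct (sph_surj x Hx) as (phi & theta & ->). rewrite area_density_sph.
apply Rinv_0_lt_compat, pow_lt, sqrt_lt_R0, eps_sin_bound.
Qed.

(** The density of [A /\ dA] along a fiber, relative to the round area form, in the angle [t]
    from the unit vector along [d/dtheta] to the one along [d/dphi]; here [a = eps sin phi]. *)
Definition fiber_density (a t : R) : R :=
  / (sqrt (radicand a t) + a * cos t) / sqrt (radicand a t) ^ 3.

Lemma fiber_density_eq phi theta t :
  let x := sph phi theta in let e := (- sin theta, cos theta, 0) in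
  let p := fiber_point x e (cross e x) t in let a := eps * sin phi in
  speed_root eps p = sqrt (radicand a t) /\ eps * c3 (normal p) = a * cos t /\
  finsler_norm eps p / speed_root eps p ^ 3 = fiber_density a t.
Proof.
intros x e p a.
destruct (spherical_frame phi theta) as (Hx & He1 & He2 & Hc). fold x e in Hx, He1, He2, Hc.
destruct (fiber_frame x e t Hx He1 He2) as (_ & _ & Hn). fold p in Hn.
assert (A : speed_root eps p = sqrt (radicand a t)).
{ unfold speed_root, radicand. f_equal. unfold p, fiber_point. cbn [snd]. rewrite Hc.
  unfold e, sph_dphi, a. vec_unfold. ring. }
assert (B : eps * c3 (normal p) = a * cos t).
{ rewrite Hn, Hc. unfold e, sph_dphi, a. vec_unfold. ring. }
split; [exact A|split; [exact B|]].
unfold finsler_norm, fiber_density. now rewrite A, B.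
Qed.
End KatokZiller.

Section FiberDensity.
Context (a : R) (Ha : 0 < 1 - a ^ 2).

Lemma sqrt_radicand t : 0 < sqrt (radicand a t) /\ sqrt (radicand a t) ^ 2 = radicand a t /\
  0 < sqrt (radicand a t) + a * cos t.
Proof.
pose proof (radicand_pos a Ha t) as HR. pose proof (sqrt_lt_R0 _ HR) as HS.
pose proof (pow2_sqrt _ (Rlt_le _ _ HR)) as HS2.
split; [exact HS|split; [exact HS2|]].
set (S := sqrt (radicand a t)) in *. unfold radicand in HS2.
pose proof (sin2_cos2 t) as H. unfold Rsqr in H.
assert (0 < S ^ 2 - (a * cos t) ^ 2) by nra. nra.
Qed.

Lemma continuous_inv_cube (P : R -> R) t : (forall t, ex_derive P t) ->
  continuous (fun t => P t / sqrt (radicand a t) ^ 3) t.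
Proof.
intros HP. apply (ex_derive_continuous (fun t => P t / sqrt (radicand a t) ^ 3)).
destruct (sqrt_radicand t) as (HS & _). pose proof (radicand_pos a Ha t) as HR.
unfold radicand in *.
assert (E : 1 + - (a * (a * 1) * (sin t * (sin t * 1))) = 1 - a ^ 2 * sin t ^ 2) by ring.
pose proof (pow_lt _ 3 HS) as HS3. simpl pow in HS3 at 1.
auto_derive. rewrite E. repeat split; [apply HP|exact HR|]. apply Rgt_not_eq. exact HS3.
Qed.

(** The radicand is invariant under [v |-> - v], which shifts the angle by [PI]. *)
Lemma RInt_inv_cube_odd (P : R -> R) : (forall t, ex_derive P t) ->
  (forall t, P (t + PI) = - P t) -> RInt (fun t => P t / sqrt (radicand a t) ^ 3) 0 (2 * PI) = 0.
Proof.
intros HP Hodd. apply RInt_antiperiodic.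
- intros t. now apply continuous_inv_cube.
- intros t. rewrite Hodd. unfold radicand. rewrite neg_sin.
  replace ((- sin t) ^ 2) with (sin t ^ 2) by ring. unfold Rdiv. ring.
Qed.

(** The numerator and the denominator are multiplied by [S - a cos t], where [S^2] is the radicand;
    the second term is odd. *)
Lemma fiber_density_split t : fiber_density a t =
  / (1 - a ^ 2) * / radicand a t + - (a / (1 - a ^ 2)) * cos t / sqrt (radicand a t) ^ 3.
Proof.
destruct (sqrt_radicand t) as (HS & HS2 & HSa). unfold fiber_density.
assert (E : 1 - a ^ 2 = (sqrt (radicand a t) + a * cos t) * (sqrt (radicand a t) - a * cos t)).
{ pose proof (sin2_cos2 t) as H. unfold Rsqr in H. unfold radicand in HS2.
  transitivity (sqrt (radicand a t) ^ 2 - a ^ 2 * cos t ^ 2); [|ring].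
  unfold radicand. rewrite HS2. nra. }
rewrite <- HS2 at 3. rewrite E. set (S := sqrt (radicand a t)) in *.
assert (S - a * cos t <> 0) by nra.
field. repeat split; lra.
Qed.

Lemma continuous_inv_radicand t : continuous (fun t => / radicand a t) t.
Proof.
apply (continuous_comp (radicand a) Rinv); [apply continuous_radicand|].
apply continuous_Rinv. pose proof (radicand_pos a Ha t). lra.
Qed.

Lemma continuous_fiber_density t : continuous (fiber_density a) t.
Proof.
apply (continuous_ext (fun t => / (1 - a ^ 2) * / radicand a t
  + - (a / (1 - a ^ 2)) * cos t / sqrt (radicand a t) ^ 3)).
{ intros s. symmetry. apply fiber_density_split. }
apply (continuous_plus (fun t => / (1 - a ^ 2) * / radicand a t)).
- apply (continuous_mult (fun _ => / (1 - a ^ 2))); [apply continuous_const|].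
  apply continuous_inv_radicand.
- apply continuous_inv_cube. intros; now auto_derive.
Qed.

Lemma RInt_fiber_density : RInt (fiber_density a) 0 (2 * PI) = 2 * PI / sqrt (1 - a ^ 2) ^ 3.
Proof.
assert (Hodd : RInt (fun t => - (a / (1 - a ^ 2)) * cos t / sqrt (radicand a t) ^ 3) 0 (2 * PI) = 0).
{ apply RInt_inv_cube_odd; [intros; now auto_derive|]. intros t. rewrite neg_cos. ring. }
transitivity (/ (1 - a ^ 2) * RInt (fun t => / radicand a t) 0 (2 * PI)
  + 1 * RInt (fun t => - (a / (1 - a ^ 2)) * cos t / sqrt (radicand a t) ^ 3) 0 (2 * PI)).
- rewrite <- RInt_combination.
  + apply RInt_ext. intros t _.
    change (fiber_density a t = / (1 - a ^ 2) * / radicand a t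
      + 1 * (- (a / (1 - a ^ 2)) * cos t / sqrt (radicand a t) ^ 3)).
    rewrite fiber_density_split. ring.
  + exact continuous_inv_radicand.
  + intros t. apply continuous_inv_cube. intros; now auto_derive.
- rewrite RInt_inv_radicand by exact Ha. rewrite Hodd, Rmult_0_r, Rplus_0_r.
  pose proof (b_pos a Ha) as (Hb & Hb2). set (b := sqrt (1 - a ^ 2)) in *.
  rewrite <- Hb2. apply (Rmult_eq_reg_r (b ^ 3)); [|apply pow_nonzero; lra].
  field. lra.
Qed.

End FiberDensity.

Lemma tangent_expansion (x e v : vec) : S2 x -> TS2 x e -> dot e e = 1 -> TS2 x v ->
  v = lincomb (dot v e) e (dot v (cross e x)) (cross e x).
Proof.
intros Hx He1 He2 Hv.
assert (Hp : HM (x, e)) by (repeat split; assumption).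
pose proof (frame_expansion (x, e) v Hp) as E. cbn [fst snd] in E.
assert (D : dot v x = 0) by (rewrite <- Hv; clear; vec_destruct; vec_unfold; ring).
rewrite D in E. rewrite E at 1. unfold normal. clear. vec_destruct. vec_unfold.
f_equal; [f_equal|]; ring.
Qed.

Lemma det3_clockwise (x e : vec) : S2 x -> TS2 x e -> dot e e = 1 -> det3 x e (cross e x) = -1.
Proof. intros. vec_destruct. vec_unfold. nsatz. Qed.

Lemma volume_form_combination (Omega : vec -> vec -> vec -> R) (x e f : vec) (a b c d : R) :
  is_volume_form Omega -> S2 x -> TS2 x e -> TS2 x f ->
  Omega x (lincomb a e b f) (lincomb c e d f) = (a * d - b * c) * Omega x e f.
Proof.
intros HO Hx He Hf.
destruct (HO x Hx) as (Hl & Ha & _).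
assert (T : forall a b, TS2 x (lincomb a e b f)).
{ intros a' b'. unfold TS2 in *. transitivity (a' * dot x e + b' * dot x f).
  - clear. vec_destruct. vec_unfold. ring.
  - rewrite He, Hf. ring. }
assert (D : forall v, TS2 x v -> Omega x v v = 0) by (intros v Hv; pose proof (Ha v v Hv Hv); lra).
unfold lincomb at 1. rewrite Hl by auto.
rewrite (Ha e), (Ha f) by auto. unfold lincomb. rewrite !Hl by assumption.
rewrite (Ha f e), !D by assumption. ring.
Qed.

Section KatokZiller.
Context (eps : R) (F : vec -> vec -> R) (He : 0 < eps < 1) (HF : is_katok_ziller eps F).

(** Evaluating the defining identity on a vertical vector and a lifted basis gives the angle form
    on the fiber as the fiber density divided by [Omega]; the normalization of its integral then
    determines [Omega]. *)
Lemma volume_angle_unique (Omega : vec -> vec -> vec -> R) (alpha : vec * vec -> vec * vec -> R)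
    (phi theta : R) :
  is_volume_form Omega -> is_volume_angle F Omega alpha ->
  let x := sph phi theta in let e := (- sin theta, cos theta, 0) in let a := eps * sin phi in
  (forall v w, TS2 x v -> TS2 x w -> Omega x v w = area_density eps x * det3 x v w) /\
  (forall t, alpha (fiber_point x e (cross e x) t) (fiber_tangent e (cross e x) t)
     = sqrt (1 - a ^ 2) ^ 3 * fiber_density a t).
Proof.
intros HO (Hone & Hnz & Hvol & Hint) x e a.
destruct (spherical_frame phi theta) as (Hx & He1 & He2 & _). fold x e in Hx, He1, He2.
pose proof (eps_sin_bound eps He phi) as Ha. fold a in Ha.
pose proof (b_pos a Ha) as (Hb & Hb2).
set (f := cross e x). assert (Hf : TS2 x f)
  by (unfold f; clear; generalize e; intros; vec_destruct; vec_unfold; ring).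
set (k := Omega x e f).
assert (K : forall t, alpha (fiber_point x e f t) (fiber_tangent e f t) * - k = fiber_density a t).
{ intros t. destruct (fiber_frame x e t Hx He1 He2) as (Hp & Ht & Hn). fold f in Hp, Ht, Hn.
  destruct (fiber_density_eq eps phi theta t) as (_ & _ & E).
  change (finsler_norm eps (fiber_point x e f t) / speed_root eps (fiber_point x e f t) ^ 3
    = fiber_density a t) in E.
  assert (Hp1 : fst (fiber_point x e f t) = x) by reflexivity.
  assert (Hp2 : snd (fiber_point x e f t) = lincomb (cos t) e (sin t) f) by reflexivity.
  set (p := fiber_point x e f t) in *.
  destruct (THM_frame_vector p (-1) 0 0 Hp) as (T1 & A1 & B1 & C1).
  destruct (THM_frame_vector p 0 0 1 Hp) as (T2 & A2 & B2 & C2).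
  destruct (THM_frame_vector p 0 (-1) 0 Hp) as (T3 & A3 & B3 & C3).
  pose proof (Hvol p _ _ _ Hp T1 T2 T3) as H.
  rewrite (contact_volume_eq eps F He HF) in H by assumption.
  rewrite !det3_frame in H by assumption. rewrite E, A1, A2, A3, B1, B2, B3, C1, C2, C3 in H.
  rewrite Ht.
  assert (G1 : fst (frame_vector p (-1) 0 0) = lincomb 0 e 0 f).
  { unfold frame_vector. cbn [fst]. rewrite Hp2, Hn. generalize f e. clear. intros.
    vec_destruct. vec_unfold. f_equal; [f_equal|]; ring. }
  assert (G2 : fst (frame_vector p 0 0 1) = lincomb (cos t) e (sin t) f).
  { unfold frame_vector. cbn [fst]. rewrite Hp2, Hn. generalize f e. clear. intros.
    vec_destruct. vec_unfold. f_equal; [f_equal|]; ring. }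
  assert (G3 : fst (frame_vector p 0 (-1) 0) = lincomb (sin t) e (- cos t) f).
  { unfold frame_vector. cbn [fst]. rewrite Hp2, Hn. generalize f e. clear. intros.
    vec_destruct. vec_unfold. f_equal; [f_equal|]; ring. }
  rewrite G1, G2, G3, Hp1 in H.
  rewrite !(volume_form_combination Omega x e f _ _ _ _ HO Hx He1 Hf) in H. fold k in H.
  pose proof (sin2_cos2 t) as Hsc. unfold Rsqr in Hsc.
  assert (Q : cos t * - cos t - sin t * sin t = -1) by lra.
  rewrite Q in H. lra. }
assert (Hk : k <> 0).
{ intros E. pose proof (K 0) as K0. rewrite E in K0.
  destruct (sqrt_radicand a Ha 0) as (HS & _ & HSa).
  assert (0 < fiber_density a 0); [|lra].
  unfold fiber_density. apply Rdiv_lt_0_compat; [now apply Rinv_0_lt_compat|now apply pow_lt]. }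
assert (Kv : k = - / sqrt (1 - a ^ 2) ^ 3).
{ pose proof (Hint x Hx) as HI.
  rewrite (fiber_integral_eq eps F He HF x e alpha (fun t => - / k * fiber_density a t + 0 * 0)) in HI;
    try assumption.
  - rewrite (RInt_combination (fiber_density a) (fun _ => 0)) in HI.
    + rewrite RInt_fiber_density in HI by exact Ha. pose proof PI_RGT_0.
      apply (Rmult_eq_reg_l (- / k * (2 * PI)));
        [|apply Rmult_integral_contrapositive_currified;
          [apply Ropp_neq_0_compat, Rinv_neq_0_compat, Hk|lra]].
      transitivity (- (2 * PI)); [field; exact Hk|].
      transitivity (/ k * (2 * PI / sqrt (1 - a ^ 2) ^ 3)); [lra|field]. split; [lra|exact Hk].
    + apply continuous_fiber_density, Ha.
    + intros; apply continuous_const.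
  - intros t. apply (continuous_combination (fiber_density a) (fun _ => 0)).
    + apply continuous_fiber_density, Ha.
    + apply continuous_const.
  - intros t. fold f. rewrite <- K. field. exact Hk. }
split.
- intros v w Hv Hw. unfold x at 2. rewrite area_density_sph. fold a.
  rewrite (tangent_expansion x e v Hx He1 He2 Hv), (tangent_expansion x e w Hx He1 He2 Hw).
  fold f. rewrite (volume_form_combination Omega x e f _ _ _ _ HO Hx He1 Hf). fold k. rewrite Kv.
  transitivity (/ sqrt (1 - a ^ 2) ^ 3 * ((dot v e * dot w f - dot v f * dot w e) * det3 x e f)).
  + pose proof (det3_clockwise x e Hx He1 He2) as D. fold f in D. rewrite D. ring.
  + apply f_equal. generalize (dot v e) (dot v f) (dot w e) (dot w f) x e f. clear. intros.
    vec_destruct. vec_unfold. ring.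
- intros t. fold f. rewrite <- (K t), Kv. field. lra.
Qed.

Lemma volume_angle_exists :
  let Omega := fun x v w => area_density eps x * det3 x v w in
  is_volume_form Omega /\
  is_volume_angle F Omega (fun p Y =>
    - (finsler_norm eps p / speed_root eps p ^ 3) / area_density eps (fst p) * spin p Y).
Proof.
intros Omega. split; [|split; [|split; [|split]]].
- intros x Hx. split; [|split].
  + intros. unfold Omega. vec_destruct. vec_unfold. ring.
  + intros. unfold Omega. vec_destruct. vec_unfold. ring.
  + destruct (sph_surj x Hx) as (phi & theta & E).
    destruct (spherical_frame phi theta) as (_ & He1 & He2 & _). rewrite <- E in *.
    exists (- sin theta, cos theta, 0), (cross (- sin theta, cos theta, 0) x).
    split; [exact He1|split].
    * clear. generalize (- sin theta) (cos theta). intros. vec_destruct. vec_unfold. ring.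
    * unfold Omega. rewrite det3_clockwise by assumption.
      pose proof (area_density_pos eps He x Hx). lra.
- intros p Hp a b Y Z _ _. unfold spin.
  transitivity (- (finsler_norm eps p / speed_root eps p ^ 3) / area_density eps (fst p)
    * (a * dot (snd Y) (normal p) + b * dot (snd Z) (normal p))); [|ring].
  f_equal. generalize (normal p). clear. intros. vec_destruct. vec_unfold. ring.
- intros p Y Hp [HY HY0] Hne.
  pose proof (density_pos eps He p Hp). pose proof (area_density_pos eps He (fst p) (proj1 Hp)).
  apply Rmult_integral_contrapositive_currified.
  + apply Rmult_integral_contrapositive_currified; [lra|apply Rinv_neq_0_compat; lra].
  + intros Hs. apply Hne. rewrite (THM_frame p Y Hp HY), Hs. unfold side, forward. rewrite HY0.
    transitivity ((0, 0, 0, (0, 0, 0)) : vec * vec); [|reflexivity].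
    unfold frame_vector. generalize (normal p). clear. destruct p. intros. vec_destruct. vec_unfold.
    f_equal; (f_equal; [f_equal|]); ring.
- intros p Y1 Y2 Y3 Hp H1 H2 H3. rewrite (contact_volume_eq eps F He HF) by assumption.
  unfold Omega. pose proof (area_density_pos eps He (fst p) (proj1 Hp)).
  destruct (speed_root_spec eps p He Hp) as (HS & _). field. split; lra.
- intros x Hx. destruct (sph_surj x Hx) as (phi & theta & ->).
  destruct (spherical_frame phi theta) as (_ & He1 & He2 & _).
  pose proof (eps_sin_bound eps He phi) as Ha. set (a := eps * sin phi) in *.
  pose proof (b_pos a Ha) as (Hb & Hb2).
  set (x := sph phi theta) in *. set (e := (- sin theta, cos theta, 0)) in *.
  rewrite (fiber_integral_eq eps F He HF x e _
    (fun t => sqrt (1 - a ^ 2) ^ 3 * fiber_density a t + 0 * 0)); try assumption.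
  + rewrite (RInt_combination (fiber_density a) (fun _ => 0)).
    * rewrite RInt_fiber_density by exact Ha. field. lra.
    * apply continuous_fiber_density, Ha.
    * intros; apply continuous_const.
  + intros t. apply (continuous_combination (fiber_density a) (fun _ => 0)).
    * apply continuous_fiber_density, Ha.
    * apply continuous_const.
  + intros t. destruct (fiber_frame x e t Hx He1 He2) as (Hp & -> & _).
    destruct (fiber_density_eq eps phi theta t) as (_ & _ & E). fold x e a in E. rewrite E.
    destruct (THM_frame_vector _ (-1) 0 0 Hp) as (_ & -> & _).
    change (fst (fiber_point x e (cross e x) t)) with x. unfold x.
    rewrite area_density_sph. fold a. field. lra.
Qed.

Lemma volume_form_spec : is_volume_form (volume_form F) /\
  is_volume_angle F (volume_form F) (angle_form F).
Proof.
destruct volume_angle_exists as [H1 H2].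
assert (HV : is_volume_form (volume_form F) /\ exists alpha, is_volume_angle F (volume_form F) alpha).
{ apply (the_spec (fun _ _ _ => 0)
    (fun Omega => is_volume_form Omega /\ exists alpha, is_volume_angle F Omega alpha) _
    (conj H1 (ex_intro _ _ H2))). }
destruct HV as [HV [alpha Halpha]]. split; [exact HV|].
exact (the_spec (fun _ _ => 0) _ alpha Halpha).
Qed.

(** The antiderivative is [- 2 PI cos phi / ((1 - eps^2) b)]. *)
Lemma volume_eq : volume F = 4 * PI / (1 - eps ^ 2).
Proof.
destruct volume_form_spec as [HO Halpha].
pose (b := fun phi => sqrt (1 - (eps * sin phi) ^ 2)).
assert (Hb : forall phi, 0 < b phi /\ b phi ^ 2 = 1 - (eps * sin phi) ^ 2)
  by (intros phi; apply b_pos, eps_sin_bound, He).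
unfold volume.
rewrite (RInt_ext _ (fun phi => 2 * PI * (sin phi / b phi ^ 3))).
2:{ intros phi _. rewrite (RInt_ext _ (fun _ => sin phi / b phi ^ 3)).
  - rewrite RInt_const. change ((2 * PI - 0) * (sin phi / b phi ^ 3) = 2 * PI * (sin phi / b phi ^ 3)).
    ring.
  - intros theta _.
    destruct (volume_angle_unique _ _ phi theta HO Halpha) as [HV _].
    pose proof (sin2_cos2 theta) as Ht. pose proof (sin2_cos2 phi) as Hp. unfold Rsqr in *.
    rewrite HV.
    + rewrite area_density_sph. fold (b phi).
      assert (D : det3 (sph phi theta) (sph_dphi phi theta) (sph_dtheta phi theta) = sin phi).
      { unfold sph, sph_dphi, sph_dtheta, det3.
        generalize dependent (sin theta). generalize dependent (cos theta).
        generalize dependent (sin phi). generalize dependent (cos phi). clear. intros. nsatz. }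
      rewrite D. unfold Rdiv. apply Rmult_comm.
    + unfold TS2, sph, sph_dphi, dot.
      generalize dependent (sin theta). generalize dependent (cos theta).
      generalize (sin phi). generalize (cos phi). clear. intros. nsatz.
    + unfold TS2, sph, sph_dtheta, dot. ring. }
pose (G := fun phi => - (2 * PI / (1 - eps ^ 2)) * (cos phi / b phi)).
assert (HG : forall phi, is_derive G phi (2 * PI * (sin phi / b phi ^ 3))).
{ intros phi. destruct (Hb phi) as [Hb1 Hb2]. pose proof (eps_sin_bound eps He phi) as Ha.
  pose proof (sin2_cos2 phi) as Hp. unfold Rsqr in Hp.
  unfold G, b. auto_derive.
  - split; [|split; [|easy]].
    + eapply Rlt_le_trans; [exact Ha|]. right. ring.
    + apply Rgt_not_eq. apply sqrt_lt_R0. eapply Rlt_le_trans; [exact Ha|]. right. ring.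
  - replace (1 + - (eps * sin phi * (eps * sin phi * 1))) with (1 - (eps * sin phi) ^ 2) by ring.
    fold (b phi). set (B := b phi) in *.
    assert (Hc : cos phi ^ 2 = 1 - sin phi ^ 2) by lra.
    assert (He2 : 1 - eps ^ 2 <> 0) by nra.
    transitivity (2 * PI * (sin phi * (B ^ 2 - eps ^ 2 * cos phi ^ 2) / (1 - eps ^ 2) / B ^ 3)).
    + field. split; [exact He2|lra].
    + rewrite Hb2, Hc. field. split; [lra|exact He2]. }
assert (H : is_RInt (fun phi => 2 * PI * (sin phi / b phi ^ 3)) 0 PI (minus (G PI) (G 0))).
{ apply (is_RInt_derive G).
  - intros; apply HG.
  - intros phi _. apply (ex_derive_continuous (fun phi => 2 * PI * (sin phi / b phi ^ 3))).
    destruct (Hb phi) as [Hb1 _]. pose proof (eps_sin_bound eps He phi) as Ha.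
    unfold b in *.
    assert (E : 1 + - (eps * sin phi * (eps * sin phi * 1)) = 1 - (eps * sin phi) ^ 2) by ring.
    pose proof (pow_lt _ 3 Hb1) as HS3. simpl pow in HS3 at 1.
    auto_derive. rewrite E. repeat split; [exact Ha|]. apply Rgt_not_eq. exact HS3. }
rewrite (is_RInt_unique _ _ _ _ H). unfold minus, plus, opp, G, b; simpl.
rewrite sin_PI, sin_0, cos_PI, cos_0, Rmult_0_r, Rmult_0_l, Rminus_0_r, sqrt_1. field. nra.
Qed.

End KatokZiller.

(** * The Finsler-Laplace operator *)

Lemma dderiv_lincomb (U : vec -> R) (a b : R) (v w x : vec) : smooth U ->
  dderiv U (lincomb a v b w) x = a * dderiv U v x + b * dderiv U w x.
Proof. intros HU. exact (dderiv_lin U a b v w x HU). Qed.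

Lemma hessian_lincomb (U : vec -> R) (a b c d : R) (v w y z x : vec) : smooth U ->
  hessian U (lincomb a v b w) (lincomb c y d z) x =
  a * c * hessian U v y x + a * d * hessian U v z x
  + b * c * hessian U w y x + b * d * hessian U w z x.
Proof.
intros HU. unfold hessian.
rewrite !dderiv_lincomb by (apply (smooth_dderiv U); exact HU). unfold lincomb.
destruct v as [[v1 v2] v3], w as [[w1 w2] w3]. vec_unfold. ring.
Qed.

Section KatokZiller.
Context (eps : R) (F : vec -> vec -> R) (He : 0 < eps < 1) (HF : is_katok_ziller eps F).

Lemma THM_reeb (p : vec * vec) : HM p -> THM p (reeb F p).
Proof.
intros Hp. rewrite (reeb_eq eps F He HF p Hp). now apply THM_frame_vector.
Qed.

Lemma lie_reeb_eq (U u : vec -> R) (q : vec * vec) : smooth U -> (forall x, S2 x -> u x = U x) ->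
  HM q -> lie (reeb F) (fun q => u (fst q)) q = dderiv U (fst (reeb_frame eps q)) (fst q).
Proof.
intros HU Hu Hq. apply lie_eq; [exact Hq|now apply THM_reeb|].
intros c Hc HcM Hc0 [Hx _]. rewrite (reeb_eq eps F He HF q Hq) in Hx.
apply (is_derive_ext (fun t => U (fst (c t)))).
- intros t. symmetry. apply Hu, HcM.
- rewrite <- Hc0 at 2. exact (is_derive_comp_curve U _ 0 _ HU Hx).
Qed.

Lemma lie_lie_reeb_eq (U u : vec -> R) (p : vec * vec) :
  smooth U -> (forall x, S2 x -> u x = U x) -> HM p ->
  lie (reeb F) (lie (reeb F) (fun q => u (fst q))) p =
  hessian U (fst (reeb_frame eps p)) (fst (reeb_frame eps p)) (fst p)
  + dderiv U (reeb_acceleration eps p) (fst p).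
Proof.
intros HU Hu Hp. apply lie_eq; [exact Hp|now apply THM_reeb|].
intros c Hc HcM Hc0 Hv. rewrite (reeb_eq eps F He HF p Hp) in Hv. rewrite <- Hc0 in Hv.
apply (is_derive_ext (fun t => dderiv U (fst (reeb_frame eps (c t))) (fst (c t)))).
- intros t. symmetry. now apply lie_reeb_eq.
- pose proof (is_derive_reeb_direction eps He c HcM Hv) as Hw. destruct Hv as [Hx _].
  pose proof (is_derive_dderiv_curve U _ _ 0 _ _ HU Hx Hw) as H. cbv beta in H.
  rewrite Hc0 in H. exact H.
Qed.

(** The average over a fiber of [reeb_acceleration]: the Coriolis term is odd in [v] once
    weighted by the fiber density, and drops out. *)
Definition drift (x : vec) : vec :=
  lincomb (-1) x (- eps ^ 2) (rotation_field (rotation_field x)).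

(** The velocity of the base point is [h v] with [h = S + a cos t], and [h] times the fiber density
    is [/ S^3]. Hence the second-order terms have the weight [h / S^3 = / S^2 + a cos t / S^3],
    whose second part is odd in [v], as are the Coriolis terms. *)
Lemma finsler_laplacian_eq (U u : vec -> R) (phi theta : R) :
  smooth U -> (forall x, S2 x -> u x = U x) ->
  let x := sph phi theta in let e := (- sin theta, cos theta, 0) in let f := sph_dphi phi theta in
  let a := eps * sin phi in let b := sqrt (1 - a ^ 2) in
  finsler_laplacian F u x = b ^ 3 / PI *
    (cos_moment a * hessian U e e x + sin_moment a * hessian U f f x)
  + 2 * dderiv U (drift x) x.
Proof.
intros HU Hu x e f a b.
destruct (spherical_frame phi theta) as (Hx & He1 & He2 & Hf). fold x e in Hx, He1, He2, Hf.
fold f in Hf.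
pose proof (eps_sin_bound eps He phi) as Ha. fold a in Ha.
pose proof (b_pos a Ha) as (Hb & Hb2). fold b in Hb, Hb2.
destruct (volume_form_spec eps F He HF) as [HO Halpha].
destruct (volume_angle_unique eps F He HF _ _ phi theta HO Halpha) as [_ Hang].
fold x e a b in Hang.
set (Hee := hessian U e e x). set (Hff := hessian U f f x).
set (Hef := hessian U e f x + hessian U f e x). set (D0 := dderiv U (drift x) x).
set (De := dderiv U (rotation_field e) x). set (Df := dderiv U (rotation_field f) x).
pose (quad := fun t => cos t ^ 2 * Hee + cos t * sin t * Hef + sin t ^ 2 * Hff).
pose (odd := fun t => a * cos t * quad t - a / b ^ 2 * cos t * D0
                      + 2 * eps * (cos t * De + sin t * Df)).
unfold finsler_laplacian.
assert (Hcos : forall t, continuous (fun t => cos t ^ 2 / radicand a t) t)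
  by (intros; apply continuous_over_radicand; [exact Ha|intros; now auto_derive]).
assert (Hsin : forall t, continuous (fun t => sin t ^ 2 / radicand a t) t)
  by (intros; apply continuous_over_radicand; [exact Ha|intros; now auto_derive]).
assert (Hcs : forall t, continuous (fun t => cos t * sin t / radicand a t) t)
  by (intros; apply continuous_over_radicand; [exact Ha|intros; now auto_derive]).
assert (Hone : forall t, continuous (fun t => / radicand a t) t)
  by (intros; now apply continuous_inv_radicand).
assert (Hodd : forall t, continuous (fun t => odd t / sqrt (radicand a t) ^ 3) t).
{ intros t. apply continuous_inv_cube; [exact Ha|]. intros s. unfold odd, quad. now auto_derive. }
pose (g1 := fun t => Hee * (cos t ^ 2 / radicand a t) + Hff * (sin t ^ 2 / radicand a t)).
pose (g2 := fun t => Hef * (cos t * sin t / radicand a t) + D0 / b ^ 2 * / radicand a t).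
pose (g3 := fun t => 1 * g1 t + 1 * g2 t).
pose (g4 := fun t => b ^ 3 * g3 t + b ^ 3 * (odd t / sqrt (radicand a t) ^ 3)).
assert (C1 : forall t, continuous g1 t) by (intros; now apply continuous_combination).
assert (C2 : forall t, continuous g2 t) by (intros; now apply continuous_combination).
assert (C3 : forall t, continuous g3 t) by (intros; now apply continuous_combination).
assert (C4 : forall t, continuous g4 t) by (intros; now apply continuous_combination).
rewrite (fiber_integral_eq eps F He HF x e _ g4 Hx He1 He2 C4).
- unfold g4. rewrite RInt_combination by assumption. unfold g3.
  rewrite RInt_combination by assumption. unfold g1, g2.
  rewrite !RInt_combination by assumption.
  rewrite (RInt_inv_radicand a Ha). fold b.
  rewrite (RInt_inv_cube_odd a Ha odd).
  2:{ intros s. unfold odd, quad. now auto_derive. }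
  2:{ intros s. unfold odd, quad. rewrite neg_cos, neg_sin. ring. }
  rewrite (RInt_odd_periodic (fun t => cos t * sin t / radicand a t) (2 * PI) Hcs).
  2:{ intros t. unfold radicand. rewrite cos_minus, sin_minus, cos_2PI, sin_2PI.
    replace (0 * cos t - 1 * sin t) with (- sin t) by ring.
    replace (1 * cos t + 0 * sin t) with (cos t) by ring.
    replace ((- sin t) ^ 2) with (sin t ^ 2) by ring. unfold Rdiv. ring. }
  change (RInt (fun t => cos t ^ 2 / radicand a t) 0 (2 * PI)) with (cos_moment a).
  change (RInt (fun t => sin t ^ 2 / radicand a t) 0 (2 * PI)) with (sin_moment a).
  pose proof PI_RGT_0. field. lra.
- intros t. rewrite Hang.
  destruct (fiber_frame x e t Hx He1 He2) as (Hp & _ & Hn).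
  destruct (fiber_density_eq eps phi theta t) as (E1 & E2 & _). fold x e a in E1, E2.
  rewrite (lie_lie_reeb_eq U u _ HU Hu Hp).
  unfold reeb_acceleration, reeb_frame, frame_vector. cbn [fst]. rewrite E1, E2, Hn.
  destruct (sqrt_radicand a Ha t) as (HS & HS2 & HSa).
  set (S := sqrt (radicand a t)) in *. set (h := S + a * cos t) in *.
  change (fst (fiber_point x e (cross e x) t)) with x.
  change (snd (fiber_point x e (cross e x) t)) with (lincomb (cos t) e (sin t) (cross e x)).
  rewrite Hf.
  assert (W : lincomb h (lincomb (cos t) e (sin t) f) (- 0) (lincomb (sin t) e (- cos t) f)
    = lincomb (h * cos t) e (h * sin t) f).
  { generalize e f. clear. intros. vec_destruct. vec_unfold. f_equal; [f_equal|]; ring. }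
  rewrite W, hessian_lincomb by exact HU. fold Hee Hff.
  assert (A : dderiv U (plus (lincomb (-1) x (2 * eps * h)
        (rotation_field (lincomb (cos t) e (sin t) f)))
      (scal (- eps ^ 2) (rotation_field (rotation_field x)))) x
    = D0 + 2 * eps * h * (cos t * De + sin t * Df)).
  { unfold D0, De, Df. rewrite <- dderiv_lincomb by exact HU.
    rewrite <- (Rmult_1_l (dderiv U (drift x) x)), <- dderiv_lincomb by exact HU.
    apply (f_equal (fun v => dderiv U v x)). unfold drift.
    generalize x e f. clear. intros. vec_destruct. vec_unfold.
    f_equal; [f_equal|]; ring. }
  rewrite A.
  assert (K1 : fiber_density a t * h = / S ^ 3)
    by (unfold fiber_density; fold S h; field; split; lra).
  pose proof (fiber_density_split a Ha t) as K2. fold S in K2.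
  set (K := fiber_density a t) in *.
  transitivity (b ^ 3 * (h * (K * h) * quad t + K * D0
    + 2 * eps * (K * h) * (cos t * De + sin t * Df))); [unfold quad, Hef; ring|].
  rewrite K1, K2. unfold g4, g3, g1, g2, odd, h. fold S. rewrite <- HS2, <- Hb2.
  unfold quad, Hef. field. split; lra.
Qed.

End KatokZiller.

Section KatokZiller.
Context (eps : R) (F : vec -> vec -> R) (He : 0 < eps < 1) (HF : is_katok_ziller eps F).

Lemma is_linear_c1 : is_linear c1.
Proof. apply (is_linear_comp fst fst); apply is_linear_fst. Qed.

(** The second derivatives vanish, so that only the drift contributes. *)
Lemma first_coordinate_eigenfunction : is_eigenvalue F (2 - 2 * eps ^ 2).
Proof.
pose proof (smooth_linear c1 is_linear_c1) as Hs.
assert (D : forall v x : vec, dderiv c1 v x = c1 v)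
  by (intros v x; apply dderiv_filterdiff, filterdiff_linear, is_linear_c1).
assert (Z : forall i (w x : vec), dderiv (partial c1 i) w x = 0).
{ intros i w x. replace (partial c1 i) with (fun _ : vec => c1 (basis_vector i)).
  - exact (Derive_const (c1 (basis_vector i)) 0).
  - apply functional_extensionality. intros y. symmetry. apply D. }
exists c1. split; [exists c1; split; [exact Hs|reflexivity]|split].
- exists (1, 0, 0). split; [vec_unfold; ring|vec_unfold; lra].
- intros x Hx. destruct (sph_surj x Hx) as (phi & theta & ->).
  rewrite (finsler_laplacian_eq eps F He HF c1 c1 phi theta Hs (fun _ _ => eq_refl)).
  unfold hessian. rewrite !Z, D.
  generalize (sph phi theta). clear. intros [[x1 x2] x3]. unfold drift, rotation_field.
  vec_unfold. ring.
Qed.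

(** ** The operator in spherical coordinates *)

Definition coef_b (phi : R) : R := sqrt (1 - (eps * sin phi) ^ 2).

Lemma coef_b_spec phi : 0 < coef_b phi /\ coef_b phi ^ 2 = 1 - (eps * sin phi) ^ 2.
Proof. apply b_pos, eps_sin_bound, He. Qed.

Definition coef_phi_phi (phi : R) : R := 2 * coef_b phi ^ 2 / (1 + coef_b phi).
Definition coef_phi (phi : R) : R :=
  2 * (1 - coef_b phi ^ 2 / (1 + coef_b phi)) * cos phi / sin phi.
Definition coef_theta_theta (phi : R) : R :=
  2 * coef_b phi ^ 3 / ((1 + coef_b phi) * sin phi ^ 2).

Section Pullback.
Context (U : vec -> R) (HU : smooth U).

Definition pull (phi theta : R) : R := U (sph phi theta).
Definition pull_phi (phi theta : R) : R := dderiv U (sph_dphi phi theta) (sph phi theta).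
Definition pull_phi_phi (phi theta : R) : R :=
  hessian U (sph_dphi phi theta) (sph_dphi phi theta) (sph phi theta)
  - dderiv U (sph phi theta) (sph phi theta).
Definition pull_theta (phi theta : R) : R := dderiv U (sph_dtheta phi theta) (sph phi theta).
Definition pull_theta_theta (phi theta : R) : R :=
  hessian U (sph_dtheta phi theta) (sph_dtheta phi theta) (sph phi theta)
  + dderiv U (rotation_field (rotation_field (sph phi theta))) (sph phi theta).

Lemma is_derive_sph_phi phi theta : is_derive (fun p => sph p theta) phi (sph_dphi phi theta).
Proof. apply is_derive_vec; auto_derive; try easy; ring. Qed.

Lemma is_derive_sph_theta phi theta : is_derive (fun t => sph phi t) theta (sph_dtheta phi theta).
Proof. apply is_derive_vec; auto_derive; try easy; ring. Qed.

Lemma is_derive_pull_phi phi theta : is_derive (fun p => pull p theta) phi (pull_phi phi theta).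
Proof. exact (is_derive_comp_curve U _ _ _ HU (is_derive_sph_phi phi theta)). Qed.

Lemma is_derive_pull_theta phi theta :
  is_derive (fun t => pull phi t) theta (pull_theta phi theta).
Proof. exact (is_derive_comp_curve U _ _ _ HU (is_derive_sph_theta phi theta)). Qed.

Lemma is_derive_pull_phi_phi phi theta :
  is_derive (fun p => pull_phi p theta) phi (pull_phi_phi phi theta).
Proof.
assert (H : is_derive (fun p => sph_dphi p theta) phi (lincomb (-1) (sph phi theta) 0 (0, 0, 0))).
{ unfold sph_dphi. evar_last.
  - apply is_derive_vec; auto_derive; try easy; reflexivity.
  - unfold sph. vec_unfold. f_equal; [f_equal|]; ring. }
evar_last.
- exact (is_derive_dderiv_curve U _ _ _ _ _ HU (is_derive_sph_phi phi theta) H).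
- cbv beta. rewrite dderiv_lincomb by exact HU. unfold pull_phi_phi. ring.
Qed.

Lemma is_derive_pull_theta_theta phi theta :
  is_derive (fun t => pull_theta phi t) theta (pull_theta_theta phi theta).
Proof.
assert (H : is_derive (fun t => sph_dtheta phi t) theta
  (rotation_field (rotation_field (sph phi theta)))).
{ unfold sph_dtheta, sph, rotation_field. apply is_derive_vec; auto_derive; try easy; ring. }
exact (is_derive_dderiv_curve U _ _ _ _ _ HU (is_derive_sph_theta phi theta) H).
Qed.

(** The radial derivative of [U], which is not determined by its values on the sphere, cancels
    between the drift and the two second-order terms. *)
Lemma laplacian_spherical (u : vec -> R) phi theta : (forall x, S2 x -> u x = U x) ->
  sin phi <> 0 ->
  finsler_laplacian F u (sph phi theta) =
  coef_phi_phi phi * pull_phi_phi phi theta + coef_phi phi * pull_phi phi theta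
  + coef_theta_theta phi * pull_theta_theta phi theta.
Proof.
intros Hu Hs.
rewrite (finsler_laplacian_eq eps F He HF U u phi theta HU Hu). cbv zeta.
pose proof (eps_sin_bound eps He phi) as Ha.
destruct (moments (eps * sin phi) Ha) as [-> ->].
{ apply Rmult_integral_contrapositive_currified; [lra|exact Hs]. }
fold (coef_b phi). destruct (coef_b_spec phi) as [Hb Hb2].
assert (E1 : sph_dtheta phi theta
  = lincomb (sin phi) (- sin theta, cos theta, 0) 0 (0, 0, 0))
  by (unfold sph_dtheta; vec_unfold; f_equal; [f_equal|]; ring).
assert (E2 : rotation_field (rotation_field (sph phi theta))
  = lincomb (- sin phi ^ 2) (sph phi theta) (- (sin phi * cos phi)) (sph_dphi phi theta)).
{ pose proof (sin2_cos2 phi) as H. unfold Rsqr in H. unfold sph, sph_dphi, rotation_field. vec_unfold.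
  generalize dependent (sin phi). generalize dependent (cos phi).
  generalize (cos theta) (sin theta). clear. intros. f_equal; [f_equal|]; nsatz. }
unfold drift. rewrite dderiv_lincomb by exact HU.
unfold pull_phi_phi, pull_theta_theta, pull_phi.
rewrite E2, dderiv_lincomb by exact HU. rewrite E1 at 1 2. rewrite hessian_lincomb by exact HU.
unfold coef_phi_phi, coef_phi, coef_theta_theta.
set (b := coef_b phi) in *.
pose proof PI_RGT_0.
assert (Ee : eps ^ 2 = (1 - b ^ 2) / sin phi ^ 2) by (rewrite Hb2; field; exact Hs).
rewrite Ee. field. repeat split; (lra || exact Hs).
Qed.

End Pullback.
End KatokZiller.

(** * A maximum principle on the rectangle *)

(** Composing with [atan] makes the function bounded, so that its supremum exists before it is
    known to be attained. *)
Lemma rectangle_maximum (q : R -> R -> R) (a b c d : R) : a <= b -> c <= d ->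
  (forall x y, a <= x <= b -> c <= y <= d -> continuity_2d_pt q x y) ->
  exists x0 y0, a <= x0 <= b /\ c <= y0 <= d /\
    forall x y, a <= x <= b -> c <= y <= d -> q x y <= q x0 y0.
Proof.
intros Hab Hcd Hq.
pose (E := fun z => exists x y, a <= x <= b /\ c <= y <= d /\ z = atan (q x y)).
destruct (completeness E) as [M [HM1 HM2]].
{ exists (PI / 2). intros z (x & y & _ & _ & ->). pose proof (atan_bound (q x y)). lra. }
{ exists (atan (q a c)), a, c. repeat split; lra. }
apply NNPP. intros Hno.
assert (Hlt : forall u v, a <= u <= b -> c <= v <= d -> atan (q u v) < M).
{ intros u v Hu Hv.
  destruct (Rle_lt_or_eq_dec (atan (q u v)) M) as [H | H]; [|exact H|exfalso].
  { apply HM1. now exists u, v. }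
  apply Hno. exists u, v. split; [exact Hu|split; [exact Hv|]]. intros x y Hx Hy.
  apply Rnot_lt_le. intros Hc. apply atan_increasing in Hc.
  pose proof (HM1 (atan (q x y)) (ex_intro _ x (ex_intro _ y (conj Hx (conj Hy eq_refl))))). lra. }
assert (Hloc : forall u v, exists dl : posreal, a <= u <= b -> c <= v <= d ->
  forall x y, Rabs (x - u) < dl -> Rabs (y - v) < dl -> atan (q x y) < M - dl).
{ intros u v.
  destruct (classic (a <= u <= b /\ c <= v <= d)) as [[Hu Hv] | H].
  2:{ exists (mkposreal 1 Rlt_0_1). intros Hu Hv. now destruct H. }
  pose proof (Hlt u v Hu Hv) as HL.
  assert (Hc : continuity_2d_pt (fun x y => atan (q x y)) u v).
  { apply continuity_1d_2d_pt_comp; [|now apply Hq].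
    apply derivable_continuous_pt, derivable_pt_atan. }
  assert (He : 0 < (M - atan (q u v)) / 2) by lra.
  destruct (Hc (mkposreal _ He)) as [dl Hdl]. simpl in Hdl.
  assert (Hm : 0 < Rmin dl ((M - atan (q u v)) / 2)) by (apply Rmin_pos; [apply cond_pos|exact He]).
  exists (mkposreal _ Hm). intros _ _ x y Hx Hy. simpl in *.
  pose proof (Rmin_l dl ((M - atan (q u v)) / 2)). pose proof (Rmin_r dl ((M - atan (q u v)) / 2)).
  specialize (Hdl x y ltac:(lra) ltac:(lra)). apply Rabs_def2 in Hdl. lra. }
pose (dl := fun u v => proj1_sig (constructive_indefinite_description _ (Hloc u v))).
assert (Hdl : forall u v, a <= u <= b -> c <= v <= d ->
  forall x y, Rabs (x - u) < dl u v -> Rabs (y - v) < dl u v -> atan (q x y) < M - dl u v)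
  by (intros u v; exact (proj2_sig (constructive_indefinite_description _ (Hloc u v)))).
destruct (compactness_value_2d a b c d dl) as [d0 Hd0].
assert (M <= M - d0); [|pose proof (cond_pos d0); lra].
apply HM2. intros z (x & y & Hx & Hy & ->).
destruct (NNPP _ (Hd0 x y Hx Hy)) as (u & v & Hu & Hv & Hxu & Hyv & Hle).
pose proof (Hdl u v Hu Hv x y Hxu Hyv). lra.
Qed.

(** If the second derivative were positive, the first would be positive just to the right of the
    critical point, and the function would exceed its maximum there. *)
Lemma local_maximum_derivatives (f f' : R -> R) (f'' x0 a b : R) : a < x0 < b ->
  (forall x, is_derive f x (f' x)) -> is_derive f' x0 f'' ->
  (forall x, a < x < b -> f x <= f x0) -> f' x0 = 0 /\ f'' <= 0.
Proof.
intros Hx0 Hf Hf' Hmax.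
assert (Hlim : forall g g0 l, is_derive g g0 l -> forall e, 0 < e ->
  exists dl, 0 < dl /\ forall h, Rabs h < dl -> h <> 0 -> Rabs ((g (g0 + h) - g g0) / h - l) < e).
{ intros g g0 l Hg e He. apply is_derive_Reals in Hg. destruct (Hg e He) as [dl Hdl].
  exists dl. split; [apply cond_pos|]. intros h Hh Hn. now apply Hdl. }
assert (H0 : f' x0 = 0).
{ assert (pr : derivable_pt f x0) by (exists (f' x0); apply is_derive_Reals, Hf).
  pose proof (deriv_maximum f a b x0 pr (proj1 Hx0) (proj2 Hx0)
    (fun x H1 H2 => Hmax x (conj H1 H2))) as H.
  pose proof (Derive_Reals f x0 pr) as HD. pose proof (is_derive_unique _ _ _ (Hf x0)) as HU.
  congruence. }
split; [exact H0|]. apply Rnot_lt_le. intros Hpos.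
destruct (Hlim f' x0 f'' Hf' f'' Hpos) as (dl & Hdl & Hl).
set (h := Rmin (dl / 2) ((b - x0) / 2)).
assert (Hh : 0 < h) by (apply Rmin_pos; lra).
assert (Hh1 : h < dl) by (pose proof (Rmin_l (dl / 2) ((b - x0) / 2)); unfold h; lra).
assert (Hh2 : x0 + h < b) by (pose proof (Rmin_r (dl / 2) ((b - x0) / 2)); unfold h; lra).
assert (Hinc : forall k, 0 < k <= h -> 0 < f' (x0 + k)).
{ intros k Hk. assert (Hk' : Rabs k < dl) by (rewrite Rabs_pos_eq; lra).
  specialize (Hl k Hk' ltac:(lra)). apply Rabs_def2 in Hl. rewrite H0 in Hl.
  assert (Hq : 0 < (f' (x0 + k) - 0) / k) by lra.
  replace (f' (x0 + k)) with ((f' (x0 + k) - 0) / k * k) by (field; lra).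
  apply Rmult_lt_0_compat; lra. }
destruct (MVT_cor2 f f' x0 (x0 + h)) as (z & Hz & Hzb); [lra|intros; apply is_derive_Reals, Hf|].
pose proof (Hinc (z - x0) ltac:(lra)) as HI. replace (x0 + (z - x0)) with z in HI by ring.
pose proof (Hmax (x0 + h) ltac:(lra)). nra.
Qed.

(** Derivatives of a function of [(p, t) = (phi, theta)], except the mixed one, which does not
    occur in the operators [jet_op]. *)
Record jet := Jet {
  jet_val : R -> R -> R; jet_p : R -> R -> R; jet_pp : R -> R -> R;
  jet_t : R -> R -> R; jet_tt : R -> R -> R;
  jet_p_spec : forall p t, is_derive (fun x => jet_val x t) p (jet_p p t);
  jet_pp_spec : forall p t, is_derive (fun x => jet_p x t) p (jet_pp p t);
  jet_t_spec : forall p t, is_derive (fun x => jet_val p x) t (jet_t p t);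
  jet_tt_spec : forall p t, is_derive (fun x => jet_t p x) t (jet_tt p t);
  jet_continuous : forall p t, continuity_2d_pt jet_val p t }.

Definition jet_op (A B D : R -> R) (mu : R) (v : jet) (p t : R) : R :=
  A p * jet_pp v p t + B p * jet_p v p t + D p * jet_tt v p t + mu * jet_val v p t.

(** Let [Q] be the maximum of [v / w]. If [Q] is positive it is attained in the interior, where
    [v - Q w] has a maximum with value 0; there the operator is nonpositive on [v - Q w], whereas
    it is positive on [- Q w] and zero on [v]. *)
Lemma maximum_principle (A B D : R -> R) (mu a b c d : R) (v w : jet) : a < b -> c < d ->
  (forall p, a < p < b -> 0 <= A p /\ 0 <= D p) ->
  (forall p t, a <= p <= b -> c <= t <= d -> 0 < jet_val w p t) ->
  (forall p t, a < p < b -> c < t < d -> jet_op A B D mu w p t < 0) ->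
  (forall p t, a < p < b -> c < t < d -> jet_op A B D mu v p t = 0) ->
  (forall t, c <= t <= d -> jet_val v a t = 0 /\ jet_val v b t = 0) ->
  (forall p, a <= p <= b -> jet_val v p c = 0 /\ jet_val v p d = 0) ->
  forall p t, a <= p <= b -> c <= t <= d -> jet_val v p t <= 0.
Proof.
intros Hab Hcd HAD Hw HLw HLv Hba Hbc p t Hp Ht.
destruct (rectangle_maximum (fun x y => jet_val v x y * / jet_val w x y) a b c d)
  as (p0 & t0 & Hp0 & Ht0 & Hmax); [lra|lra| |].
{ intros x y Hx Hy. apply continuity_2d_pt_mult; [apply jet_continuous|].
  apply continuity_2d_pt_inv; [apply jet_continuous|]. specialize (Hw x y Hx Hy). lra. }
set (Q := jet_val v p0 t0 * / jet_val w p0 t0) in *.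
pose proof (Hw p0 t0 Hp0 Ht0) as Hw0.
assert (Hle : forall x y, a <= x <= b -> c <= y <= d -> jet_val v x y <= Q * jet_val w x y).
{ intros x y Hx Hy. specialize (Hmax x y Hx Hy). specialize (Hw x y Hx Hy). cbv beta in Hmax.
  apply (Rmult_le_compat_r (jet_val w x y)) in Hmax; [|lra].
  rewrite Rmult_assoc, Rinv_l, Rmult_1_r in Hmax by lra. exact Hmax. }
assert (HQ0 : jet_val v p0 t0 = Q * jet_val w p0 t0) by (unfold Q; field; lra).
destruct (Rle_lt_dec Q 0) as [HQ | HQ].
{ specialize (Hle p t Hp Ht). specialize (Hw p t Hp Ht). nra. }
exfalso.
assert (Hv0 : 0 < jet_val v p0 t0) by (rewrite HQ0; now apply Rmult_lt_0_compat).
assert (Hp1 : a < p0 < b).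
{ destruct (Hba t0 Ht0) as [Z1 Z2]. split.
  - destruct (proj1 Hp0) as [|E]; [assumption|]. rewrite <- E, Z1 in Hv0. lra.
  - destruct (proj2 Hp0) as [|E]; [assumption|]. rewrite E, Z2 in Hv0. lra. }
assert (Ht1 : c < t0 < d).
{ destruct (Hbc p0 Hp0) as [Z1 Z2]. split.
  - destruct (proj1 Ht0) as [|E]; [assumption|]. rewrite <- E, Z1 in Hv0. lra.
  - destruct (proj2 Ht0) as [|E]; [assumption|]. rewrite E, Z2 in Hv0. lra. }
assert (Dm : forall (f g : R -> R) x f' g', is_derive f x f' -> is_derive g x g' ->
  is_derive (fun y => f y - Q * g y) x (f' - Q * g')).
{ intros f g x f' g' Hf Hg. apply (is_derive_minus f (fun y => Q * g y)); [exact Hf|].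
  apply (is_derive_scal g x Q g' Hg). }
destruct (local_maximum_derivatives (fun x => jet_val v x t0 - Q * jet_val w x t0)
  (fun x => jet_p v x t0 - Q * jet_p w x t0) (jet_pp v p0 t0 - Q * jet_pp w p0 t0) p0 a b)
  as [G1 G2]; [exact Hp1|intros; apply Dm; apply jet_p_spec|apply Dm; apply jet_pp_spec| |].
{ intros x Hx. specialize (Hle x t0 ltac:(lra) Ht0). lra. }
destruct (local_maximum_derivatives (fun y => jet_val v p0 y - Q * jet_val w p0 y)
  (fun y => jet_t v p0 y - Q * jet_t w p0 y) (jet_tt v p0 t0 - Q * jet_tt w p0 t0) t0 c d)
  as [G3 G4]; [exact Ht1|intros; apply Dm; apply jet_t_spec|apply Dm; apply jet_tt_spec| |].
{ intros y Hy. specialize (Hle p0 y Hp0 ltac:(lra)). lra. }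
specialize (HLw p0 t0 Hp1 Ht1). specialize (HLv p0 t0 Hp1 Ht1). destruct (HAD p0 Hp1) as [HA HD].
unfold jet_op in HLw, HLv. rewrite HQ0 in HLv.
assert (E1 : jet_p v p0 t0 = Q * jet_p w p0 t0) by lra. rewrite E1 in HLv.
assert (I1 : A p0 * (jet_pp v p0 t0 - Q * jet_pp w p0 t0) <= 0) by nra.
assert (I2 : D p0 * (jet_tt v p0 t0 - Q * jet_tt w p0 t0) <= 0) by nra.
assert (I3 : Q * (A p0 * jet_pp w p0 t0 + B p0 * jet_p w p0 t0 + D p0 * jet_tt w p0 t0
  + mu * jet_val w p0 t0) < 0) by nra.
lra.
Qed.

(** * Lower bound for the nonzero eigenvalues *)

Lemma continuity_2d_pt_pull (U : vec -> R) (r : R -> R) p t : smooth U ->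
  (forall t, ex_derive r t) -> continuity_2d_pt (fun x y => pull U x (r y)) p t.
Proof.
intros HU Hr. apply continuity_2d_pt_filterlim.
assert (C1 : forall g : R -> R, (forall x, ex_derive g x) ->
  filterlim (fun z : R * R => g (fst z)) (locally (p, t)) (locally (g p))).
{ intros g Hg. apply (filterlim_comp _ _ _ fst g (locally (p, t)) (locally p)).
  - exact (continuous_fst p t).
  - exact (ex_derive_continuous g p (Hg p)). }
assert (C2 : forall g : R -> R, (forall x, ex_derive g x) ->
  filterlim (fun z : R * R => g (r (snd z))) (locally (p, t)) (locally (g (r t)))).
{ intros g Hg. apply (filterlim_comp _ _ _ snd (fun y => g (r y)) (locally (p, t)) (locally t)).
  - exact (continuous_snd p t).
  - apply (ex_derive_continuous (fun y => g (r y))).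
    apply (ex_derive_comp g r); [apply Hg|apply Hr]. }
assert (Cm : forall g h : R -> R, (forall x, ex_derive g x) -> (forall x, ex_derive h x) ->
  filterlim (fun z : R * R => g (fst z) * h (r (snd z))) (locally (p, t))
    (locally (g p * h (r t)))).
{ intros g h Hg Hh. exact (continuous_mult (fun z : R * R => g (fst z)) _ (p, t) (C1 g Hg) (C2 h Hh)). }
assert (Es : forall x, ex_derive sin x) by (intros; now auto_derive).
assert (Ec : forall x, ex_derive cos x) by (intros; now auto_derive).
apply (filterlim_comp _ _ _ (fun z : R * R => sph (fst z) (r (snd z))) U (locally (p, t))
  (locally (sph p (r t)))).
- unfold sph.
  apply (filterlim_comp_2 (F := locally (p, t)) (G := locally (sin p * cos (r t), sin p * sin (r t)))
    (H := locally (cos p)) (fun z => (sin (fst z) * cos (r (snd z)), sin (fst z) * sin (r (snd z))))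
    (fun z => cos (fst z)) pair).
  + apply (filterlim_comp_2 (F := locally (p, t)) (G := locally (sin p * cos (r t)))
      (H := locally (sin p * sin (r t))) (fun z => sin (fst z) * cos (r (snd z)))
      (fun z => sin (fst z) * sin (r (snd z))) pair).
    * apply (Cm sin cos Es Ec).
    * apply (Cm sin sin Es Es).
    * intros P [dl HP]. exists (fun y => ball (sin p * cos (r t)) dl y)
        (fun y => ball (sin p * sin (r t)) dl y); [now exists dl|now exists dl|].
      intros x y Hx Hy. apply HP. now split.
  + apply (C1 cos Ec).
  + intros P [dl HP]. exists (fun y => ball (sin p * cos (r t), sin p * sin (r t)) dl y)
      (fun y => ball (cos p) dl y); [now exists dl|now exists dl|].
    intros x y Hx Hy. apply HP. now split.
- exact (smooth_continuous U (sph p (r t)) HU).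
Qed.

Lemma is_derive_shift (f : R -> R) (c t l : R) :
  is_derive f (c + t) l -> is_derive (fun y => f (c + y)) t l.
Proof.
intros Hf. evar_last.
- apply (is_derive_comp f (fun y => c + y) t l 1 Hf). auto_derive; [easy|ring].
- apply Rmult_1_l.
Qed.

Lemma is_derive_reflect (f : R -> R) (c t l : R) :
  is_derive f (c - t) l -> is_derive (fun y => f (c - y)) t (- l).
Proof.
intros Hf. evar_last.
- apply (is_derive_comp f (fun y => c - y) t l (-1) Hf). auto_derive; [easy|ring].
- change (-1 * l = - l). ring.
Qed.

Lemma is_derive_Rminus (f g : R -> R) t f' g' :
  is_derive f t f' -> is_derive g t g' -> is_derive (fun y => f y - g y) t (f' - g').
Proof. exact (is_derive_minus f g t f' g'). Qed.

(** Antisymmetric part of [U] under the reflection in the meridian plane at longitude [c]. *)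
Definition reflection_jet (U : vec -> R) (HU : smooth U) (c : R) : jet.
Proof.
refine {|
  jet_val := fun p t => pull U p (c + t) - pull U p (c - t);
  jet_p := fun p t => pull_phi U p (c + t) - pull_phi U p (c - t);
  jet_pp := fun p t => pull_phi_phi U p (c + t) - pull_phi_phi U p (c - t);
  jet_t := fun p t => pull_theta U p (c + t) - - pull_theta U p (c - t);
  jet_tt := fun p t => pull_theta_theta U p (c + t) - - - pull_theta_theta U p (c - t) |};
  intros p t.
- apply is_derive_Rminus; now apply is_derive_pull_phi.
- apply is_derive_Rminus; now apply is_derive_pull_phi_phi.
- apply is_derive_Rminus.
  + now apply (is_derive_shift (fun y => pull U p y)), is_derive_pull_theta.
  + now apply (is_derive_reflect (fun y => pull U p y)), is_derive_pull_theta.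
- apply is_derive_Rminus.
  + now apply (is_derive_shift (fun y => pull_theta U p y)), is_derive_pull_theta_theta.
  + apply (is_derive_opp (fun y => pull_theta U p (c - y))).
    now apply (is_derive_reflect (fun y => pull_theta U p y)), is_derive_pull_theta_theta.
- apply (continuity_2d_pt_minus (fun p t => pull U p (c + t)) (fun p t => pull U p (c - t)));
    apply (continuity_2d_pt_pull U); auto; intros; now auto_derive.
Defined.

(** The eigenfunction [sin phi sin theta] vanishes on the boundary of the half-sphere; the
    correction with small [d] makes it positive there, and large [C] keeps it strictly
    superharmonic. *)
Definition barrier_jet (d C : R) : jet.
Proof.
pose (w := fun p t => sin p * sin t).
refine {|
  jet_val := fun p t => w p t + d * (1 - C * w p t ^ 2);
  jet_p := fun p t => (1 - 2 * d * C * w p t) * (cos p * sin t);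
  jet_pp := fun p t => - (1 - 2 * d * C * w p t) * w p t - 2 * d * C * (cos p * sin t) ^ 2;
  jet_t := fun p t => (1 - 2 * d * C * w p t) * (sin p * cos t);
  jet_tt := fun p t => - (1 - 2 * d * C * w p t) * w p t - 2 * d * C * (sin p * cos t) ^ 2 |};
  intros p t; unfold w.
- auto_derive; [easy|ring].
- auto_derive; [easy|ring].
- auto_derive; [easy|ring].
- auto_derive; [easy|ring].
- assert (W : continuity_2d_pt (fun x y => sin x * sin y) p t).
  { apply continuity_2d_pt_mult; apply (continuity_1d_2d_pt_comp sin);
      try apply continuity_2d_pt_id1; try apply continuity_2d_pt_id2; apply continuity_sin. }
  apply (continuity_1d_2d_pt_comp (fun z => z + d * (1 - C * z ^ 2)) (fun x y => sin x * sin y));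
    [|exact W].
  apply derivable_continuous_pt. apply ex_derive_Reals_0. now auto_derive.
Defined.

Section KatokZiller.
Context (eps : R) (F : vec -> vec -> R) (He : 0 < eps < 1) (HF : is_katok_ziller eps F).

(** A uniform ellipticity constant; any positive one would do. *)
Lemma coef_bounds phi : 0 < sin phi ->
  (1 - eps ^ 2) ^ 2 <= coef_phi_phi eps phi /\
  (1 - eps ^ 2) ^ 2 <= coef_theta_theta eps phi * sin phi ^ 2.
Proof.
intros Hs. destruct (coef_b_spec eps He phi) as [Hb Hb2].
pose proof (sin2_cos2 phi) as H. unfold Rsqr in H.
unfold coef_phi_phi, coef_theta_theta. set (b := coef_b eps phi) in *.
assert (H1 : b ^ 2 <= 1) by (rewrite Hb2; nra).
assert (H2 : 1 - eps ^ 2 <= b ^ 2) by (rewrite Hb2; nra).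
assert (H3 : b <= 1) by nra.
assert (H4 : 0 < 1 - eps ^ 2 <= 1) by nra.
set (e := 1 - eps ^ 2) in *. clearbody e. clearbody b.
assert (H5 : e ^ 2 * (1 + b) <= 2 * e ^ 2) by nra.
split.
- apply (Rmult_le_reg_r (1 + b)); [lra|].
  replace (2 * b ^ 2 / (1 + b) * (1 + b)) with (2 * b ^ 2) by (field; lra). nra.
- replace (2 * b ^ 3 / ((1 + b) * sin phi ^ 2) * sin phi ^ 2) with (2 * b ^ 3 / (1 + b))
    by (field; lra).
  apply (Rmult_le_reg_r (1 + b)); [lra|].
  replace (2 * b ^ 3 / (1 + b) * (1 + b)) with (2 * b ^ 3) by (field; lra).
  assert (e ^ 2 <= b ^ 4) by nra.
  assert (0 < b ^ 3) by now apply pow_lt. assert (b ^ 4 <= b ^ 3) by nra. lra.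
Qed.

(** The product [sin phi sin theta] is the coordinate function [x2]. *)
Lemma sector_harmonic phi theta : sin phi <> 0 ->
  coef_phi_phi eps phi * - (sin phi * sin theta) + coef_phi eps phi * (cos phi * sin theta)
  + coef_theta_theta eps phi * - (sin phi * sin theta)
  = - (2 - 2 * eps ^ 2) * (sin phi * sin theta).
Proof.
intros Hs. destruct (coef_b_spec eps He phi) as [Hb Hb2].
pose proof (sin2_cos2 phi) as H. unfold Rsqr in H.
unfold coef_phi_phi, coef_phi, coef_theta_theta. set (b := coef_b eps phi) in *.
assert (Ee : eps ^ 2 = (1 - b ^ 2) / sin phi ^ 2) by (rewrite Hb2; field; exact Hs).
assert (Hc : cos phi ^ 2 = 1 - sin phi ^ 2) by lra.
rewrite Ee. field_simplify_eq; [|split; [exact Hs|lra]]. rewrite Hc. ring.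
Qed.

(** Write [w] for [sin phi sin theta] and [G] for the symbol of the operator at [dw]. Since
    [w^2] has the image [2 w L w + 2 G] and [G >= k (1 - w^2)], the correction [d (1 - C w^2)]
    contributes at most [d (|mu| - 2 k C)], which is negative, plus [d C M w^2], which is
    absorbed by [(l - mu) w] when [d] is small. *)
Lemma barrier_exists (mu : R) : mu < 2 - 2 * eps ^ 2 -> exists d C,
  (forall p t, 0 <= p <= PI -> 0 <= t <= PI -> 0 < jet_val (barrier_jet d C) p t) /\
  (forall p t, 0 < p < PI -> 0 < t < PI ->
     jet_op (coef_phi_phi eps) (coef_phi eps) (coef_theta_theta eps) mu (barrier_jet d C) p t < 0).
Proof.
intros Hmu. set (l := 2 - 2 * eps ^ 2) in *. set (k := (1 - eps ^ 2) ^ 2).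
assert (Hk : 0 < k) by (apply pow_lt; nra).
assert (Hl : 0 < l) by (unfold l; nra).
set (C := Rabs mu / k + 1). set (M := 2 * l + 2 * k + Rabs mu).
pose proof (Rabs_pos mu) as Hmu0.
assert (Hq : 0 <= Rabs mu / k) by (apply Rmult_le_pos; [lra|apply Rlt_le, Rinv_0_lt_compat, Hk]).
assert (HC : 1 <= C) by (unfold C; lra).
assert (HkC : k * C = Rabs mu + k) by (unfold C; field; lra).
assert (HM : 0 < M) by (unfold M; lra).
set (d := Rmin (/ C) ((l - mu) / (C * M))).
assert (Hd1 : d * C <= 1).
{ pose proof (Rmin_l (/ C) ((l - mu) / (C * M))) as H. fold d in H.
  apply (Rmult_le_compat_r C) in H; [|lra]. rewrite Rinv_l in H by lra. exact H. }
assert (Hd2 : d * C * M <= l - mu).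
{ pose proof (Rmin_r (/ C) ((l - mu) / (C * M))) as H. fold d in H.
  apply (Rmult_le_compat_r (C * M)) in H; [|nra].
  replace ((l - mu) / (C * M) * (C * M)) with (l - mu) in H by (field; lra). lra. }
assert (Hd : 0 < d).
{ apply Rmin_pos; [apply Rinv_0_lt_compat; lra|]. apply Rdiv_lt_0_compat; [lra|nra]. }
assert (HdC : 0 < d * C) by (apply Rmult_lt_0_compat; lra).
clearbody d. exists d, C. split.
- intros p t Hp Ht. simpl jet_val.
  assert (Hw0 : 0 <= sin p * sin t) by (apply Rmult_le_pos; apply sin_ge_0; lra).
  assert (Hw1 : sin p * sin t <= 1).
  { pose proof (SIN_bound p). pose proof (SIN_bound t).
    pose proof (sin_ge_0 p (proj1 Hp) (proj2 Hp)). pose proof (sin_ge_0 t (proj1 Ht) (proj2 Ht)). nra. }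
  set (w := sin p * sin t) in *.
  replace (w + d * (1 - C * w ^ 2)) with (w * (1 - d * C * w) + d) by ring. nra.
- intros p t Hp Ht. unfold jet_op. simpl.
  pose proof (sin_gt_0 p (proj1 Hp) (proj2 Hp)) as Hs1.
  pose proof (sin_gt_0 t (proj1 Ht) (proj2 Ht)) as Hs2.
  destruct (coef_bounds p Hs1) as [HA HD]. fold k in HA, HD.
  pose proof (sector_harmonic p t ltac:(lra)) as HL. fold l in HL.
  pose proof (sin2_cos2 p) as Tp. pose proof (sin2_cos2 t) as Tt. unfold Rsqr in Tp, Tt.
  set (A := coef_phi_phi eps p) in *. set (B := coef_phi eps p) in *.
  set (D := coef_theta_theta eps p) in *.
  set (w := sin p * sin t) in *.
  assert (Hw0 : 0 < w) by now apply Rmult_lt_0_compat.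
  assert (Hw1 : w <= 1).
  { pose proof (SIN_bound p). pose proof (SIN_bound t). unfold w. nra. }
  set (G := A * (cos p * sin t) ^ 2 + D * (sin p * cos t) ^ 2).
  assert (HG : k * (1 - w ^ 2) <= G).
  { assert (E : 1 - w ^ 2 = (cos p * sin t) ^ 2 + cos t ^ 2).
    { unfold w. replace (cos t ^ 2) with (1 - sin t ^ 2) by lra.
      replace ((cos p * sin t) ^ 2) with ((cos p * cos p) * sin t ^ 2) by ring.
      replace (cos p * cos p) with (1 - sin p * sin p) by lra. ring. }
    rewrite E. unfold G. replace (D * (sin p * cos t) ^ 2) with (D * sin p ^ 2 * cos t ^ 2) by ring.
    pose proof (pow2_ge_0 (cos p * sin t)). pose proof (pow2_ge_0 (cos t)). nra. }
  replace (A * _ + B * _ + D * _ + mu * _) with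
    ((1 - 2 * d * C * w) * (A * - w + B * (cos p * sin t) + D * - w) - 2 * (d * C) * G
      + mu * (w + d * (1 - C * w ^ 2))) by (unfold G; ring).
  rewrite HL.
  assert (Hmu1 : mu * (1 - C * w ^ 2) <= Rabs mu + Rabs mu * C * w ^ 2).
  { pose proof (Rle_abs mu). pose proof (Rle_abs (- mu)). rewrite Rabs_Ropp in *.
    pose proof (pow2_ge_0 w).
    assert (- mu * (C * w ^ 2) <= Rabs mu * (C * w ^ 2))
      by (apply Rmult_le_compat_r; [apply Rmult_le_pos; lra|lra]).
    lra. }
  assert (Hww : w ^ 2 <= w) by nra.
  assert (S1 : (1 - 2 * d * C * w) * (- l * w) - 2 * (d * C) * G + mu * (w + d * (1 - C * w ^ 2))
    <= - (l - mu) * w + d * C * M * w - d * (2 * k * C - Rabs mu)).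
  { assert (P1 : d * C * (k * (1 - w ^ 2)) <= d * C * G) by (apply Rmult_le_compat_l; lra).
    assert (P2 : d * (mu * (1 - C * w ^ 2)) <= d * (Rabs mu + Rabs mu * C * w ^ 2))
      by (apply Rmult_le_compat_l; lra).
    assert (P3 : d * C * M * w ^ 2 <= d * C * M * w)
      by (apply Rmult_le_compat_l; [apply Rmult_le_pos; lra|exact Hww]).
    unfold M in P3 |- *. nra. }
  assert (S2 : d * C * M * w <= (l - mu) * w) by (apply Rmult_le_compat_r; lra).
  assert (S3 : 0 < d * (2 * k * C - Rabs mu)) by (apply Rmult_lt_0_compat; lra).
  lra.
Qed.

End KatokZiller.

Section Eigenfunction.
Context (eps : R) (U : vec -> R) (mu : R) (He : 0 < eps < 1) (HU : smooth U).
Context (Hpde : forall phi theta, sin phi <> 0 ->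
  coef_phi_phi eps phi * pull_phi_phi U phi theta + coef_phi eps phi * pull_phi U phi theta
  + coef_theta_theta eps phi * pull_theta_theta U phi theta + mu * pull U phi theta = 0).

Lemma pull_2PI phi theta : pull U phi (theta + 2 * PI) = pull U phi theta.
Proof.
unfold pull, sph. now rewrite cos_plus, sin_plus, cos_2PI, sin_2PI, !Rmult_1_r, !Rmult_0_r,
  Rminus_0_r, Rplus_0_r.
Qed.

Lemma pull_pole phi theta theta' : sin phi = 0 -> pull U phi theta = pull U phi theta'.
Proof. intros Hs. unfold pull, sph. now rewrite Hs, !Rmult_0_l. Qed.

(** The reflected function solves the same equation because the coefficients do not depend on
    [theta] and the first derivative in [theta] is absent. *)
Lemma reflection_nonpositive (c : R) : mu < 2 - 2 * eps ^ 2 ->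
  forall p t, 0 <= p <= PI -> 0 <= t <= PI -> pull U p (c + t) - pull U p (c - t) <= 0.
Proof.
intros Hmu. destruct (barrier_exists eps He mu Hmu) as (d & C & Hpos & Hop).
pose proof PI_RGT_0 as HPI.
apply (maximum_principle (coef_phi_phi eps) (coef_phi eps) (coef_theta_theta eps) mu 0 PI 0 PI
  (reflection_jet U HU c) (barrier_jet d C) HPI HPI); try assumption.
- intros p Hp. pose proof (sin_gt_0 p (proj1 Hp) (proj2 Hp)) as Hs.
  destruct (coef_bounds eps He p Hs) as [HA HD]. pose proof (pow2_ge_0 (1 - eps ^ 2)).
  split; [lra|]. assert (0 < sin p ^ 2) by now apply pow_lt. nra.
- intros p t Hp Ht. unfold jet_op. simpl.
  pose proof (sin_gt_0 p (proj1 Hp) (proj2 Hp)) as Hs.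
  pose proof (Hpde p (c + t) ltac:(lra)). pose proof (Hpde p (c - t) ltac:(lra)). lra.
- intros t _. simpl. split; apply Rminus_diag_eq, pull_pole; [apply sin_0|apply sin_PI].
- intros p _. simpl. split.
  + rewrite Rplus_0_r, Rminus_0_r. ring.
  + rewrite <- (pull_2PI p (c - PI)). replace (c - PI + 2 * PI) with (c + PI) by ring. ring.
Qed.

(** The reflection at longitude [c + PI] exchanges the two sides of the one at [c], which turns
    the inequality into an equality. *)
Lemma zonal (p t : R) : mu < 2 - 2 * eps ^ 2 ->
  0 <= p <= PI -> 0 <= t <= 2 * PI -> pull U p t = pull U p 0.
Proof.
intros Hmu Hp Ht.
pose proof (reflection_nonpositive (t / 2) Hmu p (t / 2) Hp ltac:(lra)) as H1.
pose proof (reflection_nonpositive (t / 2 + PI) Hmu p (PI - t / 2) Hp ltac:(lra)) as H2.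
replace (t / 2 + t / 2) with t in H1 by field. replace (t / 2 - t / 2) with 0 in H1 by ring.
replace (t / 2 + PI + (PI - t / 2)) with (0 + 2 * PI) in H2 by ring.
replace (t / 2 + PI - (PI - t / 2)) with t in H2 by field.
rewrite pull_2PI in H2. lra.
Qed.

Lemma is_derive_locally_const (f : R -> R) (a b x l : R) : a < x < b ->
  (forall y, a < y < b -> f y = f x) -> is_derive f x l -> l = 0.
Proof.
intros Hx Hf Hl. rewrite <- (is_derive_unique f x l Hl).
apply is_derive_unique. apply (is_derive_ext_loc (fun _ => f x)).
- assert (Hd : 0 < Rmin (x - a) (b - x)) by (apply Rmin_pos; lra).
  exists (mkposreal _ Hd). intros y Hy. symmetry. apply Hf.
  change (Rabs (y - x) < Rmin (x - a) (b - x)) in Hy. apply Rabs_def2 in Hy.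
  pose proof (Rmin_l (x - a) (b - x)). pose proof (Rmin_r (x - a) (b - x)). lra.
- apply (is_derive_const (f x) x).
Qed.

Lemma zonal_theta_theta (p : R) : mu < 2 - 2 * eps ^ 2 -> 0 <= p <= PI ->
  pull_theta_theta U p PI = 0.
Proof.
intros Hmu Hp. pose proof PI_RGT_0 as HPI.
assert (H : forall t, 0 < t < 2 * PI -> pull_theta U p t = 0).
{ intros t Ht. apply (is_derive_locally_const (fun t => pull U p t) 0 (2 * PI) t); [exact Ht| |].
  - intros y Hy. rewrite (zonal p y), (zonal p t); lra.
  - now apply is_derive_pull_theta. }
apply (is_derive_locally_const (fun t => pull_theta U p t) 0 (2 * PI) PI); [lra| |].
- intros y Hy. rewrite !H; lra.
- now apply is_derive_pull_theta_theta.
Qed.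

Lemma symmetric_critical (f : R -> R) (x l d : R) : 0 < d ->
  (forall h, 0 <= h < d -> f (x + h) = f (x - h)) -> is_derive f x l -> l = 0.
Proof.
intros Hd Hf Hl.
assert (H : is_derive (fun h => f (x + h) - f (x - h)) 0 (l - - l)).
{ apply is_derive_Rminus; [apply is_derive_shift|apply is_derive_reflect];
    now rewrite ?Rplus_0_r, ?Rminus_0_r. }
assert (l - - l = 0); [|lra].
apply (is_derive_locally_const (fun h => f (x + h) - f (x - h)) (- d) d 0); [lra| |exact H].
intros h Hh. rewrite Rplus_0_r, Rminus_0_r, Rminus_diag.
destruct (Rle_dec 0 h).
- rewrite Hf by lra. ring.
- replace (x + h) with (x - - h) by ring. replace (x - h) with (x + - h) by ring.
  rewrite Hf by lra. ring.
Qed.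

Let f (p : R) : R := pull U p PI.
Let f' (p : R) : R := pull_phi U p PI.

(** A zonal function is symmetric about the poles along the great circle through the meridian
    [PI], which continues past a pole along the meridian 0. *)
Lemma zonal_critical : mu < 2 - 2 * eps ^ 2 -> f' 0 = 0 /\ f' PI = 0.
Proof.
intros Hmu. pose proof PI_RGT_0 as HPI.
split.
- apply (symmetric_critical f 0 (f' 0) PI HPI); [|now apply is_derive_pull_phi].
  intros h Hh. unfold f. rewrite Rplus_0_l, Rminus_0_l, (zonal h PI) by lra.
  unfold pull, sph. rewrite sin_neg, cos_neg, cos_PI, sin_PI, cos_0, sin_0.
  apply (f_equal U). repeat apply (f_equal2 pair); ring.
- apply (symmetric_critical f PI (f' PI) PI HPI); [|now apply is_derive_pull_phi].
  intros h Hh. unfold f. rewrite (zonal (PI - h) PI) by lra.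
  unfold pull, sph. rewrite sin_plus, cos_plus, sin_minus, cos_minus, cos_PI, sin_PI, cos_0, sin_0.
  apply (f_equal U). repeat apply (f_equal2 pair); ring.
Qed.

(** Picone's identity. In the self-adjoint form [(P f')' = - mu W f] of the zonal equation,
    [P = 2 sin / (b (1 + b))] and [W = sin / b^3]. The flux [z = P f'] solves
    [(z' / W)' = - mu z / P], and the flux of the eigenfunction [- cos phi], of eigenvalue 2, is
    the positive solution [P sin] of the same equation with 2 for [mu]. The quantity
    differentiated is [z z' / W - z^2 (P sin)' / (W P sin)]. *)
Lemma is_derive_picone (p : R) : mu < 2 - 2 * eps ^ 2 -> 0 < p < PI ->
  let b := coef_b eps in
  is_derive (fun p => - (2 / (b p * (1 + b p))) * (mu * sin p * f p * f' p + 2 * cos p * f' p ^ 2)) p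
    (sin p / b p ^ 3 * (mu * f p + 2 * cos p * f' p / sin p) ^ 2
     + (2 - mu) * (2 * sin p / (b p * (1 + b p))) * f' p ^ 2).
Proof.
intros Hmu Hp b. pose proof (sin_gt_0 p (proj1 Hp) (proj2 Hp)) as Hs.
destruct (coef_b_spec eps He p) as [Hb Hb2]. fold b in Hb, Hb2.
pose proof (Hpde p PI ltac:(lra)) as E. rewrite zonal_theta_theta in E by lra.
pose proof (is_derive_pull_phi U HU p PI) as D1. pose proof (is_derive_pull_phi_phi U HU p PI) as D2.
change (is_derive f p (f' p)) in D1. change (is_derive f' p (pull_phi_phi U p PI)) in D2.
change (pull_phi U p PI) with (f' p) in E. change (pull U p PI) with (f p) in E.
set (f2 := pull_phi_phi U p PI) in *. clearbody f f' f2.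
pose proof (is_derive_unique _ _ _ D1) as U1. pose proof (is_derive_unique _ _ _ D2) as U2.
assert (X1 : ex_derive f p) by now exists (f' p). assert (X2 : ex_derive f' p) by now exists f2.
assert (Db : is_derive b p (- eps ^ 2 * sin p * cos p / b p)).
{ unfold b, coef_b. pose proof (eps_sin_bound eps He p) as Ha.
  assert (Er : 1 + - (eps * sin p * (eps * sin p * 1)) = 1 - (eps * sin p) ^ 2) by ring.
  auto_derive; [rewrite Er; auto|]. rewrite Er. fold (coef_b eps p). fold b. field. lra. }
pose proof (is_derive_unique _ _ _ Db) as Ub.
assert (Xb : ex_derive b p) by (eexists; exact Db).
assert (Ef : f2 = (- mu * f p - coef_phi eps p * f' p) / coef_phi_phi eps p).
{ assert (0 < coef_phi_phi eps p).
  { unfold coef_phi_phi. fold b. apply Rdiv_lt_0_compat; [|lra].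
    assert (0 < b p ^ 2) by now apply pow_lt. lra. }
  apply (Rmult_eq_reg_l (coef_phi_phi eps p)); [|lra]. field_simplify; lra. }
assert (Ee : eps ^ 2 = (1 - b p ^ 2) / sin p ^ 2) by (rewrite Hb2; field; lra).
auto_derive.
- repeat split; auto. apply Rgt_not_eq. apply Rmult_lt_0_compat; lra.
- change (fun x => f x) with f. change (fun x => f' x) with f'. change (fun x => b x) with b.
  rewrite U1, U2, Ub, Ef. unfold coef_phi, coef_phi_phi. fold b. rewrite Ee.
  field. repeat split; lra.
Qed.

(** The quantity of the preceding lemma vanishes at the poles and is nondecreasing between them,
    so its derivative, a sum of two squares with positive weights, is zero. *)
Lemma zonal_vanishes (p : R) : mu < 2 - 2 * eps ^ 2 -> mu <> 0 -> 0 <= p <= PI -> f p = 0.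
Proof.
intros Hmu Hmu0. pose proof PI_RGT_0 as HPI.
set (b := coef_b eps). destruct (zonal_critical Hmu) as [Z0 Z1].
set (H := fun p => - (2 / (b p * (1 + b p))) * (mu * sin p * f p * f' p + 2 * cos p * f' p ^ 2)).
assert (HH : forall x, ex_derive H x).
{ intros x. destruct (coef_b_spec eps He x) as [Hb _]. fold b in Hb.
  assert (X1 : ex_derive f x) by (eexists; exact (is_derive_pull_phi U HU x PI)).
  assert (X2 : ex_derive f' x) by (eexists; exact (is_derive_pull_phi_phi U HU x PI)).
  assert (Xb : ex_derive b x).
  { unfold b, coef_b. pose proof (eps_sin_bound eps He x) as Ha. auto_derive.
    eapply Rlt_le_trans; [exact Ha|]. right. ring. }
  clearbody f f'. unfold H. auto_derive. repeat split; auto.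
  apply Rgt_not_eq. apply Rmult_lt_0_compat; lra. }
assert (HD : forall x, 0 < x < PI -> 0 <= Derive H x /\ (Derive H x = 0 -> f' x = 0 /\ f x = 0)).
{ intros x Hx. pose proof (sin_gt_0 x (proj1 Hx) (proj2 Hx)) as Hs.
  destruct (coef_b_spec eps He x) as [Hb _].
  pose proof (is_derive_unique H x _ (is_derive_picone x Hmu Hx)) as ED. fold b in Hb, ED.
  rewrite ED. clear ED. set (W := sin x / b x ^ 3). set (P := 2 * sin x / (b x * (1 + b x))).
  assert (HW : 0 < W) by (apply Rdiv_lt_0_compat; [exact Hs|now apply pow_lt]).
  assert (HP : 0 < P) by (apply Rdiv_lt_0_compat; [lra|apply Rmult_lt_0_compat; lra]).
  assert (Hm : 0 < 2 - mu) by (pose proof (pow2_ge_0 eps); lra).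
  set (g := mu * f x + 2 * cos x * f' x / sin x).
  assert (I1 : 0 <= W * g ^ 2) by (apply Rmult_le_pos; [lra|apply pow2_ge_0]).
  assert (HmP : 0 < (2 - mu) * P) by now apply Rmult_lt_0_compat.
  assert (I2 : 0 <= (2 - mu) * P * f' x ^ 2) by (apply Rmult_le_pos; [lra|apply pow2_ge_0]).
  split; [lra|]. intros E.
  assert (E1 : f' x = 0).
  { assert (E1 : (2 - mu) * P * f' x ^ 2 = 0) by lra.
    apply Rmult_integral in E1. destruct E1 as [E1 | E1]; [lra|]. nra. }
  assert (E2 : g = 0).
  { assert (E2 : W * g ^ 2 = 0) by lra.
    apply Rmult_integral in E2. destruct E2 as [E2 | E2]; [lra|]. nra. }
  split; [exact E1|]. unfold g in E2. rewrite E1 in E2.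
  apply (Rmult_eq_reg_l mu); [|exact Hmu0]. rewrite Rmult_0_r, <- E2 at 1. field. lra. }
assert (HM : forall x y, 0 <= x -> x < y -> y <= PI -> H x <= H y).
{ intros x y Hx Hxy Hy.
  destruct (MVT_cor2 H (Derive H) x y Hxy) as (z & Hz & Hzb).
  { intros c _. apply is_derive_Reals, Derive_correct, HH. }
  destruct (HD z ltac:(lra)) as [HDz _]. nra. }
assert (H0 : H 0 = 0) by (unfold H; rewrite Z0; ring).
assert (H1 : H PI = 0) by (unfold H; rewrite Z1; ring).
assert (HZ : forall x, 0 < x < PI -> H x = 0).
{ intros x Hx. pose proof (HM 0 x ltac:(lra) ltac:(lra) ltac:(lra)).
  pose proof (HM x PI ltac:(lra) ltac:(lra) ltac:(lra)). lra. }
assert (Hint : forall x, 0 < x < PI -> f' x = 0 /\ f x = 0).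
{ intros x Hx. apply (HD x Hx).
  apply (is_derive_locally_const H 0 PI x); [exact Hx| |apply Derive_correct, HH].
  intros y Hy. now rewrite (HZ y Hy), (HZ x Hx). }
assert (Hconst : forall x y, 0 <= x -> x < y -> y <= PI -> f x = f y).
{ intros x y Hx Hxy Hy.
  destruct (MVT_cor2 f f' x y Hxy) as (z & Hz & Hzb).
  { intros c _. apply is_derive_Reals. now apply is_derive_pull_phi. }
  destruct (Hint z ltac:(lra)) as [E _]. rewrite E in Hz. lra. }
assert (Hmid : f (PI / 2) = 0) by (apply Hint; lra).
intros Hp. destruct (Rtotal_order p (PI / 2)) as [Hlt | [-> | Hgt]]; [|exact Hmid|].
- rewrite (Hconst p (PI / 2)); lra.
- rewrite <- (Hconst (PI / 2) p); lra.
Qed.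

End Eigenfunction.

Section KatokZiller.
Context (eps : R) (F : vec -> vec -> R) (He : 0 < eps < 1) (HF : is_katok_ziller eps F).

Lemma eigenvalue_lower_bound (mu : R) : is_eigenvalue F mu -> mu <> 0 -> 2 - 2 * eps ^ 2 <= mu.
Proof.
intros (u & (U & HU & Hu) & (x & Hx & Hux) & Heig) Hmu0.
apply Rnot_lt_le. intros Hmu. apply Hux.
assert (HS2 : forall phi theta, S2 (sph phi theta)) by (intros; apply spherical_frame).
assert (Hpde : forall phi theta, sin phi <> 0 ->
  coef_phi_phi eps phi * pull_phi_phi U phi theta + coef_phi eps phi * pull_phi U phi theta
  + coef_theta_theta eps phi * pull_theta_theta U phi theta + mu * pull U phi theta = 0).
{ intros phi theta Hs. pose proof (Heig _ (HS2 phi theta)) as E.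
  rewrite (laplacian_spherical eps F He HF U HU u phi theta Hu Hs), (Hu _ (HS2 phi theta)) in E.
  unfold pull. lra. }
destruct (sph_tangent_surj x (0, 0, 0) Hx) as (phi & theta & _ & _ & Hphi & Htheta & -> & _).
{ destruct x as [[x1 x2] x3]. unfold TS2, dot. ring. }
rewrite Hu by exact Hx. pose proof PI_RGT_0.
change (pull U phi theta = 0). rewrite (zonal eps U mu He HU Hpde phi theta Hmu Hphi Htheta).
rewrite <- (zonal eps U mu He HU Hpde phi PI Hmu Hphi) by lra.
exact (zonal_vanishes eps U mu He HU Hpde phi Hmu Hmu0 Hphi).
Qed.

End KatokZiller.

Theorem theorem2 (eps : R) (F : R * R * R -> R * R * R -> R)
    (heps : 0 < eps < 1) (hF : is_katok_ziller eps F) :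
  is_smallest_nonzero_eigenvalue F (2 - 2 * eps ^ 2) /\
  2 - 2 * eps ^ 2 = 8 * PI / volume F.
Proof.
split; [split; [|split]|].
- exact (first_coordinate_eigenfunction eps F heps hF).
- nra.
- intros mu Hmu Hmu0. exact (eigenvalue_lower_bound eps F heps hF mu Hmu Hmu0).
- rewrite (volume_eq eps F heps hF). pose proof PI_RGT_0. field. split; nra.
Qed.
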